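(* Let $l\ge 1$. The $\mathbb{C}$-derivation $\partial$ of $\mathcal{K}_l$ defined through the Hamiltonian $H_0$ (see context) commutes with the action on $\mathcal{K}_l$ of the extended affine Weyl group $\widetilde{W}=\langle s_0,\ldots,s_l,\pi\rangle$ of type $A_l^{(1)}$ given by the automorphisms $s_0,\ldots,s_l,\pi$ listed in the context; i.e. $\partial(w(\varphi))=w(\partial\varphi)$ for all $w\in\widetilde W$ and $\varphi\in\mathcal{K}_l$.
   Context: **The skew fields $\mathcal{K}_l$.** Commutators are $[a,b]=ab-ba$. For $l=1$, $\mathcal{K}_1$ is the quotient skew field of the Ore domain over $\mathbb{C}$ with generators $f_0,f_1,f_2,\alpha_0,\alpha_1,h$ and relations $[f_1,f_0]=2hf_2$, $[f_0,f_2]=[f_2,f_1]=h$, with $\alpha_0,\alpha_1,h$ central. For $l\ge 2$, $\mathcal{K}_l$ is the quotient skew field of the Ore domain over $\mathbb{C}$ with generators $f_i,\alpha_i$ ($0\le i\le l$), $h$ and relations $[f_i,f_{i+1}]=h$, $[f_i,f_j]=0$ ($j\ne i\pm1$), with all $\alpha_i$ and $h$ central; indices are in $\Gamma:=\mathbb{Z}/(l+1)\mathbb{Z}$. **Notation for the Hamiltonian.** $\varpi_0=0$ and $\varpi_i=\sum_{r=1}^l\big(\min\{i,r\}-\frac{ir}{l+1}\big)\alpha_r$ for $1\le i\le l$ (index of $\varpi$ read in $\Gamma$). For $1\le m\le l$ let $C_{i,m}=\{i,i+1,\ldots,i+m-1\}\subset\Gamma$, $\chi(C_{i,m})=\varpi_i-\varpi_{i+1}+\cdots+(-1)^{m-1}\varpi_{i+m-1}$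 and $f_{C_{i,m}}=f_if_{i+1}\cdots f_{i+m-1}$ (in this cyclic order). A proper subset $C\subset\Gamma$ is uniquely a disjoint union of maximal cyclic intervals $C_{i,m_i}$ (its connected components, of length $m_i$); put $\chi(C)=\sum_i\chi(C_{i,m_i})$ and $f_C=\prod_i f_{C_{i,m_i}}$ (the factors of different components commute). For $d\ge 1$ let $S_d$ be the set of subsets $K\subset\Gamma$ with $|K|=d$ such that every connected component of $\Gamma\setminus K$ has even length. **Hamiltonian $H_0$.** - $l=1$: $H_0=\frac12(f_0f_1+f_1f_0)+\alpha_1f_2$. - $l=2$: $H_0=f_0f_1f_2+hf_1+\sum_{K\in S_1}\chi(\Gamma\setminus K)f_K$. - $l=2n$, $n\ge2$: $H_0=\sum_{K\in S_3}f_K+\sum_{K\in S_1}\chi(\Gamma\setminus K)f_K$. - $l=3$: $H_0=f_0f_1f_2f_3+hf_1f_2+\sum_{K\in S_2}\chi(\Gamma\setminus K)f_K+\big(\sum_{i=1}^3(-1)^{i-1}\varpi_i\big)^2$. - $l=2n+1$, $n\ge2$: $H_0=\sum_{K\in S_4}f_K+\sum_{K\in S_2}\chi(\Gamma\setminus K)f_K+\big(\sum_{i=1}^l(-1)^{i-1}\varpi_i\big)^2$. **Derivation $\partial$.** With $k=\alpha_0+\cdots+\alpha_l$, $\partial$ is the $\mathbb{C}$-derivation of $\mathcal{K}_l$ determined by $\partial\alpha_i=\frac1h[H_0,\alpha_i]$, $\partial h=\frac1h[H_0,h]$ and - for $l=1$ or $l=2n$: $\partial f_i=\frac1h[H_0,f_i]+\delta_{i,0}k$;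 - for $l=2n+1$, $n\ge1$: $\partial f_i=\frac1h[H_0,f_i]-(-1)^i\frac k2f_i+\delta_{i,0}kx_0$, where $x_0=f_0+f_2+\cdots+f_{l-1}$ (a central element). **Action of $\widetilde W$.** The automorphisms $s_0,\ldots,s_l,\pi\in\mathrm{Aut}_{\mathbb{C}}\mathcal{K}_l$ are as follows. All fix $h$. For $l=1$: $s_0(f_0)=f_0$, $s_0(f_1)=f_1-f_2\frac{\alpha_0}{f_0}-\frac{\alpha_0}{f_0}f_2-\frac{\alpha_0^2}{f_0^2}$, $s_0(f_2)=f_2+\frac{\alpha_0}{f_0}$; $s_1(f_0)=f_0+f_2\frac{\alpha_1}{f_1}+\frac{\alpha_1}{f_1}f_2-\frac{\alpha_1^2}{f_1^2}$, $s_1(f_1)=f_1$, $s_1(f_2)=f_2-\frac{\alpha_1}{f_1}$; $s_0(\alpha_0)=-\alpha_0$, $s_0(\alpha_1)=\alpha_1+2\alpha_0$, $s_1(\alpha_0)=\alpha_0+2\alpha_1$, $s_1(\alpha_1)=-\alpha_1$; $\pi(f_0)=f_1$, $\pi(f_1)=f_0$, $\pi(f_2)=-f_2$, $\pi(\alpha_0)=\alpha_1$, $\pi(\alpha_1)=\alpha_0$. For $l\ge2$ ($i,j\in\mathbb{Z}/(l+1)\mathbb{Z}$): $s_i(f_j)=f_j+\frac{\alpha_i}{f_i}u_{ij}$, $s_i(\alpha_j)=\alpha_j-\alpha_ia_{ij}$, $\pi(f_j)=f_{j+1}$, $\pi(\alpha_j)=\alpha_{j+1}$, where $a_{ii}=2$,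 $a_{i,i\pm1}=-1$, $a_{ij}=0$ otherwise, and $u_{i,i\pm1}=\pm1$, $u_{ij}=0$ otherwise. *)

(* Defs.v *)
From HB Require Import structures.
From mathcomp Require Import all_boot all_order all_algebra.
From mathcomp Require Import reals.
From mathcomp.real_closed Require Import complex.
From mathcomp.multinomials Require Import monalg.

Set Implicit Arguments.
Unset Strict Implicit.
Unset Printing Implicit Defensive.

Import Order.TTheory GRing.Theory Num.Theory.
Local Open Scope ring_scope.

Definition commutator (A : pzRingType) (x y : A) : A := x * y - y * x.

(* Throughout, l >= 1; the value of definitions by cases at l = 0 is junk.

   The cyclic index set Gamma = Z/(l+1)Z is 'I_l.+1; i + 1 and i - 1 are
   ordS i and ord_pred i (for l = 1 they coincide).                           *)
Definition shift (l : nat) (i : 'I_l.+1) (m : nat) : 'I_l.+1 :=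
  iter m (@ordS l.+1) i.


(* For l = 1 there are three generators f_0, f_1, f_2 but only two alphas.    *)
Definition nf (l : nat) : nat := if l == 1%N then 3 else l.+1.

Definition gen (l : nat) : choiceType := ('I_(nf l) + 'I_l.+1 + unit)%type.

Definition genf (l : nat) (i : 'I_(nf l)) : gen l := inl (inl i).
Definition gena (l : nat) (i : 'I_l.+1) : gen l := inl (inr i).
Definition genh (l : nat) : gen l := inr tt.

(* Elements x of A such that "x = 0" is a defining relation, for given values
   of the generators in A.                                                    *)
Section Relators.
Variable A : pzRingType.

Inductive relator_one (f : 'I_3 -> A) (a : 'I_2 -> A) (h : A) : A -> Prop :=
| relator_one10 : relator_one f a h (commutator (f 1) (f 0) - 2 * h * f 2)
| relator_one02 : relator_one f a h (commutator (f 0) (f 2) - h)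
| relator_one21 : relator_one f a h (commutator (f 2) (f 1) - h)
| relator_one_af i j : relator_one f a h (commutator (a i) (f j))
| relator_one_aa i j : relator_one f a h (commutator (a i) (a j))
| relator_one_ah i : relator_one f a h (commutator (a i) h)
| relator_one_hf j : relator_one f a h (commutator h (f j)).

Inductive relator_ge2 (l : nat) (f a : 'I_l.+1 -> A) (h : A) : A -> Prop :=
| relator_ge2_next i : relator_ge2 f a h (commutator (f i) (f (ordS i)) - h)
| relator_ge2_far i j : j != ordS i -> j != ord_pred i ->
    relator_ge2 f a h (commutator (f i) (f j))
| relator_ge2_af i j : relator_ge2 f a h (commutator (a i) (f j))
| relator_ge2_aa i j : relator_ge2 f a h (commutator (a i) (a j))
| relator_ge2_ah i : relator_ge2 f a h (commutator (a i) h)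
| relator_ge2_hf j : relator_ge2 f a h (commutator h (f j)).

Definition relator (l : nat) :
    ('I_(nf l) -> A) -> ('I_l.+1 -> A) -> A -> A -> Prop :=
  match l with
  | 0 => fun _ _ _ _ => False
  | 1 => fun f a h => relator_one f a h
  | n.+2 => fun f a h => @relator_ge2 n.+2 f a h
  end.

Inductive two_sided_ideal (S : A -> Prop) : A -> Prop :=
| ideal_gen x : S x -> two_sided_ideal S x
| ideal_0 : two_sided_ideal S 0
| ideal_add x y :
    two_sided_ideal S x -> two_sided_ideal S y -> two_sided_ideal S (x + y)
| ideal_mull c x : two_sided_ideal S x -> two_sided_ideal S (c * x)
| ideal_mulr c x : two_sided_ideal S x -> two_sided_ideal S (x * c).

End Relators.

Section SkewField.
Variables (C : comNzRingType) (l : nat).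

(* The free associative algebra C<f_i, alpha_i, h>: the monoid algebra of the
   free monoid on the generators.                                             *)
Definition free_alg : lalgType C := {malg C[{fmonom (gen l)}]}.

Definition free_gen (g : gen l) : free_alg :=
  (mkmalgU (fmu g) 1 : {malg C[{fmonom (gen l)}]}).

Definition relation_ideal : free_alg -> Prop :=
  two_sided_ideal (relator (fun i => free_gen (genf i))
                           (fun i => free_gen (gena i)) (free_gen (genh l))).

(* K, together with ev, is a quotient skew field of the algebra presented by
   the generators and relations: the image of ev is this algebra (its kernel
   is the ideal of relations), K is a skew field, and every element of K is a
   fraction of elements of the image.  This determines (K, ev) up to a unique
   isomorphism.                                                               *)
Record is_quotient_skew_field (K : unitAlgType C)
    (ev : {lrmorphism free_alg -> K}) : Prop := IsQuotientSkewField {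
  qsf_ker : forall p, ev p = 0 <-> relation_ideal p;
  qsf_unit : forall x : K, x != 0 -> x \is a GRing.unit;
  qsf_frac : forall x : K, exists p q, ev q != 0 /\ x = ev p / ev q
}.

End SkewField.


Section Arcs.
Variable l : nat.
Implicit Types (i : 'I_l.+1) (m d : nat) (C K : {set 'I_l.+1}).

(* C_{i,m} = {i, i+1, ..., i+m-1} *)
Definition arc i m : {set 'I_l.+1} := [set shift i j | j : 'I_m].

(* For a proper subset C and 1 <= m <= l: C_{i,m} is a maximal cyclic interval
   contained in C.                                                            *)
Definition component C i m : bool :=
  [&& arc i m \subset C, ord_pred i \notin C & shift i m \notin C].

Definition Sset d : {set {set 'I_l.+1}} :=
  [set K : {set 'I_l.+1} | (#|K| == d) &&
    [forall i, forall m : 'I_l.+1,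
       (0 < m)%N && component (~: K) i m ==> ~~ odd m]].

End Arcs.

Section Hamiltonian.
Variables (R : realType) (K : unitAlgType R[i]).

Definition half : R[i] := 2^-1.

Section Cyclic.
Variables (l : nat) (f a : 'I_l.+1 -> K) (h : K).

(* The coefficients vanish when i = 0, so varpi 0 = 0. *)
Definition varpi (i : 'I_l.+1) : K :=
  \sum_(r < l.+1 | (0 < r)%N)
    ((minn i r)%:R - (i * r)%:R / l.+1%:R : R[i]) *: a r.

Definition chi_arc (i : 'I_l.+1) (m : nat) : K :=
  \sum_(j < m) (-1) ^+ j * varpi (shift i j).

Definition f_arc (i : 'I_l.+1) (m : nat) : K := \prod_(j < m) f (shift i j).

Definition chi (C : {set 'I_l.+1}) : K :=
  \sum_(i < l.+1) \sum_(1 <= m < l.+1 | component C i m) chi_arc i m.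

(* Factors of different components commute, so their order is immaterial. *)
Definition f_set (C : {set 'I_l.+1}) : K :=
  \prod_(i < l.+1) \prod_(1 <= m < l.+1 | component C i m) f_arc i m.

Definition H0_ge2 : K :=
  let F k := f (inord k) in
  let quad d := \sum_(S in Sset l d) chi (~: S) * f_set S in
  let Z := (\sum_(i < l.+1 | (0 < i)%N) (-1) ^+ i.-1 * varpi i) ^+ 2 in
  if l == 2%N then F 0%N * F 1%N * F 2%N + h * F 1%N + quad 1%N
  else if l == 3%N then
    F 0%N * F 1%N * F 2%N * F 3%N + h * F 1%N * F 2%N + quad 2%N + Z
  else if ~~ odd l then \sum_(S in Sset l 3) f_set S + quad 1%N
  else \sum_(S in Sset l 4) f_set S + quad 2%N + Z.

End Cyclic.

Definition H0_one (f : 'I_3 -> K) (a : 'I_2 -> K) : K :=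
  half *: (f 0 * f 1 + f 1 * f 0) + a 1 * f 2.


Definition bracket (h H x : K) : K := h^-1 * commutator H x.

Definition deriv_f_one (f : 'I_3 -> K) (a : 'I_2 -> K) (h : K)
    (D : K -> K) : Prop :=
  forall i : 'I_3,
    D (f i) = bracket h (H0_one f a) (f i) + (i == 0)%:R * \sum_j a j.

Definition deriv_f_ge2 (l : nat) (f a : 'I_l.+1 -> K) (h : K)
    (D : K -> K) : Prop :=
  let k := \sum_j a j in
  let x0 := \sum_(j < l.+1 | ~~ odd j) f j in
  forall i : 'I_l.+1,
    D (f i) = if ~~ odd l
      then bracket h (H0_ge2 f a h) (f i) + (i == ord0)%:R * k
      else bracket h (H0_ge2 f a h) (f i)
             - (-1) ^+ i * (half *: k) * f i + (i == ord0)%:R * (k * x0).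

Definition cartan (l : nat) (i j : 'I_l.+1) : int :=
  if j == i then 2
  else if (j == ordS i) || (j == ord_pred i) then -1 else 0.

Definition orient (l : nat) (i j : 'I_l.+1) : int :=
  if j == ordS i then 1 else if j == ord_pred i then -1 else 0.

Record weyl_action_one (f : 'I_3 -> K) (a : 'I_2 -> K) (h : K)
    (s : 'I_2 -> K -> K) (pi : K -> K) : Prop := WeylActionOne {
  one_s0f0 : s 0 (f 0) = f 0;
  one_s0f1 : s 0 (f 1) = f 1 - f 2 * (a 0 / f 0) - a 0 / f 0 * f 2
                         - a 0 ^+ 2 / f 0 ^+ 2;
  one_s0f2 : s 0 (f 2) = f 2 + a 0 / f 0;
  one_s1f0 : s 1 (f 0) = f 0 + f 2 * (a 1 / f 1) + a 1 / f 1 * f 2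
                         - a 1 ^+ 2 / f 1 ^+ 2;
  one_s1f1 : s 1 (f 1) = f 1;
  one_s1f2 : s 1 (f 2) = f 2 - a 1 / f 1;
  one_s0a0 : s 0 (a 0) = - a 0;
  one_s0a1 : s 0 (a 1) = a 1 + 2 * a 0;
  one_s1a0 : s 1 (a 0) = a 0 + 2 * a 1;
  one_s1a1 : s 1 (a 1) = - a 1;
  one_pif0 : pi (f 0) = f 1;
  one_pif1 : pi (f 1) = f 0;
  one_pif2 : pi (f 2) = - f 2;
  one_pia0 : pi (a 0) = a 1;
  one_pia1 : pi (a 1) = a 0;
  one_sh : forall i, s i h = h;
  one_pih : pi h = h
}.

Record weyl_action_ge2 (l : nat) (f a : 'I_l.+1 -> K) (h : K)
    (s : 'I_l.+1 -> K -> K) (pi : K -> K) : Prop := WeylActionGe2 {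
  ge2_sf : forall i j, s i (f j) = f j + a i / f i *~ orient i j;
  ge2_sa : forall i j, s i (a j) = a j - a i *~ cartan i j;
  ge2_pif : forall j, pi (f j) = f (ordS j);
  ge2_pia : forall j, pi (a j) = a (ordS j);
  ge2_sh : forall i, s i h = h;
  ge2_pih : pi h = h
}.

Definition H0 (l : nat) :
    ('I_(nf l) -> K) -> ('I_l.+1 -> K) -> K -> K :=
  match l with
  | 0 => fun _ _ _ => 0
  | 1 => fun f a _ => H0_one f a
  | n.+2 => fun f a h => @H0_ge2 n.+2 f a h
  end.

Definition deriv_f (l : nat) :
    ('I_(nf l) -> K) -> ('I_l.+1 -> K) -> K -> (K -> K) -> Prop :=
  match l with
  | 0 => fun _ _ _ _ => True
  | 1 => fun f a h D => deriv_f_one f a h D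
  | n.+2 => fun f a h D => @deriv_f_ge2 n.+2 f a h D
  end.

Definition weyl_action (l : nat) :
    ('I_(nf l) -> K) -> ('I_l.+1 -> K) -> K ->
    ('I_l.+1 -> K -> K) -> (K -> K) -> Prop :=
  match l with
  | 0 => fun _ _ _ _ _ => True
  | 1 => fun f a h s pi => weyl_action_one f a h s pi
  | n.+2 => fun f a h s pi => @weyl_action_ge2 n.+2 f a h s pi
  end.

Record is_hamiltonian_derivation (l : nat) (f : 'I_(nf l) -> K)
    (a : 'I_l.+1 -> K) (h : K) (D : K -> K) : Prop :=
  IsHamiltonianDerivation {
  hd_linear : linear D;
  hd_leibniz : forall x y, D (x * y) = D x * y + x * D y;
  hd_a : forall i, D (a i) = bracket h (H0 f a h) (a i);
  hd_h : D h = bracket h (H0 f a h) h;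
  hd_f : deriv_f f a h D
}.

End Hamiltonian.

Inductive generated_group (T : Type) (S : (T -> T) -> Prop) :
    (T -> T) -> Prop :=
| generated_in g : S g -> generated_group S g
| generated_id : generated_group S id
| generated_comp g1 g2 : generated_group S g1 -> generated_group S g2 ->
    generated_group S (g1 \o g2)
| generated_inv g g' : generated_group S g -> cancel g g' -> cancel g' g ->
    generated_group S g'.

(* The group generated by s_0, ..., s_l and pi, as a group of bijections of T. *)
Definition extended_affine_weyl_group (T : Type) (l : nat) (s : 'I_l.+1 -> T -> T)
    (pi : T -> T) : (T -> T) -> Prop :=
  generated_group (fun g => (exists i, g = s i) \/ g = pi).

(* Main.v *)
Require Import Defs.
From HB Require Import structures.
From mathcomp Require Import all_boot all_order all_algebra.
From mathcomp Require Import reals.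
From mathcomp.real_closed Require Import complex.
From mathcomp.multinomials Require Import monalg.
From mathcomp Require Import zify ring.
From Stdlib Require Ncring Ncring_tac.

Set Implicit Arguments.
Unset Strict Implicit.
Unset Printing Implicit Defensive.

Import Order.TTheory GRing.Theory Num.Theory.
Local Open Scope ring_scope.

(** Write [D = h^-1 [H_0, .] + D'].  The derivation [D'] (called [outer] below)
    kills [h] and the [alpha_i], and it sends [f_i] to an explicit expression of
    degree at most one in the [f_j].  Hence an automorphism [w] that fixes [h]
    commutes with [D] as soon as
    [h^-1 [w H_0 - H_0, w x] = D' (w x) - w (D' x)] for the generators [x]
    ([commutes_through_bracket], [commutes_of_gens]).  Here [h] is invertible
    because it does not vanish: the defining relations have a representation by
    Heisenberg matrices in which [h] acts by a nonzero corner matrix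
    ([genh_not_relation]).

    The relation [s_(i+1) pi = pi s_i] shows that it suffices to treat the rotation
    [pi] and one reflection, for which [s_1] is convenient.

    For [s_1], the element [s_1 H_0 - H_0] is central, and [D'] commutes with [s_1].
    For [pi], one finds [pi H_0 - H_0 = k Xi + z] with [z] central and [Xi] the sum
    of the [f_x] over even [x > 0] when [l] is even, and the sum of the [f_x f_y]
    over [2 <= x < y] with [x] even and [y] odd when [l] is odd.  The commutators of
    [Xi] with the [f_j] are exactly what makes up for the failure of [D'] to
    commute with [pi].

    Both computations of the action on [H_0] are carried out after cutting the
    cycle [Z/(l+1)] in front of [0].  A set of [d] elements, with [d] congruent to
    [l + 1] modulo [2], has a complement with even components if and only if its
    elements, listed in increasing order, alternate in parity ([mem_Sset]).  The
    product [f_K] is the increasing product of its letters, up to a correction by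
    [h] when [K] contains both [0] and [l] ([f_set_cut], [f_set_wrap]).  The
    coefficients [chi] are alternating sums of the [varpi_i].  Thus [H_0] is, up to
    a central element, a sum over alternating words with explicit lower terms, and
    this also covers the special formulas for [l = 2] and [l = 3] ([H0_even],
    [H0_odd]).  In this form [s_1] affects only the letters [0], [1] and [2], while
    [pi] moves one letter from one end of the words to the other.

    For [l = 1] the same argument applies directly to the quadratic [H_0], with
    [Xi = - f_2]. *)

(** * Identities in noncommutative rings *)

#[local] Instance ncring_ops (A : pzRingType) :
  @Ncring.Ring_ops A 0 1 +%R *%R (fun x y => x - y) -%R (@eq A) := {}.

#[local] Instance ncring_ring (A : pzRingType) :
  @Ncring.Ring A _ _ _ _ _ _ _ (ncring_ops A).
Proof.
split.
- exact: RelationClasses.eq_equivalence.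
- by move=> x _ <- y _ <-.
- by move=> x _ <- y _ <-.
- by move=> x _ <- y _ <-.
- by move=> x _ <-.
- exact: add0r.
- exact: addrC.
- exact: addrA.
- exact: mul1r.
- exact: mulr1.
- exact: mulrA.
- exact: mulrDl.
- by move=> *; exact: mulrDr.
- by [].
- exact: subrr.
Qed.

Ltac ncring := Ncring_tac.non_commutative_ring.

(** * Sums over words of alternating parity *)

Section Words.
Variable A : pzRingType.
Implicit Types (F : nat -> A) (d s n : nat) (p : bool) (z h : A).

(** The sum of the products [F x_1 * ... * F x_d] over the words
    [s <= x_1 < ... < x_d < s + n] whose letters alternate in parity and start
    with parity [p].  The recursion decides on the leftmost position, so that
    the letters at the left end can be split off by simplification. *)
Fixpoint word_sum F d p s n : A :=
  if n is n'.+1 then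
    word_sum F d p s.+1 n' +
    (if d is d'.+1 then
       if odd s == p then F s * word_sum F d' (~~ p) s.+1 n' else 0
     else 0)
  else (d == 0)%:R.

Lemma word_sum0 F p s n : word_sum F 0 p s n = 1.
Proof. by elim: n s => //= n IHn s; rewrite IHn addr0. Qed.

Lemma word_sumS F d p s n : word_sum F d.+1 p s n.+1 =
  word_sum F d.+1 p s.+1 n +
  (if odd s == p then F s * word_sum F d (~~ p) s.+1 n else 0).
Proof. by []. Qed.

(** The same recursion from the right end: a word of length [d.+1] starting with
    parity [p] ends with parity [p (+) odd d]. *)
Lemma word_sum_rcons F d p s n : word_sum F d.+1 p s n.+1 =
  word_sum F d.+1 p s n +
  (if odd (s + n) == p (+) odd d then word_sum F d p s n * F (s + n)%N else 0).
Proof.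
elim: n d p s => [|n IHn] d p s.
  case: d => [|d] /=; rewrite addn0 ?addbF ?add0r ?mulr1 ?mul1r //.
  by rewrite mulr0 mul0r !if_same.
rewrite [LHS]word_sumS {1}IHn [in RHS]word_sumS addSnnS -!addrA; congr (_ + _).
case: d => [|d].
  by rewrite !word_sum0 addrC.
rewrite IHn [in X in _ = _ + X]word_sumS addSnnS addrC.
have -> : (~~ p (+) odd d) = p (+) odd d.+1 by rewrite /= addNb addbN.
case: eqP => _; case: eqP => _;
  rewrite ?mulrDl ?mulrDr ?mulr0 ?mul0r ?addr0 ?add0r //.
by rewrite mulrA -addrA [X in _ + X]addrC.
Qed.

Lemma word_sum_comm F d p s n z :
  (forall m, (s <= m < s + n)%N -> GRing.comm z (F m)) ->
  GRing.comm z (word_sum F d p s n).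
Proof.
elim: n d p s => [|n IHn] d p s zF /=; first exact: commr_nat.
have zF' m : (s.+1 <= m < s.+1 + n)%N -> GRing.comm z (F m).
  by rewrite addSnnS => /andP[sm mn]; apply: zF; rewrite ltnW.
apply: commrD; first exact: IHn.
case: d => [|d]; first exact: commr0.
case: ifP => _; last exact: commr0.
by apply: commrM; [apply: zF; rewrite leqnn addnS ltnS leq_addr | exact: IHn].
Qed.

Lemma eq_word_sum F F' d p s n :
  (forall m, (s <= m < s + n)%N -> F m = F' m) ->
  word_sum F d p s n = word_sum F' d p s n.
Proof.
elim: n d p s => [|n IHn] d p s eqF //=.
have eqF' m : (s.+1 <= m < s.+1 + n)%N -> F m = F' m.
  by rewrite addSnnS => /andP[sm mn]; apply: eqF; rewrite ltnW.
rewrite eqF ?leqnn ?addnS ?ltnS ?leq_addr //.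
by rewrite IHn //; case: d => // d; rewrite IHn.
Qed.

Lemma word_sum_shift F d p s n :
  word_sum (fun m => F m.+1) d p s n = word_sum F d (~~ p) s.+1 n.
Proof.
elim: n d p s => [|n IHn] d p s //=; rewrite IHn.
case: d => // d; rewrite IHn (inj_eq (can_inj negbK)) //.
Qed.

Lemma word_sum1 F p s n :
  word_sum F 1 p s n = \sum_(s <= x < s + n | odd x == p) F x.
Proof.
elim: n s => [|n IHn] s; first by rewrite addn0 big_geq.
rewrite word_sumS word_sum0 mulr1 IHn addSnnS.
rewrite [in RHS]big_ltn_cond ?addnS ?ltnS ?leq_addr //.
by case: ifP; rewrite ?addr0 // addrC.
Qed.

Lemma word_sum2 F p s n :
  word_sum F 2 p s n = \sum_(s <= x < s + n | odd x == p)
     \sum_(x.+1 <= y < s + n | odd y != odd x) F x * F y.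
Proof.
elim: n s => [|n IHn] s; first by rewrite addn0 big_geq.
rewrite word_sumS IHn word_sum1 addSnnS.
rewrite [in RHS]big_ltn_cond ?addnS ?ltnS ?leq_addr //.
case: eqP => [<-|_]; rewrite ?addr0 // addrC mulr_sumr; congr (_ + _).
by apply: eq_bigl => y; case: (odd y); case: (odd s).
Qed.

End Words.

Lemma rmorph_word_sum (A B : pzRingType) (g : {rmorphism A -> B}) F d p s n :
  g (word_sum F d p s n) = word_sum (g \o F) d p s n.
Proof.
elim: n d p s => [|n IHn] d p s /=; first by rewrite rmorph_nat.
rewrite rmorphD IHn; case: d => [|d]; first by rewrite rmorph0.
by case: ifP; rewrite ?rmorph0 // rmorphM IHn.
Qed.

Arguments word_sum : simpl never.

Section Edges.
Variable A : pzRingType.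

(** [z] stands for the letter at position [0] of a cycle of length [m.+3]: it
    fails to commute only with its two neighbours, the letters [1] and [m.+2].
    A word contributes to the commutator through the removal of its first letter
    when that is [1], with sign [-], and of its last letter when that is [m.+2],
    with sign [+].  The parity condition on [d] lets words end at [m.+2]. *)
Lemma word_sum_edges (F : nat -> A) d m (z h : A) :
  odd d = odd m.+1 -> (forall x, GRing.comm h x) ->
  F 1%N * z = z * F 1%N - h -> F m.+2 * z = z * F m.+2 + h ->
  (forall i, (1 < i < m.+2)%N -> GRing.comm z (F i)) ->
  word_sum F d.+1 true 1 m.+2 * z - z * word_sum F d.+1 true 1 m.+2 =
  h * (word_sum F d true 1 m.+1 - word_sum F d false 2 m.+1).
Proof.
move=> dm hC F1z Fmz zF.
have zW d' p s n : (1 < s)%N -> (s + n <= m.+2)%N ->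
    z * word_sum F d' p s n = word_sum F d' p s n * z.
  move=> s1 snm; apply: word_sum_comm => i /andP[si isn]; apply: zF.
  by rewrite (leq_trans s1 si) (leq_trans isn snm).
rewrite [word_sum _ d.+1 _ 1 _]word_sumS /= [word_sum _ d.+1 _ 2 _]word_sum_rcons.
have -> : (odd (2 + m) == true (+) odd d) = true by rewrite dm oddD /= negbK eqxx.
case: d dm => [|d] dm.
  rewrite !word_sum0 !mul1r mulr1 subrr mulr0.
  have e : (2 + m = m.+2)%N by [].
  rewrite e !mulrDl !mulrDr Fmz F1z zW //.
  by ncring.
have dm' : odd (2 + m) == ~~ true (+) odd d.
  by move: dm; rewrite oddD /=; case: (odd d); case: (odd m).
rewrite [word_sum _ d.+1 false 2 _]word_sum_rcons dm'.
rewrite [word_sum _ d.+1 true 1 _]word_sumS /=.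
have e : (2 + m = m.+2)%N by [].
have e' : F (2 + m)%N = F m.+2 by [].
set X1 := word_sum F d.+2 _ _ _; set X2 := word_sum F d.+1 true _ _.
set X3 := word_sum F d.+1 false _ _; set X4 := word_sum F d false _ _.
have c1 : z * X1 = X1 * z by apply: zW.
have c2 : z * X2 = X2 * z by apply: zW.
have c3 : z * X3 = X3 * z by apply: zW.
have c4 : z * X4 = X4 * z by apply: zW.
rewrite e'; set y := F m.+2 in Fmz *; set x := F 1%N in F1z *.
have -> : z * (X1 + X2 * y + x * (X3 + X4 * y)) =
  z * X1 + z * X2 * y + (z * x) * X3 + (z * x) * X4 * y by ncring.
have -> : (X1 + X2 * y + x * (X3 + X4 * y)) * z =
  X1 * z + X2 * (y * z) + x * (X3 * z) + x * X4 * (y * z) by ncring.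
rewrite -c3 Fmz c1 c2.
have -> : X2 * (z * y + h) = X2 * z * y + h * X2 by rewrite mulrDr mulrA (hC X2).
have -> : z * x = x * z + h by rewrite F1z subrK.
have -> : x * X4 * (z * y + h) = x * (z * X4) * y + h * (x * X4).
  by rewrite c4 mulrDr -(hC (x * X4)) !mulrA.
by ncring.
Qed.

End Edges.

(** * The Hamiltonians as polynomials in linearly ordered letters *)

Section LinearHamiltonians.
Variable A : pzRingType.

(** The shape of [H_0] after the cycle of length [N] has been cut in front of the
    position [0]; [N] is odd in the applications of [cubic_ham] and even in those
    of [quartic_ham].  A product along a cyclic interval that crosses the cut
    contains the last letter before the first one; restoring the increasing order
    costs [h] times the product without these two letters, whence the term in
    [h], which runs over the positions [1, ..., N - 2]. *)
Definition cubic_ham (F : nat -> A) (h : A) (c : nat -> A) N : A :=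
  word_sum F 3 false 0 N + word_sum F 3 true 0 N
  + h * word_sum F 1 true 1 N.-2 + \sum_(0 <= x < N) c x * F x.

Definition quartic_ham (F : nat -> A) (h : A) (c : nat -> nat -> A) N : A :=
  word_sum F 4 false 0 N + word_sum F 4 true 0 N
  + h * word_sum F 2 true 1 N.-2
  + \sum_(0 <= x < N) \sum_(x.+1 <= y < N | odd y != odd x) c x y * (F x * F y).

End LinearHamiltonians.

(** The substitution [F'] is the action of the simple reflection at position [1],
    the first one for which the three letters involved lie on the same side of
    the cut. *)
Section Reflection.
Variables (A : pzRingType) (F F' : nat -> A) (a b h : A) (n : nat).
Hypothesis aC : forall x, GRing.comm a x.
Hypothesis bF1 : b * F 1%N = a.
Hypothesis F1b : F 1%N * b = a.
Hypothesis F'0 : F' 0%N = F 0%N - b.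
Hypothesis F'1 : F' 1%N = F 1%N.
Hypothesis F'2 : F' 2 = F 2 + b.
Hypothesis F'ge3 : forall m, (2 < m < n.+3)%N -> F' m = F m.

Let word_sum_ge3 d p : word_sum F' d p 3 n = word_sum F d p 3 n.
Proof. exact: eq_word_sum. Qed.

(** Since [b * F 1 = F 1 * b] is the central [a], the sums over the letters [0,
    1, 2] of given length and parity change only by [a] times expressions
    shorter by two: for instance [F 0 * F 1] changes by [- a] and [F 1 * F 2] by
    [a].  The change of the coefficients [c] compensates for this. *)
Lemma cubic_ham_reflection (c c' : nat -> A) :
  c' 0%N = c 0%N - a -> c' 1%N = c 1%N -> c' 2 = c 0%N -> c 2 = c 0%N - a ->
  (forall x, (2 < x < n.+3)%N -> c' x = c x + (-1) ^+ x * a) ->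
  cubic_ham F' h c' n.+3 = cubic_ham F h c n.+3.
Proof.
move=> c'0 c'1 c'2 c2 c'ge3; rewrite /cubic_ham /=.
have -> : word_sum F' 1 true 1 n.+1 = word_sum F 1 true 1 n.+1.
  rewrite !word_sum1 big_nat_cond [RHS]big_nat_cond; apply: eq_bigr => -[|[|[|x]]] // /andP[xn] //.
  by move=> _; apply: F'ge3; case/andP: xn => _; rewrite add1n => /ltnW.
have eQ : \sum_(3 <= x < n.+3) c' x * F' x = \sum_(3 <= x < n.+3) c x * F x
    + a * word_sum F 1 false 3 n - a * word_sum F 1 true 3 n.
  rewrite !word_sum1 !mulr_sumr -addrA -sumrN !add3n !(big_mkcond (fun x => odd x == _)).
  rewrite -!big_split; apply: eq_big_nat => x xn.
  rewrite F'ge3 // c'ge3 // mulrDl; congr (_ + _).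
  rewrite -signr_odd; case: (odd x) => /=.
    by rewrite expr1 mulN1r mulNr add0r.
  by rewrite expr0 mul1r addr0.
do 3![rewrite big_ltn // [in RHS]big_ltn //].
rewrite eQ F'0 F'1 F'2 c'0 c'1 c'2 c2 !word_sumS /= !word_sum0 !word_sum_ge3.
rewrite F'0 F'1 F'2.
set W2o := word_sum F 2 true 3 n; set W1e := word_sum F 1 false 3 n.
set W1o := word_sum F 1 true 3 n; set W2e := word_sum F 2 false 3 n.
set W3e := word_sum F 3 false 3 n; set W3o := word_sum F 3 true 3 n.
(* The difference of the two sides, written as a combination of the relations
   [b * F 1 = a], [F 1 * b = a] and of commutators with [a]. *)
apply: subr0_eq; transitivity (F 0%N * (F 1%N * b - a) + (F 0%N * a - a * F 0%N)
  - (b * F 1%N - a) * F 2 - b * (F 1%N * b - a) - (b * a - a * b)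
  - (b * F 1%N - a) * W1e + (F 1%N * b - a) * W1o); first by ncring.
by rewrite F1b bF1 !aC !subrr !(mulr0, mul0r, subr0, addr0).
Qed.

(** The same cancellation, one degree higher.  What survives comes from the
    quadratic words in the letters [0, 1, 2] alone. *)
Lemma quartic_ham_reflection (c c' : nat -> nat -> A) :
  (0 < n)%N ->
  (forall x y, (x < y < n.+3)%N -> odd y != odd x ->
     (x == 1)%N || (y == 1)%N -> c' x y = c x y) ->
  (forall y, (2 < y < n.+3)%N -> odd y ->
     [/\ c' 0%N y = c 0%N y - a, c' 2 y = c 0%N y & c 2 y = c 0%N y - a]) ->
  (forall x y, (2 < x < y)%N -> (y < n.+3)%N -> odd y != odd x ->
     c' x y = c x y + (-1) ^+ x * a) ->
  quartic_ham F' h c' n.+3 - quartic_ham F h c n.+3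
    = (h + c 1%N 2 - c 0%N 1%N) * a.
Proof.
move=> n0 c'1 c'02 c'ge3; rewrite /quartic_ham.
have -> : word_sum F' 2 true 1 n.+3.-2 = word_sum F 2 true 1 n.+3.-2 + a.
  have [n' en] : exists n', n = n'.+1 by exists n.-1; rewrite prednK.
  have e d p : word_sum F' d p 3 n' = word_sum F d p 3 n'.
    apply: eq_word_sum => m /andP[m3 mn]; apply: F'ge3.
    by rewrite m3 (leq_trans mn) // add3n en.
  rewrite /= en !word_sumS /= !word_sum0.
  by rewrite !e F'1 F'2 !mulr1 !mulrDr F1b !addr0 !addrA.
have eQ : \sum_(3 <= x < n.+3) \sum_(x.+1 <= y < n.+3 | odd y != odd x)
      c' x y * (F' x * F' y)
    = \sum_(3 <= x < n.+3) \sum_(x.+1 <= y < n.+3 | odd y != odd x)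
      c x y * (F x * F y) + a * word_sum F 2 false 3 n - a * word_sum F 2 true 3 n.
  rewrite !word_sum2 !mulr_sumr -addrA -sumrN !add3n !(big_mkcond (fun x => odd x == _)).
  rewrite -!big_split; apply: eq_big_nat => x /andP[x3 xn].
  transitivity (\sum_(x.+1 <= y < n.+3 | odd y != odd x)
     (c x y * (F x * F y) + (-1) ^+ x * a * (F x * F y))).
    rewrite big_nat_cond [RHS]big_nat_cond; apply: eq_bigr => y /andP[/andP[xy yn] odxy].
    by rewrite !F'ge3 ?c'ge3 ?mulrDl ?x3 ?xn ?yn ?(ltn_trans x3 xy).
  rewrite big_split; congr (_ + _); rewrite -[LHS]mulr_sumr.
  rewrite -signr_odd; case: (odd x) => /=.
    by rewrite expr1 mulN1r mulNr add0r.
  by rewrite expr0 mul1r addr0.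
have eW : word_sum F' 4 false 0 n.+3 + word_sum F' 4 true 0 n.+3 =
  word_sum F 4 false 0 n.+3 + word_sum F 4 true 0 n.+3 +
  (a * word_sum F 2 true 3 n - a * word_sum F 2 false 3 n +
   (a * F 0%N - a * F 2 - b * a) * word_sum F 1 true 3 n).
  rewrite !word_sumS /= !word_sum_ge3 F'0 F'1 F'2.
  set W1o := word_sum F 1 true 3 n; set W2e := word_sum F 2 false 3 n.
  set W2o := word_sum F 2 true 3 n; set W3e := word_sum F 3 false 3 n.
  set W3o := word_sum F 3 true 3 n.
  apply: subr0_eq; transitivity (
     (F 0%N * (F 1%N * b - a) + (F 0%N * a - a * F 0%N)
      - (b * F 1%N - a) * F 2 - b * (F 1%N * b - a)) * W1o
     - (b * F 1%N - a) * W2e + (F 1%N * b - a) * W2o); first by ncring.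
  by rewrite F1b bF1 !aC !subrr !(mulr0, mul0r, subr0, addr0).
have e0 (G : nat -> nat -> A) : \sum_(1 <= y < n.+3 | odd y != odd 0) G 0%N y =
    G 0%N 1%N + \sum_(3 <= y < n.+3 | odd y == true) G 0%N y.
  rewrite big_ltn_cond // big_ltn_cond //=; congr (_ + _).
  by apply: eq_bigl => y; case: (odd y).
have e1 (G : nat -> nat -> A) : \sum_(2 <= y < n.+3 | odd y != odd 1) G 1%N y =
    G 1%N 2 + \sum_(3 <= y < n.+3 | odd y == false) G 1%N y.
  rewrite big_ltn_cond //=; congr (_ + _).
  by apply: eq_bigl => y; case: (odd y).
have e2 (G : nat -> nat -> A) : \sum_(3 <= y < n.+3 | odd y != odd 2) G 2 y =
    \sum_(3 <= y < n.+3 | odd y == true) G 2 y.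
  by apply: eq_bigl => y; case: (odd y).
do 3![rewrite big_ltn // [\sum_(_ <= x < _) \sum_(x.+1 <= y < n.+3 | _) c x y * _]big_ltn //].
pose G (c : nat -> nat -> A) (F : nat -> A) x y := c x y * (F x * F y).
rewrite eQ eW (e0 (G c' F')) (e0 (G c F)) (e1 (G c' F')) (e1 (G c F)).
rewrite (e2 (G c' F')) (e2 (G c F)) /G.
have eL : \sum_(3 <= y < n.+3 | odd y == true) c' 0%N y * (F' 0%N * F' y) +
    \sum_(3 <= y < n.+3 | odd y == true) c' 2 y * (F' 2 * F' y) =
    \sum_(3 <= y < n.+3 | odd y == true) c 0%N y * (F 0%N * F y) +
    \sum_(3 <= y < n.+3 | odd y == true) c 2 y * (F 2 * F y) -
    (a * F 0%N - a * F 2 - b * a) * word_sum F 1 true 3 n.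
  rewrite word_sum1 add3n mulr_sumr -sumrN -!big_split.
  rewrite big_nat_cond [RHS]big_nat_cond; apply: eq_bigr => y.
  rewrite eqb_id => /andP[y3 oy]; have [-> -> ->] := c'02 y y3 oy.
  rewrite F'0 F'2 F'ge3 //= -[b * a]aC; ncring.
have e1' : \sum_(3 <= y < n.+3 | odd y == false) c' 1%N y * (F' 1%N * F' y) =
   \sum_(3 <= y < n.+3 | odd y == false) c 1%N y * (F 1%N * F y).
  rewrite big_nat_cond [RHS]big_nat_cond; apply: eq_bigr => y /andP[y3 oy].
  have [/andP[y2 yn] ey] := (y3, eqP oy).
  by rewrite c'1 ?F'1 ?F'ge3 ?(ltnW y2) ?ey.
rewrite e1' !c'1 // F'1; move: eL; rewrite F'2 F'0 {eW e1' eQ e0 e1 e2 G}.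
set S0' := \sum_(3 <= y < _ | _) c' 0%N y * _.
set S2' := \sum_(3 <= y < _ | _) c' 2 y * _.
set S0 := \sum_(3 <= y < _ | _) c 0%N y * _.
set S2 := \sum_(3 <= y < _ | _) c 2 y * _.
set X := (_ - _ - _) * word_sum _ _ _ _ _ => eL.
apply: subr0_eq; transitivity ((S0' + S2') - (S0 + S2 - X)
  - c 0%N 1%N * (b * F 1%N - a) + c 1%N 2 * (F 1%N * b - a)); first by ncring.
by rewrite eL F1b bF1 !subrr !mulr0 subr0 addr0.
Qed.
End Reflection.

(** * Moving the cut by one position *)

Section OppositeParityPairs.
Variables (A : pzRingType) (n : nat) (G : nat -> nat -> A).

Lemma big_opposite_recl :
  \sum_(0 <= x < n.+1) \sum_(x.+1 <= y < n.+1 | odd y != odd x) G x y =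
  \sum_(0 <= y < n | ~~ odd y) G 0%N y.+1 +
  \sum_(0 <= x < n) \sum_(x.+1 <= y < n | odd y != odd x) G x.+1 y.+1.
Proof.
rewrite big_nat_recl //; congr (_ + _).
  by rewrite big_add1 /=; apply: eq_bigl => y; case: (odd y).
apply: eq_bigr => x _; rewrite big_add1 /=.
by apply: eq_bigl => y; case: (odd y); case: (odd x).
Qed.

Lemma big_opposite_recr :
  \sum_(0 <= x < n.+1) \sum_(x.+1 <= y < n.+1 | odd y != odd x) G x y =
  \sum_(0 <= x < n) \sum_(x.+1 <= y < n | odd y != odd x) G x y +
  \sum_(0 <= x < n | odd n != odd x) G x n.
Proof.
rewrite big_nat_recr //= [X in _ + X]big_geq // addr0.
rewrite [X in _ = _ + X]big_mkcond -big_split; apply: eq_big_nat => x /andP[_ xn].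
by rewrite big_mkcond big_nat_recr //= -big_mkcond.
Qed.

End OppositeParityPairs.

Section Rotation.
Variables (A : pzRingType) (F : nat -> A) (h k t : A) (m : nat).
Hypothesis hC : forall x, GRing.comm h x.
Hypothesis F_cycle : F m.+3 = F 0%N.
Hypothesis F1F0 : F 1%N * F 0%N = F 0%N * F 1%N - h.
Hypothesis FlF0 : F m.+2 * F 0%N = F 0%N * F m.+2 + h.
Hypothesis F0C : forall i, (1 < i < m.+2)%N -> GRing.comm (F 0%N) (F i).

(** Words that avoid the letter [0] are common to both sides.  The others have
    this letter in front on one side and at the end on the other, so that the
    sides differ by a commutator with [F 0]; by [word_sum_edges] it is also the
    difference of the two terms in [h]. *)
Lemma word_sums_rotation d : odd d = odd m.+1 ->
  let sums G := word_sum G d.+2 false 0 m.+3 + word_sum G d.+2 true 0 m.+3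
                + h * word_sum G d true 1 m.+1 in
  sums (fun x => F x.+1) = sums F.
Proof.
move=> dm sums; rewrite /sums !word_sum_shift /=.
rewrite [word_sum F d.+2 true 1 _]word_sum_rcons.
rewrite [word_sum F d.+2 false 1 _]word_sum_rcons.
rewrite [word_sum F d.+2 false 0 _]word_sumS [word_sum F d.+2 true 0 _]word_sumS /=.
have -> : odd m = ~~ odd d by rewrite dm /= negbK.
rewrite !negbK eqxx; have -> : (odd d == ~~ odd d) = false by case: (odd d).
rewrite /= !addr0.
have := word_sum_edges dm hC F1F0 FlF0 F0C.
rewrite -[(1 + m.+2)%N]/m.+3 F_cycle.
set X := word_sum F d.+1 true 1 m.+2; set Y := word_sum F d true 1 m.+1.
set Z := word_sum F d false 2 m.+1.
set U := word_sum F d.+2 _ _ _; set V := word_sum F d.+2 _ _ _ => e.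
apply: subr0_eq; transitivity ((X * F 0%N - F 0%N * X) - h * (Y - Z)).
  by ncring.
by rewrite e subrr.
Qed.

(** Only the coefficients of the linear part matter, the rest being invariant.
    The hypotheses on [c'] say how these coefficients, which are alternating sums
    of fundamental weights, change under the rotation of the diagram. *)
Lemma cubic_ham_rotation (c c' : nat -> A) : ~~ odd m ->
  (forall x, (x < m.+2)%N -> c' x = c x.+1 + (odd x)%:R * k - t) ->
  c' m.+2 = c 0%N - t ->
  cubic_ham (fun x => F x.+1) h c' m.+3 - cubic_ham F h c m.+3
    = k * (\sum_(0 <= x < m.+3 | (0 < x)%N && ~~ odd x) F x)
      - t * \sum_(0 <= x < m.+3) F x.
Proof.
move=> em c'lt c'l; rewrite /cubic_ham /=.
have -> := @word_sums_rotation 1; last by rewrite /= em.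
rewrite opprD addrACA subrr add0r.
rewrite [\sum_(0 <= x < m.+3) c' x * _]big_nat_recr //= c'l F_cycle.
have -> : \sum_(0 <= x < m.+3 | (0 < x)%N && ~~ odd x) F x =
    \sum_(0 <= x < m.+2) (odd x)%:R * F x.+1.
  rewrite big_mkcond big_nat_recl //= add0r; apply: eq_bigr => x _.
  by rewrite negbK; case: (odd x); rewrite ?mul1r ?mul0r.
rewrite !(@big_nat_recl _ _ _ m.+2 0) //=.
rewrite (eq_big_nat _ _ (F2 := fun x => c x.+1 * F x.+1 +
   k * ((odd x)%:R * F x.+1) - t * F x.+1)); last first.
  move=> x xm; rewrite c'lt // mulrBl mulrDl; congr (_ + _ - _).
  by case: (odd x); rewrite ?mul1r ?mul0r // mulr0.
rewrite sumrB big_split -!mulr_sumr /=; ncring.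
Qed.

(** In degree two the pairs that contain the position [0] also change their
    order, which gives the last sum; in the application it is central, because there
    the commutators of two letters are multiples of [h]. *)
Lemma quartic_ham_rotation (c c' : nat -> nat -> A) : odd m ->
  (forall x y, (x < y < m.+2)%N -> odd y != odd x ->
     c' x y = c x.+1 y.+1 + (odd x)%:R * k - t) ->
  (forall x, (x < m.+2)%N -> ~~ odd x -> c' x m.+2 = c 0%N x.+1 - t) ->
  quartic_ham (fun x => F x.+1) h c' m.+3 - quartic_ham F h c m.+3
    = k * word_sum F 2 false 2 m.+1
      - t * (word_sum F 2 false 0 m.+3 + word_sum F 2 true 0 m.+3)
      + \sum_(0 <= x < m.+2 | ~~ odd x)
          c' x m.+2 * (F x.+1 * F 0%N - F 0%N * F x.+1).
Proof.
move=> om c'lt c'l; rewrite /quartic_ham /=.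
have -> := @word_sums_rotation 2; last by rewrite /= om.
rewrite opprD addrACA subrr add0r.
have -> : word_sum F 2 false 0 m.+3 + word_sum F 2 true 0 m.+3 =
    \sum_(0 <= x < m.+3) \sum_(x.+1 <= y < m.+3 | odd y != odd x) F x * F y.
  rewrite !word_sum2 !add0n !(big_mkcond (fun x => odd x == _)) -big_split /=.
  by apply: eq_bigr => x _; case: (odd x); rewrite ?add0r ?addr0.
have -> : word_sum F 2 false 2 m.+1 = \sum_(0 <= x < m.+2)
   \sum_(x.+1 <= y < m.+2 | odd y != odd x) (odd x)%:R * (F x.+1 * F y.+1).
  rewrite word_sum2 add2n big_mkcond big_add1 /= [RHS]big_ltn //.
  rewrite [X in _ = X + _]big1 ?add0r => [|y _]; last by rewrite mul0r.
  apply: eq_bigr => x _; rewrite big_add1 /= -[RHS]mulr_sumr.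
  case: (odd x); rewrite ?mul1r ?mul0r //=.
  by apply: eq_bigl => y; case: (odd y).
rewrite (big_opposite_recr _ (fun x y => c' x y * (F x.+1 * F y.+1))).
rewrite (big_opposite_recl _ (fun x y => c x y * (F x * F y))).
rewrite (big_opposite_recl _ (fun x y => F x * F y)) F_cycle.
rewrite /= om negbK.
rewrite (eq_bigl (fun x => ~~ odd x) (fun x => c' x m.+2 * (F x.+1 * F 0%N))); last first.
  by move=> x; case: (odd x).
set T1 := \sum_(0 <= x < m.+2) \sum_(_ <= _ < _ | _) (F _ * _).
set T2 := \sum_(0 <= x < m.+2) \sum_(_ <= _ < _ | _) ((odd _)%:R * _).
set S1 := \sum_(0 <= x < m.+2) \sum_(_ <= _ < _ | _) (c _ _ * _).
have -> : \sum_(0 <= x < m.+2) \sum_(x.+1 <= y < m.+2 | odd y != odd x)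
    c' x y * (F x.+1 * F y.+1) = S1 + k * T2 - t * T1.
  rewrite !mulr_sumr -sumrN -!big_split; apply: eq_bigr => x _ /=.
  rewrite !mulr_sumr -sumrN -!big_split [LHS]big_nat_cond [RHS]big_nat_cond.
  apply: eq_bigr => y /andP[/andP[xy ym] odxy] /=.
  rewrite c'lt ?xy // !mulrDl mulNr; congr (_ + _ - _).
  by case: (odd x); rewrite ?mul1r ?mul0r ?mulr0.
have -> : \sum_(0 <= x < m.+2 | ~~ odd x) c' x m.+2 * (F x.+1 * F 0%N) =
  \sum_(0 <= x < m.+2 | ~~ odd x) c' x m.+2 * (F x.+1 * F 0%N - F 0%N * F x.+1)
  + \sum_(0 <= x < m.+2 | ~~ odd x) c 0%N x.+1 * (F 0%N * F x.+1)
  - t * \sum_(0 <= x < m.+2 | ~~ odd x) F 0%N * F x.+1.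
  rewrite mulr_sumr -sumrN -!big_split [LHS]big_nat_cond [RHS]big_nat_cond.
  apply: eq_bigr => x /andP[/andP[_ xm] ox] /=.
  rewrite c'l //; ncring.
ncring.
Qed.
End Rotation.

(** * The coefficients chi as alternating sums *)

Section CyclicIndices.
Local Open Scope nat_scope.
Variable l : nat.
Implicit Types (i x y : 'I_l.+1) (m : nat) (C : {set 'I_l.+1}).

(** Positions are natural numbers read modulo [l.+1], so that cyclic intervals
    become honest intervals, possibly beyond [l]. *)
Definition cyc m : 'I_l.+1 := inord (m %% l.+1).

Arguments cyc : simpl never.

Lemma val_cyc m : cyc m = m %% l.+1 :> nat.
Proof. by rewrite inordK ?ltn_mod. Qed.

Lemma cyc_eq m m' : m = m' %[mod l.+1] -> cyc m = cyc m'.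
Proof. by move=> e; apply: val_inj; rewrite /= !val_cyc. Qed.

Lemma cyc_val i : cyc i = i.
Proof. by apply: val_inj; rewrite /= val_cyc modn_small. Qed.

Lemma cycDn m : cyc (m + l.+1) = cyc m.
Proof. by apply: cyc_eq; rewrite modnDr. Qed.

Lemma ordS_cyc m : ordS (cyc m) = cyc m.+1.
Proof. by apply: val_inj; rewrite /= !val_cyc -addn1 modnDml addn1. Qed.

Lemma shift_cyc i m : shift i m = cyc (i + m).
Proof.
elim: m => [|m IHm]; first by rewrite addn0 cyc_val.
by rewrite /shift iterS -/(shift i m) IHm ordS_cyc addnS.
Qed.

Lemma ord_pred_cyc m : ord_pred (cyc m.+1) = cyc m.
Proof. by rewrite -ordS_cyc ordSK. Qed.

Lemma cyc_inj m m' : (m < m' + l.+1)%N -> (m' < m + l.+1)%N ->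
  cyc m = cyc m' -> m = m'.
Proof.
wlog le_mm' : m m' / (m <= m')%N => [wlg mm' m'm e|].
  by case/orP: (leq_total m m') => le; [|apply/esym]; apply: wlg.
move=> _ lt /(congr1 val)/eqP; rewrite /= !val_cyc eq_sym eqn_mod_dvd //.
move=> /dvdnP[[|q] eq].
  by apply/eqP; rewrite eqn_leq le_mm' -subn_eq0 eq.
by move: lt; rewrite -ltn_subLR // eq mulSn ltnNge leq_addr.
Qed.

Lemma mem_arc C i m : (Defs.arc i m \subset C) <->
  (forall j, (j < m)%N -> shift i j \in C).
Proof.
split=> [/subsetP sC j jm | sC].
  by apply: sC; apply/imsetP; exists (Ordinal jm).
by apply/subsetP => _ /imsetP[j _ ->]; exact: sC.
Qed.

Lemma component_setC (S : {set 'I_l.+1}) s m :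
  cyc s \in S -> cyc (s + m).+1 \in S ->
  (forall j, j < m -> cyc (s.+1 + j) \notin S) ->
  component (~: S) (cyc s.+1) m.
Proof.
move=> sS smS arcS; rewrite /component ord_pred_cyc !inE negbK sS /=.
have eq_shift j : shift (cyc s.+1) j = cyc (s.+1 + j).
  by rewrite shift_cyc; apply: cyc_eq; rewrite val_cyc modnDml.
rewrite eq_shift addSn negbK smS andbT; apply/mem_arc => j jm.
by rewrite eq_shift inE arcS.
Qed.

Lemma component_uniq C i m m' : component C i m -> component C i m' -> m = m'.
Proof.
wlog lt_mm' : m m' / (m <= m')%N => [wlg c c'|].
  by case/orP: (leq_total m m') => le; [|apply/esym]; apply: wlg.
case/and3P=> _ _ mC /and3P[/mem_arc sC _ _].
by apply/eqP; rewrite eqn_leq lt_mm' leqNgt; apply: contra mC => /sC.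
Qed.

(** At most one maximal interval starts at [i], so that the double iterations that
    define [chi] and [f_set] reduce to one over starting points. *)
Lemma big_component R (idx : R) (op : Monoid.law idx) C i m (g : nat -> R) :
  (m <= l)%N -> g 0%N = idx -> component C i m ->
  \big[op/idx]_(1 <= m' < l.+1 | component C i m') g m' = g m.
Proof.
move=> ml g0 Cim; rewrite (eq_bigl (fun m' => m' == m)); last first.
  by move=> m'; apply/idP/eqP => [Cim'|-> //]; apply: component_uniq Cim' Cim.
by rewrite big_nat1_eq ltnS ml andbT; case: m {Cim ml} => //=; rewrite g0.
Qed.

Lemma big_no_component R (idx : R) (op : Monoid.law idx) C i (g : nat -> R) :
  ord_pred i \in C ->
  \big[op/idx]_(1 <= m' < l.+1 | component C i m') g m' = idx.
Proof.
by move=> iC; apply: big_pred0 => m; rewrite /component iC /= andbF.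
Qed.

End CyclicIndices.

(** * Alternating sums of weights *)

Definition alt_sum (A : pzRingType) (w : nat -> A) s m : A :=
  \sum_(j < m) (-1) ^+ j * w (s + j)%N.

Section ChiOfComplements.
Variables (R : realType) (K : unitAlgType R[i]) (l : nat) (a : 'I_l.+1 -> K).
Implicit Types (m : nat).

Let v m : K := varpi a (cyc l m).

Lemma chi_arc_alt_sum m k : chi_arc a (cyc l m) k = alt_sum v m k.
Proof.
apply: eq_bigr => j _; rewrite shift_cyc; congr (_ * varpi a _).
by apply: cyc_eq; rewrite val_cyc modnDml.
Qed.

Lemma chi_setC1 x : (x <= l)%N -> chi a (~: [set cyc l x]) = alt_sum v x.+1 l.
Proof.
move=> xl; rewrite /chi (bigD1 (cyc l x.+1)) //= [X in _ + X]big1 => [|i ix].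
  rewrite addr0 (@big_component _ _ _ _ _ _ l) //; first exact: chi_arc_alt_sum.
    by rewrite /chi_arc big_ord0.
  apply: component_setC; rewrite ?inE ?eqxx //.
    by rewrite -addnS cycDn.
  by move=> j jl; rewrite inE; apply/eqP => /cyc_inj; lia.
apply: big_no_component; rewrite !inE; apply: contra ix => /eqP e.
by rewrite -(ord_predK i) e ordS_cyc.
Qed.

(** The complement of two points has two components, one of which may be empty;
    an empty one contributes an empty alternating sum. *)
Lemma chi_setC2 x y : (x < y <= l)%N -> chi a (~: [set cyc l x; cyc l y]) =
  alt_sum v x.+1 (y - x.+1) + alt_sum v y.+1 (l - y + x).
Proof.
case/andP=> xy yl; have yx : cyc l y.+1 != cyc l x.+1.
  by apply/eqP => /cyc_inj; lia.
rewrite /chi (bigD1 (cyc l x.+1)) //= (bigD1 (cyc l y.+1)) //= addrA.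
rewrite [X in _ + X]big1 => [|i /andP[ix iy]].
  rewrite addr0; congr (_ + _).
    rewrite (@big_component _ _ _ _ _ _ (y - x.+1)); first exact: chi_arc_alt_sum.
    - by lia.
    - by rewrite /chi_arc big_ord0.
    apply: component_setC; rewrite ?inE ?eqxx //.
      by rewrite -addSn subnKC // eqxx orbT.
    by move=> j jy; rewrite !inE; apply/norP; split; apply/eqP => /cyc_inj; lia.
  rewrite (@big_component _ _ _ _ _ _ (l - y + x)); first exact: chi_arc_alt_sum.
  - by lia.
  - by rewrite /chi_arc big_ord0.
  apply: component_setC; rewrite ?inE ?eqxx ?orbT //.
    have -> : ((y + (l - y + x)).+1 = x + l.+1)%N by lia.
    by rewrite cycDn eqxx.
  by move=> j jy; rewrite !inE; apply/norP; split; apply/eqP => /cyc_inj; lia.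
apply: big_no_component; rewrite !inE.
by apply/norP; split; [apply: contra ix | apply: contra iy] => /eqP e;
  rewrite -(ord_predK i) e ordS_cyc.
Qed.

End ChiOfComplements.

Section AlternatingSums.
Variable A : pzRingType.
Implicit Types (w : nat -> A).

Lemma alt_sum0 w s : alt_sum w s 0 = 0.
Proof. exact: big_ord0. Qed.

Lemma alt_sumS w s m : alt_sum w s m.+1 = alt_sum w s m + (-1) ^+ m * w (s + m)%N.
Proof. exact: big_ord_recr. Qed.

Lemma alt_sum_recl2 w s m :
  alt_sum w s m.+2 = w s - w s.+1 + alt_sum w s.+2 m.
Proof.
rewrite /alt_sum !big_ord_recl /= expr0 expr1 mul1r mulN1r addn0 addn1 addrA.
congr (_ + _); apply: eq_bigr => j _.
by rewrite /bump /= !add1n !exprS !mulN1r opprK !addnS !addSn.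
Qed.

Lemma alt_sum_recr2 w s q : ~~ odd q ->
  alt_sum w s q.+2 = alt_sum w s q + (w (s + q)%N - w (s + q).+1).
Proof.
move=> /negbTE eq; rewrite !alt_sumS -signr_odd -[(-1) ^+ q.+1]signr_odd /= eq.
by rewrite expr0 expr1 mul1r mulN1r addrA addnS.
Qed.

Lemma eq_alt_sum w w' s m :
  (forall j, (j < m)%N -> w (s + j)%N = w' (s + j)%N) ->
  alt_sum w s m = alt_sum w' s m.
Proof. by move=> e; apply: eq_bigr => j _; rewrite e. Qed.

Lemma alt_sumD w w' s m :
  alt_sum (fun j => w j + w' j) s m = alt_sum w s m + alt_sum w' s m.
Proof. by rewrite -big_split; apply: eq_bigr => j _; rewrite mulrDr. Qed.

Lemma alt_sumMl (x : A) w s m :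
  (forall y, GRing.comm x y) ->
  alt_sum (fun j => x * w j) s m = x * alt_sum w s m.
Proof.
move=> xC; rewrite /alt_sum mulr_sumr; apply: eq_bigr => j _.
by rewrite mulrA -xC mulrA.
Qed.

Lemma alt_sum_shift w s m : alt_sum (fun j => w j.+1) s m = alt_sum w s.+1 m.
Proof. by apply: eq_bigr => j _; rewrite addSn. Qed.

Lemma alt_sum_pred0 (u : pred nat) s m :
  (forall j, (s <= j < s + m)%N -> ~~ u j) ->
  alt_sum (fun j => (u j)%:R) s m = 0 :> A.
Proof.
move=> u0; apply: big1 => j _.
have /u0/negbTE-> : (s <= s + j < s + m)%N; last by rewrite mulr0.
by rewrite leq_addr ltn_add2l ltn_ord.
Qed.

Lemma alt_sum_pred1 (u : pred nat) p s m :
  (s <= p < s + m)%N -> u p -> (forall j, (s <= j < s + m)%N -> u j -> j = p) ->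
  alt_sum (fun j => (u j)%:R) s m = (-1) ^+ (p - s) :> A.
Proof.
case/andP=> sp psm up u1; have psm' : (p - s < m)%N by lia.
rewrite /alt_sum (bigD1 (Ordinal psm')) //= subnKC // up mulr1.
rewrite big1 ?addr0 // => j; rewrite -val_eqE /= => jp.
case: (boolP (u _)) => [/u1 e|_]; last by rewrite mulr0.
by case/eqP: jp; rewrite -e ?addKn // leq_addr ltn_add2l ltn_ord.
Qed.

End AlternatingSums.

(** An alternating sum of even length is a sum of consecutive differences, so
    it is [k] times the number of its positions marked by [u] that have the parity
    of the first one, minus a multiple of [t]. *)
Section StepSums.
Variables (A : pzRingType) (w : nat -> A) (u : pred nat) (k t : A).
Hypothesis w_step : forall s, (0 < s)%N -> w s - w s.+1 = (u s)%:R * k - t.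

Lemma alt_sum_step s q : (0 < s)%N ->
  alt_sum w s q.*2 = (\sum_(i < q) (u (s + i.*2)%N)%:R) * k - t *+ q.
Proof.
move=> s0; elim: q => [|q IHq].
  by rewrite alt_sum0 big_ord0 mul0r mulr0n subrr.
rewrite doubleS alt_sum_recr2 ?odd_double // IHq w_step; last by lia.
by rewrite big_ord_recr mulrDl mulrSr opprD addrACA.
Qed.

Lemma alt_sum_step0 s q : (0 < s)%N ->
  (forall j, (s <= j < s + q.*2)%N -> odd j = odd s -> ~~ u j) ->
  alt_sum w s q.*2 = - (t *+ q).
Proof.
move=> s0 u0; rewrite alt_sum_step // big1 ?mul0r ?add0r // => i _.
rewrite (negbTE (u0 _ _ _)) // ?oddD ?odd_double ?addbF //.
by have := ltn_ord i; lia.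
Qed.

Lemma alt_sum_step1 s q p : (0 < s)%N ->
  (s <= p < s + q.*2)%N -> odd p = odd s -> u p ->
  (forall j, (s <= j < s + q.*2)%N -> u j -> j = p) ->
  alt_sum w s q.*2 = k - t *+ q.
Proof.
move=> s0 sp op up u1; rewrite alt_sum_step //.
have ip : ((p - s)./2 < q)%N by lia.
have ep : (s + ((p - s)./2).*2 = p)%N by lia.
rewrite (bigD1 (Ordinal ip)) //= ep up big1 ?addr0 ?mul1r // => i.
rewrite -val_eqE /= => ne_i; case: (boolP (u _)) => // /u1 e.
by case/eqP: ne_i; have := ltn_ord i; lia.
Qed.

End StepSums.

Section Weights.
Variables (A : pzRingType) (l : nat).
Implicit Types (v : nat -> A).

(** With [v m] the fundamental weight at the position [m], these are the values
    of [chi] at the complements of one and of two points. *)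
Definition weight1 v x : A := alt_sum v x.+1 l.
Definition weight2 v x y : A :=
  alt_sum v x.+1 (y - x.+1) + alt_sum v y.+1 (l - y + x).

(** The reflection at [1] moves only the weight at [1], by the root [a]; an
    alternating sum over a cyclic interval thus changes by [a] or [- a], the
    sign being read off the place of [1] in the interval, if it contains [1].
    The hypothesis [v_root] expresses the root as a second difference of the
    weights. *)
Section ReflectionOfWeights.
Variables (v v' : nat -> A) (a : A).
Hypothesis l1 : (1 < l)%N.
Hypothesis aC : forall x, GRing.comm a x.
Hypothesis v_cycle : forall m, v (m + l.+1)%N = v m.
Hypothesis v_root : (v 0%N - v 1%N) + (v 2 - v 1%N) = - a.
Hypothesis v'E : forall m, v' m = v m + - a * (cyc l m == cyc l 1)%:R.

Let alt_sum_v' s m : alt_sum v' s m =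
  alt_sum v s m - a * alt_sum (fun j => (cyc l j == cyc l 1)%:R) s m.
Proof.
rewrite (@eq_alt_sum _ v' (fun j => v j + - a * (cyc l j == cyc l 1)%:R)) => [|j _].
  rewrite alt_sumD alt_sumMl ?mulNr // => y.
  by apply: commr_sym; apply: commrN; apply: commr_sym.
exact: v'E.
Qed.

Let no_root s m : (1 < s)%N -> (s + m <= l.+2)%N ->
  alt_sum (fun j => (cyc l j == cyc l 1)%:R) s m = 0 :> A.
Proof.
move=> s1 sm; apply: alt_sum_pred0 => j jsm; apply/eqP => /cyc_inj; lia.
Qed.

Let one_root s m : (2 < s)%N -> (s <= l.+2 < s + m)%N -> (m <= l.+1)%N ->
  alt_sum (fun j => (cyc l j == cyc l 1)%:R) s m = (-1) ^+ (l.+2 - s) :> A.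
Proof.
move=> s1 sm ml; have e1 : cyc l l.+2 = cyc l 1 := cycDn l 1.
apply: alt_sum_pred1 => //; first by rewrite e1.
by move=> j jsm; rewrite -e1 => /eqP/cyc_inj; lia.
Qed.

Let first_root m : (0 < m <= l)%N ->
  alt_sum (fun j => (cyc l j == cyc l 1)%:R) 1 m = 1 :> A.
Proof.
move=> m0; rewrite (@alt_sum_pred1 _ _ 1) ?subnn ?expr0 //; first by lia.
by move=> j jm /eqP/cyc_inj; lia.
Qed.

Lemma weight1_reflection : ~~ odd l ->
  [/\ weight1 v' 0 = weight1 v 0 - a, weight1 v' 1 = weight1 v 1,
      weight1 v' 2 = weight1 v 0, weight1 v 2 = weight1 v 0 - a
    & forall x, (2 < x < l.+1)%N -> weight1 v' x = weight1 v x + (-1) ^+ x * a].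
Proof.
move=> el; have e2 : weight1 v 2 = weight1 v 0 - a.
  rewrite /weight1 -v_root; case: l l1 el v_cycle => // -[] // l' _ el vC.
  rewrite [alt_sum v 1 _]alt_sum_recl2 alt_sum_recr2; last by move: el; rewrite /= negbK.
  have -> : v (3 + l')%N = v 0%N by rewrite -(vC 0%N).
  have -> : v (3 + l').+1 = v 1%N by rewrite -(vC 1%N).
  ncring.
split=> //.
- by rewrite /weight1 alt_sum_v' first_root ?leqnn ?mulr1 // ltnW.
- by rewrite /weight1 alt_sum_v' no_root ?mulr0 ?subr0 // add2n.
- rewrite /weight1 alt_sum_v' one_root; [|lia..].
  rewrite -signr_odd; have -> : odd (l.+2 - 3) by lia.
  by rewrite expr1 mulrN1 opprK -/(weight1 v 2) e2 subrK.
move=> x x2; rewrite /weight1 alt_sum_v' one_root; [|lia..].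
rewrite -signr_odd -[(-1) ^+ x]signr_odd; have -> : odd (l.+2 - x.+1) = ~~ odd x by lia.
by rewrite signrN mulrN opprK (aC ((-1) ^+ odd x)).
Qed.

Lemma weight2_reflection : odd l ->
  [/\ forall x y, (x < y <= l)%N -> odd y != odd x ->
        (x == 1)%N || (y == 1)%N -> weight2 v' x y = weight2 v x y,
      forall y, (2 < y <= l)%N -> odd y ->
        [/\ weight2 v' 0 y = weight2 v 0 y - a, weight2 v' 2 y = weight2 v 0 y
          & weight2 v 2 y = weight2 v 0 y - a]
    & forall x y, (2 < x < y)%N -> (y <= l)%N -> odd y != odd x ->
        weight2 v' x y = weight2 v x y + (-1) ^+ x * a].
Proof.
move=> ol; split.
- move=> x y xy oxy; rewrite /weight2 !alt_sum_v' => /orP[]/eqP e; subst.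
    by rewrite !no_root ?mulr0 ?subr0 //; lia.
  have -> : x = 0%N by lia.
  by rewrite subnn !alt_sum0 no_root ?mulr0 ?subr0 //; lia.
- move=> y y2 oy; have e2 : weight2 v 2 y = weight2 v 0 y - a.
    rewrite /weight2 -v_root addn0.
    have -> : (y - 1 = (y - 3).+2)%N by lia.
    rewrite [alt_sum v 1 _]alt_sum_recl2 addn2 alt_sum_recr2; last by lia.
    have -> : (y.+1 + (l - y) = 0 + l.+1)%N by lia.
    by rewrite -addSn !v_cycle; ncring.
  have e2' : weight2 v' 2 y = weight2 v 2 y + a.
    rewrite /weight2 !alt_sum_v' no_root ?one_root; [|lia..].
    rewrite mulr0 subr0 -signr_odd; have -> : odd (l.+2 - y.+1) by lia.
    by rewrite expr1 mulrN1 opprK addrA.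
  split=> //; last by rewrite e2' e2 subrK.
  rewrite /weight2 !alt_sum_v' first_root ?no_root; [|lia..].
  by rewrite mulr0 subr0 mulr1 addrAC.
move=> x y x2 yl oxy; rewrite /weight2 !alt_sum_v' no_root ?one_root; [|lia..].
rewrite mulr0 subr0 -signr_odd -[(-1) ^+ x]signr_odd.
have -> : odd (l.+2 - y.+1) = ~~ odd x by lia.
by rewrite signrN mulrN opprK (aC ((-1) ^+ odd x)) addrA.
Qed.

End ReflectionOfWeights.

(** The rotation shifts the weights up to a correction [delta].  Its successive
    differences are a constant except where the shift passes the position [0],
    which is the origin of the terms in [k]. *)
Section RotationOfWeights.
Variables (v v' delta : nat -> A) (k t : A).
Hypothesis v_cycle : forall m, v (m + l.+1)%N = v m.
Hypothesis v'E : forall m, v' m = v m.+1 + delta m.+1.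
Hypothesis delta_step : forall s, (0 < s)%N ->
  delta s - delta s.+1 = (l.+1 %| s)%:R * k - t.

Let alt_sum_v' s m : alt_sum v' s m = alt_sum v s.+1 m + alt_sum delta s.+1 m.
Proof. by rewrite -!alt_sum_shift -alt_sumD; apply: eq_alt_sum. Qed.

Let alt_sum_v_cycle s m : alt_sum v (s + l.+1) m = alt_sum v s m.
Proof. by apply: eq_bigr => j _; rewrite addnAC v_cycle. Qed.

Lemma weight1_rotation : ~~ odd l ->
  [/\ forall x, (x < l)%N ->
       weight1 v' x = weight1 v x.+1 + (odd x)%:R * k - t *+ l./2
    & weight1 v' l = weight1 v 0 - t *+ l./2].
Proof.
move=> el; split=> [x xl|]; rewrite /weight1 alt_sum_v'.
  rewrite -addrA; congr (_ + _); rewrite -{1}(even_halfK el).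
  case: (boolP (odd x)) => ox; last first.
    rewrite mul0r add0r (alt_sum_step0 delta_step) // => j jx oj.
    apply/negP => /dvdnP[[|[|q]] e]; lia.
  rewrite mul1r (alt_sum_step1 (p := l.+1) delta_step) //; try lia.
  by move=> j jx /dvdnP[[|[|q]] e]; lia.
rewrite -[X in _ + alt_sum _ _ X](even_halfK el).
rewrite (alt_sum_step0 delta_step) => [|//|j jl oj]; last first.
  by apply/negP => /dvdnP[[|[|q]] e]; lia.
by rewrite -[l.+2]/(1 + l.+1)%N alt_sum_v_cycle.
Qed.

Lemma weight2_rotation : odd l ->
  [/\ forall x y, (x < y < l)%N -> odd y != odd x -> weight2 v' x y =
       weight2 v x.+1 y.+1 + (odd x)%:R * k - t *+ l.-1./2
    & forall x, (x < l)%N -> ~~ odd x ->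
       weight2 v' x l = weight2 v 0 x.+1 - t *+ l.-1./2].
Proof.
move=> ol; split=> [x y xy oxy | x xl ex]; rewrite /weight2 !alt_sum_v'.
  have e1 : (y - x.+1 = (y - x.+1)./2.*2)%N by rewrite even_halfK //; lia.
  have e2 : (l - y + x = (l - y + x)./2.*2)%N by rewrite even_halfK //; lia.
  have -> : (y.+1 - x.+2 = y - x.+1)%N by lia.
  have -> : (l - y.+1 + x.+1 = l - y + x)%N by lia.
  rewrite addrACA -[RHS]addrA; congr (_ + _).
  have -> : l.-1./2 = ((y - x.+1)./2 + (l - y + x)./2)%N by lia.
  rewrite [in LHS]e1 [in LHS]e2 mulrnDr opprD.
  rewrite (alt_sum_step0 delta_step) => [|//|j jl oj]; last first.
    by apply/negP => /dvdnP[[|[|q]] e]; lia.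
  case: (boolP (odd x)) => ox; last first.
    rewrite mul0r add0r (alt_sum_step0 delta_step) // => j jx oj.
    by apply/negP => /dvdnP[[|[|q]] e]; lia.
  rewrite mul1r addrCA; congr (_ + _).
  rewrite (alt_sum_step1 (p := l.+1) delta_step) //; try lia.
  by move=> j jx /dvdnP[[|[|q]] e]; lia.
have e1 : (l - x.+1 = (l - x.+1)./2.*2)%N by rewrite even_halfK //; lia.
rewrite subnn add0n subn1 addn0 addrACA; congr (_ + _).
  by rewrite -[l.+2]/(1 + l.+1)%N alt_sum_v_cycle addrC.
rewrite [in LHS]e1 -[x in alt_sum delta l.+2 x](even_halfK ex).
have -> : l.-1./2 = ((l - x.+1)./2 + x./2)%N by lia.
rewrite mulrnDr opprD !(alt_sum_step0 delta_step) // => j jx oj.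
  by apply/negP => /dvdnP[[|[|q]] e]; lia.
by apply/negP => /dvdnP[[|[|q]] e]; lia.
Qed.
End RotationOfWeights.
End Weights.

(** * Sets with even gaps are alternating words *)

Fixpoint alt_seq (p : bool) (t : seq nat) : bool :=
  if t is x :: t' then (odd x == p) && alt_seq (~~ p) t' else true.

Fixpoint alt_words d (p : bool) s n : seq (seq nat) :=
  if n is n'.+1 then
    alt_words d p s.+1 n' ++
    (if d is d'.+1 then
       if odd s == p then [seq s :: t | t <- alt_words d' (~~ p) s.+1 n'] else [::]
     else [::])
  else if d is 0 then [:: [::]] else [::].

Lemma alt_wordsS d p s n : alt_words d.+1 p s n.+1 =
  alt_words d.+1 p s.+1 n ++
  (if odd s == p then [seq s :: t | t <- alt_words d (~~ p) s.+1 n] else [::]).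
Proof. by []. Qed.

Lemma alt_words0 p s n : alt_words 0 p s n = [:: [::]].
Proof. by elim: n s => //= n IHn s; rewrite cats0. Qed.

Arguments alt_words : simpl never.

Lemma alt_seq_cat p t1 t2 :
  alt_seq p (t1 ++ t2) = alt_seq p t1 && alt_seq (p (+) odd (size t1)) t2.
Proof.
elim: t1 p => [|x t1 IHt] p /=; first by rewrite addbF.
by rewrite IHt -andbA addbN addNb.
Qed.

Section SumsOverWords.
Variable A : pzRingType.

Lemma word_sumE (F : nat -> A) d p s n :
  word_sum F d p s n = \sum_(t <- alt_words d p s n) \prod_(m <- t) F m.
Proof.
elim: n d p s => [|n IHn] d p s.
  by case: d => [|d]; rewrite /= ?big_nil // big_seq1 big_nil.
case: d => [|d]; first by rewrite word_sum0 alt_words0 big_seq1 big_nil.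
rewrite word_sumS alt_wordsS big_cat /= !IHn; congr (_ + _).
case: eqP => _; last by rewrite big_nil.
by rewrite big_map mulr_sumr; under [RHS]eq_bigr do rewrite big_cons.
Qed.

End SumsOverWords.

Section SumsOverShortWords.
Variable A : nmodType.
Implicit Types G : seq nat -> A.

Lemma big_alt_words0 G p s n : \sum_(t <- alt_words 0 p s n) G t = G [::].
Proof. by rewrite alt_words0 big_seq1. Qed.

Lemma big_alt_words1 G p s n : \sum_(t <- alt_words 1 p s n) G t =
  \sum_(s <= x < s + n | odd x == p) G [:: x].
Proof.
elim: n s => [|n IHn] s; first by rewrite addn0 big_geq // big_nil.
rewrite alt_wordsS big_cat /= IHn addSnnS [in RHS]big_ltn_cond ?addnS ?ltnS ?leq_addr //.
case: ifP => _; last by rewrite big_nil addr0.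
by rewrite big_map big_alt_words0 addrC.
Qed.

Lemma big_alt_words2 G p s n : \sum_(t <- alt_words 2 p s n) G t =
  \sum_(s <= x < s + n | odd x == p)
    \sum_(x.+1 <= y < s + n | odd y != odd x) G [:: x; y].
Proof.
elim: n s => [|n IHn] s; first by rewrite addn0 big_geq // big_nil.
rewrite alt_wordsS big_cat /= IHn addSnnS [in RHS]big_ltn_cond ?addnS ?ltnS ?leq_addr //.
case: eqP => [<-|_]; last by rewrite big_nil addr0.
rewrite big_map big_alt_words1 addrC addSnnS; congr (_ + _).
by rewrite addnS; apply: eq_bigl => y; case: (odd y); case: (odd s).
Qed.

End SumsOverShortWords.

Section SetsAsWords.
Variable l : nat.
Implicit Types (S T : {set 'I_l.+1}) (s n m : nat).

Definition word_of T s n : seq nat := [seq m <- iota s n | cyc l m \in T].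

Lemma word_ofS T s n : word_of T s n.+1 =
  if cyc l s \in T then s :: word_of T s.+1 n else word_of T s.+1 n.
Proof. by []. Qed.

Lemma mem_word_of T s n m :
  (m \in word_of T s n) = (cyc l m \in T) && (s <= m < s + n)%N.
Proof. by rewrite mem_filter mem_iota. Qed.

Lemma eq_word_of T T' s n :
  (forall m, (s <= m < s + n)%N -> (cyc l m \in T) = (cyc l m \in T')) ->
  word_of T s n = word_of T' s n.
Proof. by move=> e; apply: eq_in_filter => m; rewrite mem_iota; apply: e. Qed.

Lemma size_word_of T : size (word_of T 0 l.+1) = #|T|.
Proof.
have -> : #|T| = count [in T] (enum 'I_l.+1).
  by rewrite cardE size_filter -enumT.
rewrite /word_of -val_enum_ord size_filter count_map; apply: eq_count => i /=.
by rewrite cyc_val.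
Qed.

Definition interval s n : {set 'I_l.+1} := [set i : 'I_l.+1 | (s <= i < s + n)%N].

(** A set is determined by the increasing word of its elements; the induction
    removes the smallest position of the interval from the sets as the recursion
    of [alt_words] does from the words. *)
Lemma big_sets_words (A : nmodType) (G : seq nat -> A) d p s n :
  (s + n <= l.+1)%N ->
  \sum_(T : {set 'I_l.+1} | [&& T \subset interval s n,
      size (word_of T s n) == d & alt_seq p (word_of T s n)]) G (word_of T s n) =
  \sum_(t <- alt_words d p s n) G t.
Proof.
elim: n d p s G => [|n IHn] d p s G sn.
  have i0 : interval s 0 = set0.
    by apply/setP => i; rewrite !inE addn0; apply/negP; lia.
  rewrite (bigID (pred1 set0)) /= [X in _ + X]big1 ?addr0; last first.
    by move=> T; rewrite i0 subset0 => /andP[/andP[->]].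
  case: d => [|d].
    rewrite alt_words0 big_seq1 (big_pred1 set0) // => T /=.
    by rewrite i0 subset0 /word_of /= andbT andbb.
  by rewrite big_nil big1 // => T; rewrite /word_of /= andbF.
rewrite (bigID (fun T : {set 'I_l.+1} => cyc l s \in T)) /= addrC.
have scyc : cyc l s = s :> nat by rewrite val_cyc modn_small //; lia.
have sub T : (T \subset interval s.+1 n) = (T \subset interval s n.+1) && (cyc l s \notin T).
  apply/subsetP/andP => [sT | [/subsetP sT sNT] i iT].
    split; last by apply/negP => /sT; rewrite inE scyc ltnn.
    by apply/subsetP => i /sT; rewrite !inE; lia.
  have := sT i iT; rewrite !inE addnS leq_eqVlt => /andP[/orP[/eqP si|-> //] _].
  by case/negP: sNT; rewrite si cyc_val.
have -> : alt_words d p s n.+1 = alt_words d p s.+1 n ++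
    (if d is d'.+1 then
      if odd s == p then [seq s :: t | t <- alt_words d' (~~ p) s.+1 n] else [::]
     else [::]) by [].
rewrite big_cat /=; congr (_ + _).
  rewrite -IHn; last by lia.
  apply: eq_big => T.
    rewrite sub word_ofS; case: (cyc l s \in T); rewrite ?andbF ?andbT //.
  by rewrite word_ofS => /andP[_ /negbTE->].
case: d => [|d].
  rewrite big_nil big1 // => T; rewrite word_ofS => /andP[/and3P[_]] + _ sT.
  by rewrite sT.
have eW T : cyc l s \notin T -> word_of (cyc l s |: T) s n.+1 = s :: word_of T s.+1 n.
  move=> sT; rewrite word_ofS setU11; congr (_ :: _).
  apply: eq_word_of => m ms; rewrite !inE; case: eqP => // /(congr1 val) /=.
  by rewrite scyc val_cyc modn_small; lia.
rewrite (reindex_onto (fun T => cyc l s |: T) (fun T => T :\ cyc l s)) /=; last first.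
  by move=> T /andP[_ sT]; rewrite setD1K.
case: eqP => [ps|ps]; last first.
  rewrite big_nil big1 // => T /andP[/andP[/and3P[_ _]]].
  by rewrite word_ofS => + sT; rewrite sT /= => /andP[/eqP /ps].
rewrite big_map -IHn; last by lia.
apply: eq_big => T.
  rewrite setU11 andbT sub; case: (boolP (cyc l s \in T)) => sT; last first.
    rewrite setU1K // eqxx eW // subUset sub1set inE scyc leqnn addnS ltnS leq_addr.
    by rewrite /= eqSS -ps eqxx !andbT.
  rewrite andbF; apply/negbTE/negP => /andP[_ /eqP eT].
  by move: sT; rewrite -eT !inE eqxx.
move=> /andP[_ /eqP eT]; rewrite eW //.
by rewrite -eT !inE eqxx.
Qed.

Lemma word_of_cat T s m n :
  word_of T s (m + n) = word_of T s m ++ word_of T (s + m) n.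
Proof. by rewrite /word_of iotaD filter_cat. Qed.

Lemma word_of_nil T s n :
  (forall m, (s <= m < s + n)%N -> cyc l m \notin T) -> word_of T s n = [::].
Proof.
move=> sT; apply/eqP; rewrite -size_eq0 size_filter -leqn0 leqNgt -has_count.
by apply/hasPn => m; rewrite mem_iota; apply: sT.
Qed.

Section EvenGaps.
Variable S : {set 'I_l.+1}.

Let even_gaps := [forall i, forall m : 'I_l.+1,
  (0 < m)%N && component (~: S) i m ==> ~~ odd m].

(** Two consecutive elements of [S] are separated by an even gap exactly when
    they have opposite parities. *)
Lemma alt_seq_of_even_gaps : even_gaps -> exists p, alt_seq p (word_of S 0 l.+1).
Proof.
move=> /forallP gaps.
have scan n x m : (x + m + n = l)%N -> cyc l x \in S ->
    (forall j, (j < m)%N -> cyc l (x.+1 + j) \notin S) ->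
    alt_seq (~~ odd x) (word_of S (x.+1 + m) n).
  elim: n x m => [|n IHn] x m xmn xS mS //=; rewrite word_ofS.
  case: (boolP (cyc l (x.+1 + m) \in S)) => yS.
    have em : ~~ odd m.
      case: m => [|m] in xmn mS yS *; first by [].
      have ml : (m.+1 < l.+1)%N by lia.
      have /forallP/(_ (Ordinal ml)) /= := gaps (cyc l x.+1).
      by rewrite component_setC.
    have eo : odd (x.+1 + m) = ~~ odd x by rewrite oddD /= (negbTE em) addbF.
    rewrite /= -eo eqxx /= -[(x.+1 + m).+1]addn0.
    by apply: IHn => //; lia.
  rewrite -addnS; apply: IHn => //; first by lia.
  move=> j; rewrite ltnS leq_eqVlt => /orP[/eqP-> //|]; exact: mS.
suff scan0 n m : (m + n = l.+1)%N -> exists p, alt_seq p (word_of S m n).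
  exact: scan0.
elim: n m => [|n IHn] m mn; first by exists true.
rewrite word_ofS; case: ifP => mS; last by apply: IHn; lia.
exists (odd m); rewrite /= eqxx -[m.+1]addn0; apply: scan => //; lia.
Qed.

(** The gap that crosses the cut is not seen by the word; it is even because it
    is what remains of [l.+1] after the elements of [S], which have the parity of
    [l.+1] in number, and the other gaps. *)
Lemma even_gaps_of_alt_seq p : odd #|S| = odd l.+1 ->
  alt_seq p (word_of S 0 l.+1) -> even_gaps.
Proof.
move=> oS altS; apply/forallP => i; apply/forallP => m; apply/implyP.
case/andP=> m0 /and3P[/mem_arc arcS]; rewrite !inE !negbK => xS yS.
have [x [xl ei {}xS]] : exists x : nat, [/\ (x <= l)%N, i = cyc l x.+1 & cyc l x \in S].
  exists (ord_pred i); rewrite -ordS_cyc !cyc_val ord_predK xS.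
  by split; rewrite // -ltnS.
have eshift j : shift i j = cyc l (x.+1 + j).
  by rewrite shift_cyc ei; apply: cyc_eq; rewrite val_cyc modnDml.
have gap j : (j < m)%N -> cyc l (x.+1 + j) \notin S.
  by move=> /arcS; rewrite inE eshift.
rewrite eshift in yS.
(* The gap starts after [x] and ends before [x.+1 + m]; first the case that it
   does not cross the cut. *)
have [yl | yl] := leqP (x.+1 + m) l.
  have e : word_of S 0 l.+1 = word_of S 0 (x + (m + (l - x - m)).+1).
    by congr word_of; lia.
  move: altS; rewrite e word_of_cat add0n alt_seq_cat => /andP[_].
  rewrite word_ofS xS word_of_cat (@word_of_nil S x.+1 m) => [|j jm]; last first.
    have -> : (j = x.+1 + (j - x.+1))%N by lia.
    by apply: gap; lia.
  have -> : (l - x - m = (l - x.+1 - m).+1)%N by lia.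
  rewrite cat0s word_ofS yS /= => /and3P[/eqP <- /eqP + _].
  by rewrite oddD /=; case: (odd x); case: (odd m).
have ey : cyc l (x.+1 + m) = cyc l (x.+1 + m - l.+1).
  by rewrite -[in LHS](subnK yl) cycDn.
rewrite ey in yS; set y := (x.+1 + m - l.+1)%N in yS.
have yx : (y <= x)%N by have := ltn_ord m; lia.
have eS : word_of S 0 l.+1 = word_of S y (x.+1 - y).
  have -> : word_of S 0 l.+1 = word_of S 0 (y + ((x.+1 - y) + (l - x))).
    by congr word_of; lia.
  rewrite !word_of_cat add0n (@word_of_nil S 0 y) => [|j jy]; last first.
    rewrite -(cycDn l j); have -> : (j + l.+1 = x.+1 + (j + l - x))%N by lia.
    by apply: gap; lia.
  rewrite [X in _ ++ (_ ++ X)]word_of_nil ?cats0 // => j jy.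
  have -> : (j = x.+1 + (j - x.+1))%N by lia.
  by apply: gap; lia.
have altS' := altS; move: oS altS altS'; rewrite -size_word_of eS.
have -> : (x.+1 - y = (x - y) + 1)%N by lia.
rewrite {2}addn1 word_ofS yS /= => + /andP[/eqP oy _].
rewrite word_of_cat alt_seq_cat size_cat oddD.
have -> : (y + (x - y) = x)%N by lia.
rewrite word_ofS xS /= => oS /andP[_ /andP[/eqP ox _]].
move: ox; rewrite -oy; have : (x.+1 + m = y + l.+1)%N by lia.
move/(congr1 odd); rewrite !oddD /=; move: oS; rewrite /word_of /=.
by case: (odd x); case: (odd y); case: (odd m); case: (odd l); case: (odd _).
Qed.

End EvenGaps.

Lemma mem_Sset S d : odd d = odd l.+1 ->
  (S \in Sset l d) = (size (word_of S 0 l.+1) == d) &&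
    (alt_seq false (word_of S 0 l.+1) || alt_seq true (word_of S 0 l.+1)).
Proof.
move=> od; rewrite inE size_word_of; case: eqP => //= Sd; rewrite -Sd in od.
apply/idP/orP => [/alt_seq_of_even_gaps[[]]|[]]; [by right | by left | |];
  exact: even_gaps_of_alt_seq.
Qed.

End SetsAsWords.

(** * Products over components in increasing order *)

Section OrderedMonomials.
Variables (R : realType) (K : unitAlgType R[i]) (l : nat) (f : 'I_l.+1 -> K).
Implicit Types (S : {set 'I_l.+1}) (s n m c : nat).

Let F m : K := f (cyc l m).

(** The contribution to [f_set] of the component that starts at the position [s],
    or [1] if none does. *)
Definition block S s : K :=
  \prod_(1 <= m < l.+1 | component S (cyc l s) m) f_arc f (cyc l s) m.

Let F_cycle m : F (l.+1 + m) = F m.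
Proof. by rewrite /F addnC cycDn. Qed.

Let block_cycle S s : block S (l.+1 + s) = block S s.
Proof. by rewrite /block addnC cycDn. Qed.

Let block_notin S s : cyc l s \notin S -> block S s = 1.
Proof.
move=> sS; rewrite /block big_nat_cond big_pred0 // => m; apply/negbTE/negP.
case/andP=> m0 /and3P[/mem_arc/(_ 0%N) arcS _ _]; case/negP: sS.
by rewrite -(cyc_val (cyc l s)) -[X in cyc l X]addn0 -shift_cyc; apply: arcS; case/andP: m0.
Qed.

Let block_inner S s : cyc l s \in S -> block S s.+1 = 1.
Proof. by move=> sS; apply: big_no_component; rewrite ord_pred_cyc. Qed.

Let block_start S s m : (0 < m <= l)%N -> cyc l s \notin S ->
  (forall j, (j < m)%N -> cyc l (s.+1 + j) \in S) -> cyc l (s.+1 + m) \notin S ->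
  block S s.+1 = \prod_(t <- iota s.+1 m) F t.
Proof.
case/andP=> m0 ml sS run mS; rewrite /block (@big_component _ _ _ _ _ _ m) //.
- rewrite -[X in iota X m]addn0 iotaDl big_map -{2}(subn0 m) big_mkord.
  apply: eq_bigr => j _; rewrite shift_cyc; congr f; apply: cyc_eq.
  by rewrite val_cyc modnDml.
- by rewrite /f_arc big_ord0.
rewrite -[S]setCK; apply: component_setC; rewrite ?inE // => j /run.
by rewrite inE negbK.
Qed.

Let nonfull_mem S s : S != setT -> exists2 j, (j <= l)%N & cyc l (s + j) \notin S.
Proof.
move=> /eqP ST; have [i iS] : exists i, i \notin S.
  apply/existsP; rewrite -negb_forall; apply/negP => /forallP ST'.
  by apply: ST; apply/setP => i; rewrite inE ST'.
exists ((i + l.+1 - s %% l.+1) %% l.+1)%N; first by rewrite -ltnS ltn_mod.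
suff -> : cyc l (s + (i + l.+1 - s %% l.+1) %% l.+1) = i by [].
apply: val_inj; rewrite /= val_cyc modnDmr -modnDml.
have := ltn_mod s l.+1; rewrite ltn0Sn => lt; rewrite subnKC; last by lia.
by rewrite modnDr modn_small.
Qed.

(** The two side conditions say that no component crosses an end of the range of
    positions; each component is then a block of consecutive letters, and the
    blocks come in increasing order. *)
Lemma prod_blocks S s n : S != setT ->
  ~~ ((cyc l s \in S) && (cyc l s.+1 \in S)) ->
  ~~ ((cyc l (s + n) \in S) && (cyc l (s + n).+1 \in S)) ->
  \prod_(t <- iota s.+1 n) block S t = \prod_(t <- word_of S s.+1 n) F t.
Proof.
move=> ST; elim/ltn_ind: n s => -[|n] IHn s cut_s cut_n; first by rewrite !big_nil.
case: (boolP (cyc l s.+1 \in S)) cut_s => sS cut_s; last first.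
  rewrite /= big_cons block_notin // mul1r word_ofS (negbTE sS) IHn ?(negbTE sS) //.
  by rewrite addSnnS.
have [j jl jS] := nonfull_mem s.+1 ST.
have [m mS mmin] : exists2 m, cyc l (s.+1 + m) \notin S &
    forall j, (j < m)%N -> cyc l (s.+1 + j) \in S.
  have exm : exists m, cyc l (s.+1 + m) \notin S by exists j.
  case: (ex_minnP exm) => m mS mmin; exists m => // j' j'm.
  by apply: contraLR j'm => /mmin; rewrite leqNgt.
have ml : (m <= l)%N.
  by apply: leq_trans jl; rewrite leqNgt; apply: contra jS => /mmin.
have m0 : (0 < m)%N by case: m mS {mmin ml} => //; rewrite addn0 sS.
have mn : (m <= n.+1)%N.
  rewrite leqNgt; apply: contra cut_n => nm.
  by rewrite -addSnnS -addnS !mmin // ltnW.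
have {IHn}IH := IHn (n.+1 - m)%N _ (s + m)%N.
have en : n.+1 = (m + (n.+1 - m))%N by rewrite subnKC.
rewrite en iotaD word_of_cat !big_cat; congr (_ * _); last first.
  apply: IH; first by lia.
    by rewrite -addSn (negbTE mS) andbF.
  by rewrite -addnA subnKC.
have -> : word_of S s.+1 m = iota s.+1 m.
  apply/all_filterP/allP => t; rewrite mem_iota => /andP[st tm].
  by rewrite -(subnKC st) mmin // ltn_subLR.
rewrite -(@block_start S s m) ?m0 //; last by move: cut_s; rewrite andbT.
have -> : (m = m.-1.+1)%N by rewrite prednK.
rewrite /= big_cons big1_seq ?mulr1 // => t /andP[_]; rewrite mem_iota => /andP[st tm].
rewrite -(subnKC st) addSn block_inner // mmin // ltn_subLR //.
by rewrite (leq_trans tm) // leq_add2l leq_pred.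
Qed.

Let word_of_cycle S s n :
  word_of S (l.+1 + s) n = [seq (l.+1 + t)%N | t <- word_of S s n].
Proof.
rewrite /word_of iotaDl filter_map; congr map; apply: eq_filter => t /=.
by rewrite addnC cycDn.
Qed.

Let word_of1 S s : word_of S s 1 = if cyc l s \in S then [:: s] else [::].
Proof. by []. Qed.

Let f_set_blocks S : f_set f S = \prod_(t <- iota 0 l.+1) block S t.
Proof.
have -> : iota 0 l.+1 = index_iota 0 l.+1 by rewrite /index_iota subn0.
rewrite big_mkord; apply: eq_bigr => i _.
by rewrite /block cyc_val.
Qed.

Lemma f_set_cut S : S != setT -> ~~ ((cyc l l \in S) && (cyc l 0 \in S)) ->
  f_set f S = \prod_(t <- word_of S 0 l.+1) F t.
Proof.
move=> ST cut; have e0 : cyc l l.+1 = cyc l 0 by rewrite -(cycDn l 0).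
have := @prod_blocks S l l.+1 ST; rewrite cycDn -addSn cycDn e0 => /(_ cut cut).
rewrite f_set_blocks -{1}(addn0 l.+1) iotaDl big_map.
under eq_bigr => t _ do rewrite block_cycle.
move=> ->; rewrite -{1}(addn0 l.+1) word_of_cycle big_map.
by under eq_bigr => t _ do rewrite F_cycle.
Qed.

Variable h : K.
Hypothesis hC : forall x, GRing.comm h x.
Hypothesis f_next : forall i, f i * f (ordS i) = f (ordS i) * f i + h.
Hypothesis f_far : forall i j, j != ordS i -> j != ord_pred i -> GRing.comm (f i) (f j).

Let F_far m m' : (m.+1 < m' <= l)%N -> ~~ ((m == 0)%N && (m' == l)) ->
  GRing.comm (F m) (F m').
Proof.
move=> mm' ml; apply: f_far.
  by rewrite ordS_cyc; apply/eqP => /cyc_inj; lia.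
case: m mm' ml => [|m] mm' ml; last by rewrite ord_pred_cyc; apply/eqP => /cyc_inj; lia.
by rewrite -(cycDn l 0) add0n ord_pred_cyc; apply/eqP => /cyc_inj; lia.
Qed.

(** The component that crosses the cut carries [F l * F 0 = F 0 * F l + h]; all
    other letters that have to be moved commute, because some position [c] outside
    [S] separates them. *)
Lemma f_set_wrap S : S != setT -> (cyc l l \in S) && (cyc l 0 \in S) ->
  f_set f S = \prod_(t <- word_of S 0 l.+1) F t
              + h * \prod_(t <- word_of S 1 l.-1) F t.
Proof.
move=> ST /andP[lS zS].
have [c cS cmin] : exists2 c, cyc l c \notin S & forall j, (j < c)%N -> cyc l j \in S.
  have [j _ jS] := nonfull_mem 0 ST; have exc : exists c, cyc l c \notin S by exists j.
  case: (ex_minnP exc) => c cS cmin; exists c => // j' j'c.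
  by apply: contraLR j'c => /cmin; rewrite leqNgt.
(* Starting the product at the first position [c] outside [S], instead of [0],
   puts the letters [0, ..., c - 1] behind [l], without cutting a component. *)
have [j jl jS] := nonfull_mem 0 ST.
have cl : (c < l)%N.
  rewrite ltnNge; apply/negP; rewrite leq_eqVlt => /orP[/eqP lc|lc].
    by case/negP: cS; rewrite -lc.
  by case/negP: jS; apply: cmin; lia.
case: c cS cmin cl => [|c] cS cmin cl; first by rewrite zS in cS.
have eB : \prod_(t <- iota 0 c.+1) block S t = 1.
  rewrite big1_seq // => -[|t] /andP[_]; rewrite mem_iota => tc.
    by rewrite -(block_cycle S 0) addn0; apply: block_inner.
  by apply: block_inner; apply: cmin; lia.
have -> : f_set f S = \prod_(t <- iota c.+1 l.+1) block S t.
  rewrite f_set_blocks; have -> : iota 0 l.+1 = iota 0 c.+1 ++ iota c.+1 (l - c).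
    by rewrite -iotaD; congr iota; lia.
  have -> : iota c.+1 l.+1 = iota c.+1 (l - c) ++ iota (l.+1 + 0) c.+1.
    have -> : (l.+1 + 0 = c.+1 + (l - c))%N by lia.
    by rewrite -iotaD; congr iota; lia.
  rewrite iotaDl !big_cat big_map /= eB mul1r.
  under [X in _ * X]eq_bigr => t _ do rewrite block_cycle.
  by rewrite eB mulr1.
rewrite prod_blocks //; last 2 first.
- by rewrite (negbTE cS) andbF.
- by rewrite -addSn !cycDn (negbTE cS) andbF.
have word_prefix : word_of S 0 c.+1 = iota 0 c.+1.
  by apply/all_filterP/allP => t; rewrite mem_iota => /andP[_]; apply: cmin.
have ew1 : word_of S c.+1 l.+1 =
    word_of S c.+2 (l - c.+2) ++ l :: [seq (l.+1 + t)%N | t <- iota 0 c.+1].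
  have -> : word_of S c.+1 l.+1 = word_of S c.+1 (1 + ((l - c.+2) + (1 + c.+1))).
    by congr word_of; lia.
  rewrite 3!word_of_cat !word_of1 (negbTE cS) cat0s addn1.
  have -> : (c.+2 + (l - c.+2) = l)%N by lia.
  by rewrite lS -word_prefix -word_of_cycle addn0 addn1.
have ew0 : word_of S 0 l.+1 =
    0%N :: iota 1 c ++ word_of S c.+2 (l - c.+2) ++ [:: l].
  have -> : word_of S 0 l.+1 = word_of S 0 (c.+1 + (1 + ((l - c.+2) + 1))).
    by congr word_of; lia.
  rewrite 3!word_of_cat word_prefix !word_of1 add0n (negbTE cS) cat0s addn1.
  have -> : (c.+2 + (l - c.+2) = l)%N by lia.
  by rewrite lS.
have ew2 : word_of S 1 l.-1 = iota 1 c ++ word_of S c.+2 (l - c.+2).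
  have -> : word_of S 1 l.-1 = word_of S 1 (c + (1 + (l - c.+2))).
    by congr word_of; lia.
  rewrite 2!word_of_cat word_of1 add1n (negbTE cS) cat0s addn1; congr (_ ++ _).
  apply/all_filterP/allP => t; rewrite mem_iota => tc.
  by apply: cmin; lia.
have eF : \prod_(t <- [seq (l.+1 + t)%N | t <- iota 0 c.+1]) F t =
    F 0%N * \prod_(t <- iota 1 c) F t.
  by rewrite big_map; under eq_bigr => t _ do rewrite F_cycle; rewrite big_cons.
rewrite ew0 ew1 ew2 big_cat big_cons eF !(big_cat, big_cons, big_nil) /= mulr1.
set U := \prod_(t <- iota 1 c) F t; set Y := \prod_(t <- word_of S _ _) F t.
have YF0 : GRing.comm (F 0%N) Y.
  rewrite /Y big_seq; apply: (big_ind (GRing.comm (F 0%N))).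
  - exact: commr1.
  - exact: commrM.
  move=> t; rewrite mem_word_of => /andP[_ tl]; apply: F_far; lia.
have FlU : GRing.comm (F l) U.
  rewrite /U big_seq; apply: (big_ind (GRing.comm (F l))).
  - exact: commr1.
  - exact: commrM.
  move=> t; rewrite mem_iota => tl; apply: commr_sym; apply: F_far; lia.
have YU : GRing.comm Y U.
  rewrite /U big_seq; apply: (big_ind (GRing.comm Y)).
  - exact: commr1.
  - exact: commrM.
  move=> t; rewrite mem_iota => tl; apply: commr_sym.
  rewrite /Y big_seq; apply: (big_ind (GRing.comm (F t))).
  - exact: commr1.
  - exact: commrM.
  move=> t'; rewrite mem_word_of => /andP[_ tl']; apply: F_far; lia.
have FlF0 : F l * F 0%N = F 0%N * F l + h.
  have := f_next (cyc l l); rewrite ordS_cyc.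
  by have -> : cyc l l.+1 = cyc l 0 by rewrite -(cycDn l 0).
transitivity (Y * (F l * F 0%N) * U); first by rewrite !mulrA.
rewrite FlF0 mulrDr mulrDl mulrA -YF0 -!mulrA FlU; congr (_ + _).
  by rewrite [Y * (U * _)]mulrA YU !mulrA.
by rewrite mulrA -(hC Y) -!mulrA YU.
Qed.

End OrderedMonomials.

(** * The Hamiltonian as a sum over words *)

Section SumsOverSset.
Variable l : nat.
Implicit Types (S T : {set 'I_l.+1}).

Lemma interval_setT : interval l 0 l.+1 = setT.
Proof. by apply/setP => i; rewrite !inE add0n ltn_ord. Qed.

Lemma big_Sset_words (A : nmodType) (G : seq nat -> A) d :
  (0 < d)%N -> odd d = odd l.+1 ->
  \sum_(S in Sset l d) G (word_of S 0 l.+1) =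
  \sum_(t <- alt_words d false 0 l.+1) G t + \sum_(t <- alt_words d true 0 l.+1) G t.
Proof.
move=> d0 od; rewrite (bigID (fun S => alt_seq false (word_of S 0 l.+1))) /=.
rewrite -!(@big_sets_words l) // interval_setT; congr (_ + _); apply: eq_bigl => S;
  rewrite mem_Sset // subsetT; case: eqP => //= Sd.
  by rewrite andb_orl andbb orb_idr // => /andP[].
case: (word_of S 0 l.+1) Sd d0 => [<-|x t _ _] //=.
by case: (odd x) => /=; rewrite ?orbF ?andbN ?andbT.
Qed.

Definition set_of_word (t : seq nat) : {set 'I_l.+1} := [set i : 'I_l.+1 | (i : nat) \in t].

Lemma word_ofK S : set_of_word (word_of S 0 l.+1) = S.
Proof. by apply/setP => i; rewrite inE mem_word_of cyc_val add0n ltn_ord leq0n !andbT. Qed.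

Lemma big_Sset1 (A : nmodType) (G : {set 'I_l.+1} -> seq nat -> A) : ~~ odd l ->
  \sum_(S in Sset l 1) G S (word_of S 0 l.+1) =
  \sum_(0 <= x < l.+1) G [set cyc l x] [:: x].
Proof.
move=> el; pose G' t := G (set_of_word t) t.
rewrite (eq_bigr (fun S => G' (word_of S 0 l.+1))) => [|S _]; last first.
  by rewrite /G' word_ofK.
rewrite (big_Sset_words G') // !(big_alt_words1 G') /G' add0n.
rewrite !(big_mkcond (fun x => odd x == _)) -big_split.
apply: eq_big_nat => x /andP[_ xl].
have -> : set_of_word [:: x] = [set cyc l x].
  by apply/setP => i; rewrite !inE -val_eqE /= val_cyc modn_small.
by case: (odd x) => /=; rewrite ?add0r ?addr0.
Qed.

Lemma big_Sset2 (A : nmodType) (G : {set 'I_l.+1} -> seq nat -> A) : odd l ->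
  \sum_(S in Sset l 2) G S (word_of S 0 l.+1) = \sum_(0 <= x < l.+1)
    \sum_(x.+1 <= y < l.+1 | odd y != odd x) G [set cyc l x; cyc l y] [:: x; y].
Proof.
move=> ol; pose G' t := G (set_of_word t) t.
rewrite (eq_bigr (fun S => G' (word_of S 0 l.+1))) => [|S _]; last first.
  by rewrite /G' word_ofK.
rewrite (big_Sset_words G') //; last by rewrite /= ol.
rewrite !(big_alt_words2 G') /G' add0n !(big_mkcond (fun x => odd x == _)) -big_split.
apply: eq_big_nat => x /andP[_ xl].
have e y : (x < y < l.+1)%N -> set_of_word [:: x; y] = [set cyc l x; cyc l y].
  move=> xy; apply/setP => i; rewrite !inE -!val_eqE /= !val_cyc !modn_small //.
  by case/andP: xy.
transitivity (\sum_(x.+1 <= y < l.+1 | odd y != odd x) G (set_of_word [:: x; y]) [:: x; y]).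
  by case: (odd x) => /=; rewrite ?add0r ?addr0.
rewrite big_nat_cond [RHS]big_nat_cond; apply: eq_bigr => y /andP[xy _].
by rewrite e.
Qed.

End SumsOverSset.

Section HamiltonianAsWords.
Variables (R : realType) (K : unitAlgType R[i]) (l : nat).
Variables (f a : 'I_l.+1 -> K) (h : K).
Implicit Types (S T : {set 'I_l.+1}).
Hypothesis l1 : (1 < l)%N.
Hypothesis hC : forall x, GRing.comm h x.
Hypothesis aC : forall i x, GRing.comm (a i) x.
Hypothesis f_next : forall i, f i * f (ordS i) = f (ordS i) * f i + h.
Hypothesis f_far : forall i j, j != ordS i -> j != ord_pred i -> GRing.comm (f i) (f j).

Let F m : K := f (cyc l m).
Let wraps S := (cyc l l \in S) && (cyc l 0 \in S).

Let f_setE S : S != setT -> f_set f S = \prod_(t <- word_of S 0 l.+1) F t +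
  (if wraps S then h * \prod_(t <- word_of S 1 l.-1) F t else 0).
Proof.
move=> ST; case: (boolP (wraps S)) => wS; first exact: f_set_wrap.
by rewrite addr0 f_set_cut.
Qed.

Let nonfull_Sset S d : (d <= l)%N -> S \in Sset l d -> S != setT.
Proof.
move=> dl; rewrite inE => /andP[/eqP Sd _]; apply/eqP => ST.
by move: dl; rewrite -Sd ST cardsT card_ord ltnn.
Qed.

Let word_of_wraps S : wraps S -> word_of S 0 l.+1 = 0%N :: word_of S 1 l.-1 ++ [:: l].
Proof.
case/andP=> lS zS.
have -> : word_of S 0 l.+1 = word_of S 0 (1 + (l.-1 + 1)) by congr word_of; lia.
rewrite 2!word_of_cat -[word_of S 0 1]/(if _ then _ else _) zS cat1s.
have -> : (0 + 1 + l.-1 = l)%N by lia.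
by rewrite -[word_of S l 1]/(if _ then _ else _) lS.
Qed.

(** The sets that contain both [0] and [l] produce the term in [h]: removing these
    two elements leaves an alternating word in the positions [1, ..., l - 1] that
    starts with an odd letter. *)
Lemma sum_f_set d : (d.+1 < l)%N -> odd d = odd l.+1 ->
  \sum_(S in Sset l d.+2) f_set f S =
  word_sum F d.+2 false 0 l.+1 + word_sum F d.+2 true 0 l.+1
  + h * word_sum F d true 1 l.-1.
Proof.
move=> dl od.
rewrite (eq_bigr (fun S => \prod_(t <- word_of S 0 l.+1) F t +
    (if wraps S then h * \prod_(t <- word_of S 1 l.-1) F t else 0))); last first.
  by move=> S SS; rewrite f_setE // (nonfull_Sset _ SS).
rewrite big_split /= (big_Sset_words (fun t => \prod_(m <- t) F m)) //; last first.
  by rewrite /= negbK.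
rewrite -!word_sumE; congr (_ + _).
rewrite -big_mkcondr -mulr_sumr; congr (_ * _).
rewrite word_sumE -(@big_sets_words l); last by lia.
have zl : cyc l 0 != cyc l l by apply/eqP => /cyc_inj; lia.
have zI T : T \subset interval l 1 l.-1 -> cyc l 0 \notin T.
  move=> /subsetP sT; apply/negP => /sT; rewrite inE val_cyc mod0n; lia.
have lI T : T \subset interval l 1 l.-1 -> cyc l l \notin T.
  move=> /subsetP sT; apply/negP => /sT; rewrite inE val_cyc modn_small; lia.
rewrite (reindex_onto (fun T => cyc l 0 |: (cyc l l |: T))
           (fun S => S :\ cyc l 0 :\ cyc l l)) /=; last first.
  move=> S /andP[_ /andP[lS zS]].
  by rewrite setD1K ?setD1K // !inE lS eq_sym zl.
have eW T : word_of (cyc l 0 |: (cyc l l |: T)) 1 l.-1 = word_of T 1 l.-1.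
  apply: eq_word_of => m ml; rewrite !inE.
  have /negbTE-> : cyc l m != cyc l 0 by apply/eqP => /cyc_inj; lia.
  by have /negbTE-> : cyc l m != cyc l l by apply/eqP => /cyc_inj; lia.
apply: eq_big => T; last by rewrite eW.
have wT : wraps (cyc l 0 |: (cyc l l |: T)) by rewrite /wraps !inE !eqxx orbT.
rewrite mem_Sset /= ?negbK // wT andbT word_of_wraps // eW /= alt_seq_cat /= !andbT.
rewrite size_cat /= addn1 !eqSS orbF.
have -> : (cyc l 0 |: (cyc l l |: T)) :\ cyc l 0 :\ cyc l l == T =
    (T \subset interval l 1 l.-1).
  apply/eqP/idP => [eT | sT].
    apply/subsetP => i iT; rewrite inE; have il := ltn_ord i.
    have i0 : (i : nat) != 0%N.
      by move: iT; rewrite -eT; apply: contraTneq => i0; rewrite -(cyc_val i) i0 !inE eqxx andbF.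
    have iL : (i : nat) != l.
      by move: iT; rewrite -eT; apply: contraTneq => iL; rewrite -(cyc_val i) iL !inE eqxx.
    lia.
  by rewrite setU1K ?setU1K ?lI // !inE negb_or zl zI.
rewrite [RHS]andbC -andbA; case: eqP => //= ->.
suff -> : (odd l == ~~ odd d) = true by rewrite andbT.
by rewrite od /= negbK eqxx.
Qed.

Let F_next m : F m * F m.+1 = F m.+1 * F m + h.
Proof. by rewrite /F -ordS_cyc. Qed.

Lemma H0_even : ~~ odd l -> H0_ge2 f a h =
  cubic_ham F h (fun x => chi a (~: [set cyc l x])) l.+1.
Proof.
move=> el; rewrite /H0_ge2 /cubic_ham /=.
have eQ : \sum_(S in Sset l 1) chi a (~: S) * f_set f S =
    \sum_(0 <= x < l.+1) chi a (~: [set cyc l x]) * F x.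
  rewrite (eq_bigr (fun S => chi a (~: S) * \prod_(t <- word_of S 0 l.+1) F t)).
    rewrite (big_Sset1 (fun S t => chi a (~: S) * \prod_(m <- t) F m)) //.
    by apply: eq_bigr => x _; rewrite big_seq1.
  move=> S SS; rewrite f_setE ?(nonfull_Sset _ SS) 1?ltnW //.
  case: ifP => [wS|_]; last by rewrite addr0.
  move: SS; rewrite mem_Sset ?oddS ?(negbTE el) // word_of_wraps // /= size_cat.
  by rewrite addn1.
case: (altP (l =P 2)) => [l2|ln2].
  have eF k : (k <= l)%N -> f (inord k) = F k.
    by move=> kl; congr f; rewrite /cyc modn_small.
  rewrite eQ !eF ?l2 //; congr (_ + _).
  have nil d p s : word_sum F d.+1 p s 0 = 0 by [].
  by rewrite l2 !word_sumS /= !word_sum0 !nil !(mulr0, mulr1, addr0, add0r) !mulrA.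
have -> : (l == 3) = false by apply/eqP => l3; rewrite l3 in el.
by rewrite eQ el (@sum_f_set 1); [|lia|rewrite /= el].
Qed.

Lemma varpi_comm i x : GRing.comm x (varpi a i).
Proof.
apply: big_ind => [||j _]; [exact: commr0 | exact: commrD |].
by rewrite /GRing.comm -scalerAr -scalerAl aC.
Qed.

Lemma chi_comm S x : GRing.comm x (chi a S).
Proof.
have ind := big_ind (GRing.comm x) (commr0 x) (@commrD _ x).
apply: (ind) => i _; apply: (ind) => m _; apply: (ind) => j _.
by apply: commrM; [exact: commr_sign | exact: varpi_comm].
Qed.

(** The central term collects the square in the definition of [H_0] and the
    correction of [F l * F 0] in the quadratic part. *)
Lemma H0_odd : odd l -> exists2 z, (forall x, GRing.comm x z) & H0_ge2 f a h =
  quartic_ham F h (fun x y => chi a (~: [set cyc l x; cyc l y])) l.+1 + z.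
Proof.
move=> ol; pose Z := (\sum_(i < l.+1 | (0 < i)%N) (-1) ^+ i.-1 * varpi a i) ^+ 2.
pose z := \sum_(S in Sset l 2 | wraps S) chi a (~: S) * h.
have ind x := big_ind (GRing.comm x) (commr0 x) (@commrD _ x).
have ZC x : GRing.comm x Z.
  apply: commrX; apply: (ind) => i _.
  by apply: commrM; [exact: commr_sign | exact: varpi_comm].
have zC x : GRing.comm x z.
  apply: (ind) => S _; apply: commrM; first exact: chi_comm.
  exact/commr_sym/hC.
exists (z + Z) => [x|]; first by apply: commrD; [apply: zC | apply: ZC].
rewrite /H0_ge2 /quartic_ham /= -/Z.
have eQ : \sum_(S in Sset l 2) chi a (~: S) * f_set f S =
    \sum_(0 <= x < l.+1) \sum_(x.+1 <= y < l.+1 | odd y != odd x)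
       chi a (~: [set cyc l x; cyc l y]) * (F x * F y) + z.
  rewrite (eq_bigr (fun S => chi a (~: S) * \prod_(t <- word_of S 0 l.+1) F t
     + if wraps S then chi a (~: S) * h else 0)).
    rewrite big_split -big_mkcondr -/z; congr (_ + _).
    rewrite (big_Sset2 (fun S t => chi a (~: S) * \prod_(m <- t) F m)) //.
    by apply: eq_bigr => x _; apply: eq_bigr => y _; rewrite big_cons big_seq1.
  move=> S SS; rewrite f_setE ?(nonfull_Sset _ SS) //.
  case: ifP => [wS|_]; last by rewrite !addr0.
  rewrite mulrDr; congr (_ + _); congr (_ * _).
  move: SS; rewrite mem_Sset ?oddS ?ol // word_of_wraps // /= size_cat addn1 !eqSS.
  by case: (word_of S 1 l.-1) => // _; rewrite big_nil mulr1.
have -> : (l == 2) = false by apply/eqP => l2; rewrite l2 in ol.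
case: (altP (l =P 3)) => [l3|ln3].
  have eF k : (k <= l)%N -> f (inord k) = F k.
    by move=> kl; congr f; rewrite /cyc modn_small.
  rewrite eQ !eF ?l3 // !addrA; do 3! congr (_ + _).
  have nil d p s : word_sum F d.+1 p s 0 = 0 by [].
  by rewrite l3 !word_sumS /= !word_sum0 !nil !(mulr0, mulr1, addr0, add0r) !mulrA.
rewrite eQ ol (@sum_f_set 2) ?addrA /= ?negbK ?ol //; lia.
Qed.
End HamiltonianAsWords.

(** * Presented algebras, and why h does not vanish *)

Section MorphismsOfPresentations.
Variables (A B : pzRingType) (ev : {rmorphism A -> B}).

Lemma rmorph_commutator x y : ev (commutator x y) = commutator (ev x) (ev y).
Proof. by rewrite /commutator rmorphB !rmorphM. Qed.

Lemma rmorph_commutatorB x y z :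
  ev (commutator x y - z) = commutator (ev x) (ev y) - ev z.
Proof. by rewrite rmorphB rmorph_commutator. Qed.

Lemma relator_rmorph l (f : 'I_(nf l) -> A) (a : 'I_l.+1 -> A) h x :
  relator f a h x ->
  relator (fun i => ev (f i)) (fun i => ev (a i)) (ev h) (ev x).
Proof.
pose F f i := ev (f i).
case: l f a => [|[|n]] f a //=.
  case=> [|||i j|i j|i|j];
    rewrite ?rmorph_commutatorB ?rmorph_commutator ?rmorphM ?rmorph_nat.
  - exact: (relator_one10 (F _ f) (F _ a)).
  - exact: (relator_one02 (F _ f) (F _ a)).
  - exact: (relator_one21 (F _ f) (F _ a)).
  - exact: (relator_one_af (F _ f) (F _ a)).
  - exact: (relator_one_aa (F _ f) (F _ a)).
  - exact: (relator_one_ah (F _ f) (F _ a)).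
  exact: (relator_one_hf (F _ f) (F _ a)).
case=> [i|i j ij ji|i j|i j|i|j]; rewrite ?rmorph_commutatorB ?rmorph_commutator.
- exact: (relator_ge2_next (F _ f) (F _ a)).
- exact: (relator_ge2_far (F _ f) (F _ a) _ ij ji).
- exact: (relator_ge2_af (F _ f) (F _ a)).
- exact: (relator_ge2_aa (F _ f) (F _ a)).
- exact: (relator_ge2_ah (F _ f) (F _ a)).
exact: (relator_ge2_hf (F _ f) (F _ a)).
Qed.

Lemma ideal_rmorph (S : A -> Prop) x :
  (forall y, S y -> ev y = 0) -> two_sided_ideal S x -> ev x = 0.
Proof.
move=> S0; elim=> {x} [x /S0 //||x y _ ex _ ey|c x _ ex|c x _ ex].
- exact: rmorph0.
- by rewrite rmorphD ex ey addr0.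
- by rewrite rmorphM ex mulr0.
- by rewrite rmorphM ex mul0r.
Qed.

End MorphismsOfPresentations.

Section FreeAlgebra.
Variables (C : comNzRingType) (l : nat).
Implicit Types (g : gen l) (p : free_alg C l).

(** Every element is a combination of monomials, and every monomial a product of
    generators. *)
Lemma free_alg_ind (P : free_alg C l -> Prop) :
  P 0 -> P 1 -> (forall g, P (free_gen C g)) ->
  (forall x y, P x -> P y -> P (x + y)) -> (forall x y, P x -> P y -> P (x * y)) ->
  (forall (c : C) x, P x -> P (c *: x)) -> forall p, P p.
Proof.
move=> P0 P1 Pgen PD PM PZ p; rewrite (monalgE (p : {malg C[{fmonom (gen l)}]})).
apply: (big_ind P) => // k _.
have -> : (mkmalgU k p@_k : {malg C[{fmonom (gen l)}]}) =
    p@_k *: (mkmalgU k 1 : {malg C[{fmonom (gen l)}]}).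
  by apply/malgP => k'; rewrite mcoeffZ !mcoeffU mulrnAr mulr1.
apply: (PZ); case: k => s.
suff -> : (mkmalgU (FMonom s) 1 : {malg C[{fmonom (gen l)}]}) =
    \prod_(g <- s) free_gen C g.
  by apply: (big_ind P).
elim: s => [|g s IHs]; first by rewrite big_nil -fmoneE.
rewrite big_cons -IHs /free_gen.
transitivity (fgmul (mkmalgU (fmu g) (1 : C)) (mkmalgU (FMonom s) 1)); last by [].
by rewrite fgmulUU mulr1 -[mmul _ _]/(fmmul _ _) fmmulE fmuE.
Qed.

Section Evaluation.
Variables (A : nzRingType) (sc : {rmorphism C -> A}) (phi : gen l -> A).
Hypothesis scC : forall c x, GRing.comm (sc c) x.

Definition word_eval (k : {fmonom (gen l)}) : A := \prod_(g <- (k : seq _)) phi g.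

Lemma word_eval_multiplicative : mmorphism word_eval.
Proof.
split=> [k1 k2|]; first by rewrite /word_eval -[mmul k1 k2]/(fmmul k1 k2) fmmulE big_cat.
by rewrite /word_eval fm1 big_nil.
Qed.

HB.instance Definition _ :=
  isMultiplicative.Build {fmonom (gen l)} A word_eval word_eval_multiplicative.

Definition free_eval (p : free_alg C l) : A := mmap sc word_eval p.

Lemma free_eval_gen g : free_eval (free_gen C g) = phi g.
Proof.
rewrite /free_eval /free_gen mmapU /word_eval fmuE big_seq1 -[RHS]mul1r.
by congr (_ * _); exact: (rmorph1 sc).
Qed.

Lemma free_eval_additive : zmod_morphism free_eval.
Proof. exact: (raddfB (mmap sc word_eval)). Qed.

Lemma free_eval_multiplicative : monoid_morphism free_eval.
Proof.
have scC' (q : {malg C[{fmonom (gen l)}]}) m m' : GRing.comm (sc q@_m) (word_eval m').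
  exact: scC.
have [M1 M2] := commr_mmap_is_multiplicative scC'; split; [exact: M2 | exact: M1].
Qed.

Lemma free_eval_relation p :
  (forall f a h, (forall i, f i = phi (genf i)) -> (forall i, a i = phi (gena i)) ->
     h = phi (genh l) -> forall y, relator f a h y -> y = 0) ->
  relation_ideal p -> free_eval p = 0.
Proof.
pose ev : {rmorphism free_alg C l -> A} := HB.pack free_eval
  (GRing.isZmodMorphism.Build _ _ _ free_eval_additive)
  (GRing.isMonoidMorphism.Build _ _ _ free_eval_multiplicative).
move=> rel0; apply: (@ideal_rmorph _ _ ev) => x /(relator_rmorph ev).
by apply: rel0 => *; exact: free_eval_gen.
Qed.

End Evaluation.
End FreeAlgebra.

(** Nilpotent matrices satisfying the defining relations in which the central
    generator survives.  A product of two matrices [heisenberg] is the corner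
    matrix or zero according to their indices, which suffices to realise the
    commutators of the [f_i]; products of three vanish, so that the corner matrix
    commutes with all of them. *)
Section HeisenbergWitness.
Variables (C : comNzRingType) (l : nat).

Let A : nzRingType := 'M[C]_l.+3.
Let top : 'I_l.+3 := ord0.
Let bot : 'I_l.+3 := ord_max.
Let mid (i : 'I_l.+1) : 'I_l.+3 := inord i.+1.
Let e (i j : 'I_l.+3) : A := delta_mx i j.

Let mid_val i : mid i = i.+1 :> nat.
Proof. by rewrite inordK // !ltnS ltnW // ltnS. Qed.

Let eM i j i' j' : e i j * e i' j' = if j == i' then e i j' else 0.
Proof. by rewrite /e -[_ * _]/(_ *m _) mul_delta_mx_cond; case: eqP. Qed.

Let mid_eq i j : (mid i == mid j) = (i == j).
Proof. by rewrite -!val_eqE /= !mid_val eqSS. Qed.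

Let bot_mid i : (bot == mid i) = false.
Proof. by rewrite -val_eqE /= mid_val eqSS; apply/negP; have := ltn_ord i; lia. Qed.

Let mid_top i : (mid i == top) = false.
Proof. by rewrite -val_eqE /= mid_val. Qed.

Let bot_top : (bot == top) = false.
Proof. by []. Qed.

Definition heisenberg (i j : 'I_l.+1) : A := e top (mid i) + e (mid j) bot.
Definition heisenberg_center : A := e top bot.

Lemma heisenbergM i j i' j' :
  heisenberg i j * heisenberg i' j' = heisenberg_center *+ (i == j').
Proof.
rewrite /heisenberg mulrDl !mulrDr !eM mid_eq mid_top bot_mid.
rewrite bot_top !addr0 add0r.
by case: eqP.
Qed.

Lemma heisenberg_centerM i j : heisenberg_center * heisenberg i j = 0.
Proof.
by rewrite /heisenberg /heisenberg_center mulrDr !eM bot_mid bot_top addr0.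
Qed.

Lemma heisenbergM_center i j : heisenberg i j * heisenberg_center = 0.
Proof.
rewrite /heisenberg /heisenberg_center mulrDl !eM mid_top bot_top.
by rewrite addr0.
Qed.

Lemma heisenberg_center_neq0 : heisenberg_center != 0.
Proof. by apply/eqP => /matrixP/(_ top bot)/eqP; rewrite !mxE !eqxx oner_eq0. Qed.

Lemma genh_not_relation_of (phi : gen l -> A) : phi (genh l) = heisenberg_center ->
  (forall f a h, (forall i, f i = phi (genf i)) -> (forall i, a i = phi (gena i)) ->
     h = phi (genh l) -> forall y, relator f a h y -> y = 0) ->
  ~ relation_ideal (free_gen C (genh l)).
Proof.
move=> phih rel0 idh; case/eqP: heisenberg_center_neq0; rewrite -phih.
have scC (c : C) (x : A) : GRing.comm (scalar_mx c : A) x.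
  by rewrite /GRing.comm -!mulmxE scalar_mxC.
by rewrite -(free_eval_gen scalar_mx) (free_eval_relation scC rel0 idh).
Qed.

End HeisenbergWitness.

(** The generators [alpha_i] are sent to zero.  For [l >= 2], the generator [f_i]
    goes to [heisenberg i (i - 1)], whose product with the image of [f_j] is the
    corner exactly when [j = i + 1]. *)
Lemma genh_not_relation (C : comNzRingType) l :
  (0 < l)%N -> ~ relation_ideal (free_gen C (genh l)).
Proof.
case: l => [|[|n]] // _.
  (* With [f_1 = - f_0] the first relation becomes [2 * h * f_2 = 0], which holds since
     products of three matrices vanish. *)
  pose p := heisenberg C (0 : 'I_2) 1; pose q := heisenberg C (0 : 'I_2) 0.
  pose z := heisenberg_center C 1.
  pose phi (g : gen 1) := match g with
    | inl (inl i) => if (i : nat) == 0%N then p else if (i : nat) == 1%N then - p else q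
    | inl (inr i) => 0
    | inr _ => z
    end.
  apply: (@genh_not_relation_of _ _ phi) => // f a h fE aE -> y.
  have pq : p * q = z by rewrite heisenbergM.
  have qp : q * p = 0 by rewrite heisenbergM.
  have zp : z * p = 0 by apply: heisenberg_centerM.
  have zq : z * q = 0 by apply: heisenberg_centerM.
  have pz : p * z = 0 by apply: heisenbergM_center.
  have qz : q * z = 0 by apply: heisenbergM_center.
  case=> [|||i j|i j|i|j]; rewrite /commutator ?fE ?aE /= ?mul0r ?mulr0 ?subrr //.
  - by rewrite mulNr mulrN subrr -mulrA zq mulr0 subrr.
  - by rewrite pq qp subr0 subrr.
  - by rewrite mulNr mulrN qp pq oppr0 add0r opprK subrr.
  by do 2?case: ifP => _; rewrite ?mulNr ?mulrN ?zp ?pz ?zq ?qz ?oppr0 addr0.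
pose phi (g : gen n.+2) := match g with
  | inl (inl i) => heisenberg C (i : 'I_n.+3) (ord_pred (i : 'I_n.+3))
  | inl (inr i) => 0
  | inr _ => heisenberg_center C n.+2
  end.
apply: (@genh_not_relation_of _ _ phi) => // f a h fE aE -> y.
have com0 x : commutator x 0 = 0 :> 'M[C]_n.+2.+3 by rewrite /commutator mulr0 mul0r subrr.
have com0' x : commutator 0 x = 0 :> 'M[C]_n.+2.+3 by rewrite /commutator mulr0 mul0r subrr.
case=> [i|i j ij ji|i j|i j|i|j]; rewrite ?fE ?aE /= ?com0 ?com0' //.
- rewrite /commutator !heisenbergM ordSK eqxx.
  have /negbTE-> : ordS i != ord_pred i.
    rewrite -(cyc_val i) ordS_cyc -(cycDn _ i) addnS ord_pred_cyc.
    by apply/eqP => /cyc_inj; lia.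
  by rewrite subr0 subrr.
- rewrite /commutator !heisenbergM.
  rewrite -(can2_eq (@ordSK _) (@ord_predK _)) eq_sym (negbTE ij) (negbTE ji).
  by rewrite subrr.
by rewrite /commutator heisenberg_centerM heisenbergM_center subrr.
Qed.

(** * Derivations and automorphisms of the skew field *)

Section Derivations.
Variables (C : comNzRingType) (K : unitAlgType C) (D : K -> K).
Hypothesis D_lin : linear D.
Hypothesis D_leib : forall x y, D (x * y) = D x * y + x * D y.

Lemma derivD x y : D (x + y) = D x + D y.
Proof. by have := D_lin 1 x y; rewrite !scale1r. Qed.

Lemma deriv0 : D 0 = 0.
Proof. by apply: (@addrI _ (D 0)); rewrite -derivD !addr0. Qed.

Lemma derivZ c x : D (c *: x) = c *: D x.
Proof. by have := D_lin c x 0; rewrite !addr0 deriv0 addr0. Qed.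

Lemma derivN x : D (- x) = - D x.
Proof. by rewrite -scaleN1r derivZ scaleN1r. Qed.

Lemma derivB x y : D (x - y) = D x - D y.
Proof. by rewrite derivD derivN. Qed.

Lemma deriv1 : D 1 = 0.
Proof. by apply: (@addrI _ (D 1)); rewrite addr0 -{3}[1]mulr1 D_leib mulr1 mul1r. Qed.

Lemma derivV x : x \is a GRing.unit -> D x^-1 = - (x^-1 * D x * x^-1).
Proof.
move=> ux; have := D_leib x^-1 x; rewrite mulVr // deriv1 => /esym/eqP.
rewrite addr_eq0 => /eqP/(congr1 (fun y => y * x^-1)).
by rewrite mulrK // mulNr.
Qed.

End Derivations.

Section Brackets.
Variables (R : realType) (K : unitAlgType R[i]) (h H : K).
Hypothesis hC : forall x : K, GRing.comm h x.

Lemma bracket_linear : linear (bracket h H).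
Proof.
move=> c x y; rewrite /bracket /commutator [H * _]mulrDr mulrDl opprD addrACA mulrDr.
by congr (_ + _); rewrite -!scalerAr -!scalerAl -scalerBr -scalerAr.
Qed.

Lemma bracket_leibniz x y :
  bracket h H (x * y) = bracket h H x * y + x * bracket h H y.
Proof.
have hVC z : h^-1 * z = z * h^-1 by apply/commr_sym/commrV/commr_sym.
have xhV z : x * (h^-1 * z) = h^-1 * (x * z) by rewrite mulrA -hVC -mulrA.
rewrite /bracket /commutator xhV -[h^-1 * _ * y]mulrA -mulrDr.
congr (_ * _); ncring.
Qed.

End Brackets.

Section SkewFieldOfFractions.
Variables (C : comNzRingType) (l : nat) (K : unitAlgType C).
Variable ev : {lrmorphism free_alg C l -> K}.
Hypothesis hK : is_quotient_skew_field ev.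

(** The skew field is generated by the images of the generators under the
    operations of a field, so statements stable under these need checking on
    generators only. *)
Lemma fraction_ind (P : K -> Prop) :
  P 0 -> P 1 -> (forall g, P (ev (free_gen C g))) ->
  (forall x y, P x -> P y -> P (x + y)) -> (forall x y, P x -> P y -> P (x * y)) ->
  (forall c x, P x -> P (c *: x)) ->
  (forall x, x \is a GRing.unit -> P x -> P x^-1) -> forall x, P x.
Proof.
move=> P0 P1 Pgen PD PM PZ PV x.
have Pev p : P (ev p).
  apply: (@free_alg_ind C l (fun p => P (ev p))) p => //.
  - by rewrite rmorph0.
  - by rewrite rmorph1.
  - by move=> x' y Px Py; rewrite rmorphD; apply: PD.
  - by move=> x' y Px Py; rewrite rmorphM; apply: PM.
  - by move=> c x' Px; rewrite linearZ; apply: PZ.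
have [p [q [q0 ->]]] := qsf_frac hK x.
by apply: PM => //; apply: PV => //; apply: (qsf_unit hK).
Qed.

Lemma central_of_gens (z : K) :
  (forall g, GRing.comm z (ev (free_gen C g))) -> forall x, GRing.comm z x.
Proof.
move=> zg; apply: fraction_ind => //.
- exact: commr0.
- exact: commr1.
- by move=> x y zx zy; apply: commrD.
- by move=> x y zx zy; apply: commrM.
- by move=> c x zx; rewrite /GRing.comm -scalerAr -scalerAl zx.
- by move=> x _ zx; apply: commrV.
Qed.

Lemma gen_relation x :
  relator (fun i => free_gen C (genf i)) (fun i => free_gen C (gena i))
    (free_gen C (genh l)) x -> ev x = 0.
Proof. by move=> rx; apply/(qsf_ker hK)/ideal_gen. Qed.

Lemma ev_genh_unit : (0 < l)%N -> ev (free_gen C (genh l)) \is a GRing.unit.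
Proof.
move=> l0; apply: (qsf_unit hK); apply/eqP => /(qsf_ker hK).
exact: genh_not_relation.
Qed.

Lemma commutes_of_gens (D : K -> K) (w : {lrmorphism K -> K}) :
  linear D -> (forall x y, D (x * y) = D x * y + x * D y) ->
  (forall g, D (w (ev (free_gen C g))) = w (D (ev (free_gen C g)))) ->
  forall x, D (w x) = w (D x).
Proof.
move=> D_lin D_leib Dg; apply: fraction_ind => //.
- by rewrite rmorph0 (deriv0 D_lin) rmorph0.
- by rewrite rmorph1 (deriv1 D_leib) rmorph0.
- by move=> x y Dx Dy; rewrite rmorphD !(derivD D_lin) rmorphD Dx Dy.
- by move=> x y Dx Dy; rewrite rmorphM !D_leib rmorphD !rmorphM Dx Dy.
- by move=> c x Dx; rewrite linearZ /= !(derivZ D_lin) linearZ /= Dx.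
move=> x ux Dx; rewrite rmorphV // !(derivV D_leib) ?rmorph_unit //.
by rewrite rmorphN !rmorphM rmorphV // Dx.
Qed.

Lemma intertwine_of_gens (g1 g2 g3 g4 : {lrmorphism K -> K}) :
  (forall g, g1 (g2 (ev (free_gen C g))) = g3 (g4 (ev (free_gen C g)))) ->
  forall x, g1 (g2 x) = g3 (g4 x).
Proof.
move=> eg; apply: fraction_ind => //.
- by rewrite !rmorph0.
- by rewrite !rmorph1.
- by move=> x y ex ey; rewrite !rmorphD /= ex ey.
- by move=> x y ex ey; rewrite !rmorphM /= ex ey.
- have gZ (g : {lrmorphism K -> K}) c x : g (c *: x) = c *: g x by exact: linearZ.
  by move=> c x ex; rewrite !gZ ex.
by move=> x ux ex; rewrite !rmorphV ?rmorph_unit //= ex.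
Qed.

End SkewFieldOfFractions.

Section WeylGroup.
Variables (T : Type) (l : nat) (D : T -> T) (s : 'I_l.+1 -> T -> T) (pi : T -> T).
Hypothesis pi_bij : bijective pi.
Hypothesis s_pi : forall i x, s (ordS i) (pi x) = pi (s i x).
Hypothesis D_pi : forall x, D (pi x) = pi (D x).

(** All reflections are conjugate to [s i0] under the powers of [pi]. *)
Lemma commutes_reflections i0 : (forall x, D (s i0 x) = s i0 (D x)) ->
  forall i x, D (s i x) = s i (D x).
Proof.
move=> D0; have [pi' piK pi'K] := pi_bij.
have Dm m x : D (s (cyc l (i0 + m)) x) = s (cyc l (i0 + m)) (D x).
  elim: m x => [|m IHm] x; first by rewrite addn0 cyc_val.
  rewrite addnS -ordS_cyc -[x]pi'K s_pi !D_pi IHm s_pi //.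
move=> i; have -> : i = cyc l (i0 + (i + l.+1 - i0)); last exact: Dm.
by rewrite subnKC ?cycDn ?cyc_val // (leq_trans (ltnW (ltn_ord i0))) // leq_addl.
Qed.

Lemma commutes_weyl_group w : (forall i x, D (s i x) = s i (D x)) ->
  extended_affine_weyl_group s pi w -> forall x, D (w x) = w (D x).
Proof.
move=> Ds; elim=> {w} [g [[i ->] | ->] // | // | g1 g2 _ IH1 _ IH2 x | g g' _ IHg gK g'K x].
  by rewrite /= IH1 IH2.
by rewrite -{2}[x]g'K IHg gK.
Qed.

End WeylGroup.

(** * Roots and fundamental weights *)

Section RootDatum.
Variables (l : nat).
Hypothesis l1 : (1 < l)%N.
Implicit Types (i j r : 'I_l.+1).

Lemma ordS_neq i : ordS i != i.
Proof. by rewrite -(cyc_val i) ordS_cyc; apply/eqP => /cyc_inj; lia. Qed.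

Lemma ord_pred_neq i : ord_pred i != i.
Proof. by apply/eqP => e; have := ordS_neq i; rewrite -{1}e ord_predK eqxx. Qed.

Lemma ordS_neq_pred i : ordS i != ord_pred i.
Proof.
rewrite -(cyc_val i) ordS_cyc -(cycDn _ i) addnS ord_pred_cyc.
by apply/eqP => /cyc_inj; lia.
Qed.

Lemma sum_cartan (V : zmodType) (x : 'I_l.+1 -> V) i :
  \sum_r x r *~ cartan i r = x i *+ 2 - x (ordS i) - x (ord_pred i).
Proof.
rewrite (bigD1 i) //= (bigD1 (ordS i)) ?ordS_neq //= (bigD1 (ord_pred i)) /=; last first.
  by rewrite ord_pred_neq eq_sym ordS_neq_pred.
rewrite big1 ?addr0 => [|r /andP[/andP[ri rS] rP]]; last first.
  by rewrite /cartan (negbTE ri) (negbTE rS) (negbTE rP) mulr0z.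
rewrite /cartan eqxx (negbTE (ordS_neq i)) (negbTE (ord_pred_neq i)) !eqxx orbT /=.
by rewrite -!addrA.
Qed.

Lemma sum_orient (V : zmodType) (x : 'I_l.+1 -> V) i (P : pred 'I_l.+1) :
  \sum_(r | P r) x r *~ orient i r =
  (if P (ordS i) then x (ordS i) else 0) - (if P (ord_pred i) then x (ord_pred i) else 0).
Proof.
rewrite big_mkcond (bigD1 (ordS i)) //= (bigD1 (ord_pred i)) /=; last first.
  by rewrite eq_sym ordS_neq_pred.
rewrite big1 ?addr0 => [|r /andP[rS rP]]; last first.
  by rewrite /orient (negbTE rS) (negbTE rP) mulr0z if_same.
rewrite /orient !eqxx [ord_pred i == _]eq_sym (negbTE (ordS_neq_pred i)) mulr1z.
by congr (_ + _); case: ifP => _; rewrite ?oppr0 // mulrN1z.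
Qed.

Variables (R : realType) (K : unitAlgType R[i]) (a : 'I_l.+1 -> K).

Definition varpi_coef (i r : nat) : R[i] := (minn i r)%:R - (i * r)%:R / l.+1%:R.

Lemma varpiE i : varpi a i = \sum_(r < l.+1) varpi_coef i r *: a r.
Proof.
rewrite /varpi big_mkcond; apply: eq_bigr => r _; case: posnP => // ->.
by rewrite /varpi_coef minn0 muln0 mul0r subrr scale0r.
Qed.

(** The [varpi_i] are obtained from the simple roots by the inverse of the finite
    Cartan matrix, which is minus a second difference; at the node [1] the boundary
    value [varpi_0 = 0] enters. *)
Lemma varpi_root :
  (varpi a (cyc l 0) - varpi a (cyc l 1)) + (varpi a (cyc l 2) - varpi a (cyc l 1))
  = - a (cyc l 1).
Proof.
rewrite !varpiE -!sumrB -big_split (bigD1 (cyc l 1)) //= big1 ?addr0.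
  rewrite !val_cyc mod0n !modn_small ?ltnS ?(ltnW l1) // -!scalerBl -scalerDl -[RHS]scaleN1r.
  congr (_ *: _); rewrite /varpi_coef !natrM /=; ring.
move=> r r1; rewrite -!scalerBl -scalerDl !val_cyc mod0n !modn_small ?ltnS ?(ltnW l1) //.
have rn1 : (r : nat) != 1%N.
  by apply: contra r1 => /eqP r1; rewrite -(cyc_val r) r1.
rewrite (_ : _ + _ = 0) ?scale0r // /varpi_coef !natrM.
by case: (r : nat) rn1 => [|[|[|m]]] // _; rewrite /minn /=; ring.
Qed.

Lemma reflection_varpi (s : {lrmorphism K -> K}) i :
  (forall j, s (a j) = a j - a (cyc l 1) *~ cartan (cyc l 1) j) ->
  s (varpi a i) = varpi a i + - a (cyc l 1) * (i == cyc l 1)%:R.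
Proof.
move=> sa; rewrite varpiE linear_sum /=.
under eq_bigr => r _ do rewrite linearZ /= sa scalerBr -scalerMzr.
rewrite sumrB sum_cartan ordS_cyc ord_pred_cyc; congr (_ + _).
rewrite scalerMnl -!scalerBl mulNr; congr (- _); rewrite mulr_natr -[RHS]scaler_nat.
congr (_ *: _); rewrite !val_cyc mod0n !modn_small ?ltnS ?(ltnW l1) //.
have -> : (i == cyc l 1) = (i == 1 :> nat)%N.
  by rewrite -val_eqE /= val_cyc modn_small // ltnS ltnW.
rewrite /varpi_coef !natrM.
by case: (i : nat) => [|[|m]]; rewrite /minn /=; ring.
Qed.

Lemma varpi_diff m : varpi a (cyc l m) - varpi a (cyc l m.+1) =
  \sum_(r < l.+1) (r%:R / l.+1%:R - (m %% l.+1 < r)%:R : R[i]) *: a r.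
Proof.
have N0 : l.+1%:R != 0 :> R[i] by rewrite pnatr_eq0.
rewrite !varpiE -sumrB; apply: eq_bigr => r _; rewrite -scalerBl; congr (_ *: _).
rewrite /varpi_coef !val_cyc modnS; have rl : (r <= l)%N by rewrite -ltnS.
case: ifP => [Nm|_].
  have -> : (m %% l.+1 = l)%N.
    case/dvdnP: Nm => -[|q] // em; have -> : (m = q * l.+1 + l)%N by lia.
    by rewrite modnMDl modn_small.
  rewrite (minn_idPr rl) min0n ltnNge rl mul0n /= !natrM.
  have -> : l%:R = l.+1%:R - 1 :> R[i] by rewrite -natr1 addrK.
  by move: (l.+1%:R : R[i]) N0 => N N0; field.
move: (m %% l.+1)%N => p; rewrite !natrM; case: (ltnP p r) => pr.
  rewrite (minn_idPl pr) -[p.+1%:R]natr1 /=.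
  by move: (l.+1%:R : R[i]) N0 => N N0; field.
have -> : minn p.+1 r = r by apply/minn_idPr; lia.
rewrite -[p.+1%:R]natr1 /=.
by move: (l.+1%:R : R[i]) N0 => N N0; field.
Qed.

(** The successive differences of the weights depend on [m] only through its
    comparison with the index [r] of the roots ([varpi_diff]).  The rotation shifts
    both, so that only the linear term [r / (l + 1)] changes, unless one of them
    passes [0]. *)
Lemma rotation_varpi (p : {lrmorphism K -> K}) m :
  (forall j, p (a j) = a (ordS j)) ->
  (p (varpi a (cyc l m)) - varpi a (cyc l m.+1)) -
  (p (varpi a (cyc l m.+1)) - varpi a (cyc l m.+2)) =
  (l.+1 %| m.+1)%:R * (\sum_j a j) - l.+1%:R^-1 *: \sum_j a j.
Proof.
move=> pa; have N0 : l.+1%:R != 0 :> R[i] by rewrite pnatr_eq0.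
have swap (x y z t : K) : (x - y) - (z - t) = (x - z) - (y - t).
  by rewrite !opprB addrACA [RHS]addrACA [- y - z]addrC.
rewrite swap -rmorphB !varpi_diff.
have pZ c x : p (c *: x) = c *: p x by exact: linearZ.
rewrite rmorph_sum /=; under eq_bigr => r _ do rewrite pZ pa.
rewrite (reindex_inj (can_inj (@ord_predK l.+1))) /=.
under eq_bigr => r _ do rewrite ord_predK.
rewrite -sumrB mulr_sumr scaler_sumr -sumrB; apply: eq_bigr => r _.
rewrite -scalerBl; have -> : (l.+1 %| m.+1)%:R * a r = (l.+1 %| m.+1)%:R *: a r.
  by rewrite mulr_natl scaler_nat.
rewrite -scalerBl; congr (_ *: _).
have rl : (r <= l)%N by rewrite -ltnS.
have -> : ((r + l.+1).-1 %% l.+1 = if r == 0%N :> nat then l else r.-1)%N.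
  case: (r : nat) rl => [|q] ql; first by rewrite add0n modn_small.
  by rewrite addSn /= modnDr modn_small // ltnW.
have lE : l%:R = l.+1%:R - 1 :> R[i] by rewrite -natr1 addrK.
rewrite modnS; case: (boolP (l.+1 %| m.+1)%N) => Nm.
  have -> : (m %% l.+1 = l)%N.
    case/dvdnP: Nm => -[|q] // em; have -> : (m = q * l.+1 + l)%N by lia.
    by rewrite modnMDl modn_small.
  case: (r : nat) rl => [|q] ql /=.
    by rewrite ltnn lE /=; move: (l.+1%:R : R[i]) N0 => N N0; field.
  rewrite ltnNge (ltnW ql) -[q.+1%:R]natr1 /=.
  by move: (l.+1%:R : R[i]) N0 => N N0; field.
case: (r : nat) rl => [|q] ql /=.
  have -> : (m %% l.+1 < l)%N.
    rewrite ltn_neqAle -ltnS ltn_mod andbT; apply: contra Nm => /eqP ml.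
    by rewrite /dvdn -addn1 -modnDml ml addn1 modnn.
  by rewrite lE /=; move: (l.+1%:R : R[i]) N0 => N N0; field.
rewrite ltnS -[q.+1%:R]natr1 /=.
by move: (l.+1%:R : R[i]) N0 => N N0; field.
Qed.

End RootDatum.

(** * Action of a reflection and of the rotation on the Hamiltonian *)

Section MorphismsOfHamiltonians.
Variables (A B : pzRingType) (g : {rmorphism A -> B}).

Lemma rmorph_cubic_ham F h c N :
  g (cubic_ham F h c N) = cubic_ham (g \o F) (g h) (g \o c) N.
Proof.
rewrite /cubic_ham !rmorphD rmorphM !rmorph_word_sum rmorph_sum; congr (_ + _).
by apply: eq_bigr => x _; rewrite rmorphM.
Qed.

Lemma rmorph_quartic_ham F h c N :
  g (quartic_ham F h c N) = quartic_ham (g \o F) (g h) (fun x y => g (c x y)) N.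
Proof.
rewrite /quartic_ham !rmorphD rmorphM !rmorph_word_sum rmorph_sum; congr (_ + _).
apply: eq_bigr => x _; rewrite rmorph_sum; apply: eq_bigr => y _.
by rewrite !rmorphM.
Qed.

Lemma rmorph_alt_sum v s m : g (alt_sum v s m) = alt_sum (g \o v) s m.
Proof. by rewrite rmorph_sum; apply: eq_bigr => j _; rewrite rmorphM rmorph_sign. Qed.

Lemma rmorph_weight1 l v x : g (weight1 l v x) = weight1 l (g \o v) x.
Proof. exact: rmorph_alt_sum. Qed.

Lemma rmorph_weight2 l v x y : g (weight2 l v x y) = weight2 l (g \o v) x y.
Proof. by rewrite rmorphD !rmorph_alt_sum. Qed.

Lemma eq_cubic_ham (F F' : nat -> A) h c N :
  F =1 F' -> cubic_ham F h c N = cubic_ham F' h c N.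
Proof.
move=> e; have eW d p s n : word_sum F d p s n = word_sum F' d p s n.
  by apply: eq_word_sum => m _; exact: e.
by rewrite /cubic_ham !eW; congr (_ + _); apply: eq_bigr => x _; rewrite e.
Qed.

Lemma eq_quartic_ham (F F' : nat -> A) h c N :
  F =1 F' -> quartic_ham F h c N = quartic_ham F' h c N.
Proof.
move=> e; have eW d p s n : word_sum F d p s n = word_sum F' d p s n.
  by apply: eq_word_sum => m _; exact: e.
rewrite /quartic_ham !eW; congr (_ + _); apply: eq_bigr => x _.
by apply: eq_bigr => y _; rewrite !e.
Qed.

End MorphismsOfHamiltonians.

Section HigherRank.
Variables (R : realType) (K : unitAlgType R[i]) (l : nat).
Variables (f a : 'I_l.+1 -> K) (h : K).
Hypothesis l1 : (1 < l)%N.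
Hypothesis hC : forall x, GRing.comm h x.
Hypothesis aC : forall i x, GRing.comm (a i) x.
Hypothesis f_next : forall i, f i * f (ordS i) = f (ordS i) * f i + h.
Hypothesis f_far : forall i j, j != ordS i -> j != ord_pred i -> GRing.comm (f i) (f j).
Hypothesis f_unit : forall i, f i \is a GRing.unit.
Hypothesis f_central : forall z, (forall i, GRing.comm z (f i)) ->
  forall x : K, GRing.comm z x.

Let F m : K := f (cyc l m).
Let v m : K := varpi a (cyc l m).
Let H := H0_ge2 f a h.
Let k := \sum_j a j.
Let central (z : K) := forall x, GRing.comm z x.

Let centralD x y : central x -> central y -> central (x + y).
Proof. by move=> xC yC z; apply/commr_sym/commrD; apply/commr_sym. Qed.

Let centralN x : central x -> central (- x).
Proof. by move=> xC z; apply/commr_sym/commrN/commr_sym. Qed.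

Let centralM x y : central x -> central y -> central (x * y).
Proof. by move=> xC yC z; apply/commr_sym/commrM; apply/commr_sym. Qed.

Let central0 : central 0.
Proof. by move=> z; apply/commr_sym/commr0. Qed.

Let central_sum I r (P : pred I) (G : I -> K) :
  (forall i, P i -> central (G i)) -> central (\sum_(i <- r | P i) G i).
Proof. by move=> GC; elim/big_rec: _ => // i x Pi xC; apply: centralD => //; apply: GC. Qed.

Let centralZ c x : central x -> central (c *: x).
Proof. by move=> xC z; rewrite /GRing.comm -scalerAr -scalerAl xC. Qed.

Let central_morph (g : {lrmorphism K -> K}) x : bijective g -> central x -> central (g x).
Proof. by move=> [g' gK g'K] xC z; rewrite -[z]g'K /GRing.comm -!rmorphM xC. Qed.

Let chi_central S : central (chi a S).
Proof. by move=> x; apply/commr_sym/chi_comm. Qed.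

Let kC : central k.
Proof. by apply: central_sum => i _; apply: aC. Qed.

Let chi1 x : (x <= l)%N -> chi a (~: [set cyc l x]) = weight1 l v x.
Proof. exact: chi_setC1. Qed.

Let chi2 x y : (x < y <= l)%N -> chi a (~: [set cyc l x; cyc l y]) = weight2 l v x y.
Proof. exact: chi_setC2. Qed.

Let v_cycle m : v (m + l.+1) = v m.
Proof. by rewrite /v cycDn. Qed.

Section SimpleReflection.
Variable s : {lrmorphism K -> K}.
Hypothesis s_bij : bijective s.
Let i1 := cyc l 1.
Hypothesis sf : forall j, s (f j) = f j + a i1 / f i1 *~ orient i1 j.
Hypothesis sa : forall j, s (a j) = a j - a i1 *~ cartan i1 j.
Hypothesis sh : s h = h.

Let b := a i1 / f i1.

Let bF1 : b * F 1 = a i1.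
Proof. by rewrite /b divrK // f_unit. Qed.

Let F1b : F 1 * b = a i1.
Proof. by rewrite /b mulrA -[F 1 * _]aC mulrK // f_unit. Qed.

Let orientE m : (m <= l)%N -> orient i1 (cyc l m) =
  if m == 2 then 1 else if m == 0%N then -1 else 0.
Proof.
move=> ml; rewrite /orient /i1 ordS_cyc ord_pred_cyc.
have e p : (p <= 2)%N -> (cyc l m == cyc l p) = (m == p).
  by move=> p2; apply/eqP/eqP => [/cyc_inj|-> //]; apply; lia.
by rewrite !e.
Qed.

Let sF m : (m <= l)%N ->
  s (F m) = F m + b *~ (if m == 2 then 1 else if m == 0%N then -1 else 0).
Proof. by move=> ml; rewrite sf orientE. Qed.

Let sF0 : s (F 0) = F 0 - b. Proof. by rewrite sF //= mulrN1z. Qed.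
Let sF1 : s (F 1) = F 1. Proof. by rewrite sF 1?ltnW //= mulr0z addr0. Qed.
Let sF2 : s (F 2) = F 2 + b. Proof. by rewrite sF //= mulr1z. Qed.
Let sF3 m : (2 < m < l.+1)%N -> s (F m) = F m.
Proof.
by case/andP=> m2 ml; rewrite sF //; case: m m2 {ml} => [|[|[|m]]] //= _; rewrite mulr0z addr0.
Qed.

Let sv m : s (v m) = v m + - a i1 * (cyc l m == cyc l 1)%:R.
Proof. exact: reflection_varpi. Qed.

(** The central term is zero for even [l]; for odd [l] it also contains the change
    of the summands of [H_0] that are central themselves. *)
Lemma reflection_H0 : exists2 z, forall x, GRing.comm z x & s H = H + z.
Proof.
have [n en] : exists n, l = n.+2 by exists l.-2; lia.
have F3 m : (2 < m < n.+3)%N -> (s \o F) m = F m by rewrite -en; apply: sF3.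
have root : (v 0 - v 1) + (v 2 - v 1) = - a i1 by apply: varpi_root.
case: (boolP (odd l)) => [ol | el].
  have [z0 z0C eH] := H0_odd l1 hC aC f_next f_far ol.
  have [w1 w02 w3] := weight2_reflection l1 (aC i1) v_cycle root sv ol.
  pose c x y := chi a (~: [set cyc l x; cyc l y]).
  have z0C' : central z0 by move=> x; apply/commr_sym/z0C.
  exists ((h + c 1%N 2 - c 0%N 1%N) * a i1 + (s z0 - z0)).
    apply: centralD.
      by do ?apply: centralM => //; do ?apply: centralD => //; try apply: centralN;
        apply: chi_central.
    by apply: centralD; [exact: central_morph | exact: centralN].
  have sH : s (quartic_ham F h c l.+1) =
      quartic_ham (s \o F) h (fun x y => s (c x y)) l.+1.
    by rewrite -{2}sh; exact: rmorph_quartic_ham.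
  have c' x y : (x < y <= l)%N -> s (c x y) = weight2 l (s \o v) x y.
    by move=> xy; rewrite /c chi2 //; exact: rmorph_weight2.
  have sHz : s (quartic_ham F h c l.+1 + z0) =
      quartic_ham (s \o F) h (fun x y => s (c x y)) l.+1 + s z0.
    by rewrite -sH; exact: rmorphD.
  rewrite /H eH [LHS]sHz.
  rewrite -(@quartic_ham_reflection _ F (s \o F) (a i1) b h n (aC i1) bF1 F1b sF0 sF1 sF2 F3
    c (fun x y => s (c x y))); first by rewrite -en; ncring.
  - by lia.
  - by move=> x y; rewrite -en ltnS => xy oxy xy1; rewrite c' // /c chi2 // w1.
  - move=> y; rewrite -en ltnS => y2 oy.
    have y0 : (0 < y <= l)%N by lia.
    by rewrite (c' _ _ y0) (c' _ _ y2) /c (chi2 y0) (chi2 y2); apply: w02.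
  move=> x y xy; rewrite -en ltnS => yl oxy.
  have xyl : (x < y <= l)%N by rewrite yl andbT; case/andP: xy.
  by rewrite c' // /c chi2 // w3.
have [w0 w1 w2 w20 w3] := weight1_reflection l1 (aC i1) v_cycle root sv el.
pose c x := chi a (~: [set cyc l x]).
have sH : s (cubic_ham F h c l.+1) = cubic_ham (s \o F) h (s \o c) l.+1.
  by rewrite -{2}sh; exact: rmorph_cubic_ham.
have c' x : (x <= l)%N -> s (c x) = weight1 l (s \o v) x.
  by move=> xl; rewrite /c chi1 //; exact: rmorph_weight1.
exists 0; rewrite // addr0 /H (H0_even _ l1 hC f_next f_far el) sH -[RHS]/(cubic_ham F h c l.+1) en.
apply: (@cubic_ham_reflection _ F (s \o F) (a i1) b h n (aC i1) bF1 F1b sF0 sF1 sF2 F3).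
- by rewrite [LHS]c' // [in RHS]/c chi1.
- by rewrite [LHS]c' ?[in RHS]/c ?chi1 // ltnW.
- by rewrite [LHS]c' // [in RHS]/c chi1.
- by rewrite /c !chi1.
move=> x; rewrite -en ltnS => x2; have /andP[_ xl] := x2.
by rewrite [LHS]c' // [in RHS]/c chi1 // w3.
Qed.
End SimpleReflection.

Lemma commutator_gens x j : commutator (f x) (f j) = - (h *~ orient j x).
Proof.
rewrite /orient; have [->|xS] := eqVneq x (ordS j).
  by rewrite mulr1z /commutator f_next opprD addNKr.
have [->|xP] := eqVneq x (ord_pred j).
  have e := f_next (ord_pred j); rewrite ord_predK in e.
  by rewrite mulrN1z opprK /commutator e addrC addKr.
by rewrite mulr0z oppr0 /commutator f_far ?subrr // -?(can2_eq (@ordSK _) (@ord_predK _))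
  eq_sym // (can2_eq (@ordSK _) (@ord_predK _)).
Qed.

Let sum_commutator_gens (P : pred 'I_l.+1) j :
  \sum_(x | P x) - (h *~ orient j x) = h * ((P (ord_pred j))%:R - (P (ordS j))%:R).
Proof.
by rewrite sumrN sum_orient // opprB mulrBr !mulr_natr; do 2!case: (P _).
Qed.

Lemma commutator_sum (P : pred 'I_l.+1) j :
  commutator (\sum_(x | P x) f x) (f j) =
  h * ((P (ord_pred j))%:R - (P (ordS j))%:R).
Proof.
rewrite /commutator mulr_suml mulr_sumr -sumrB -sum_commutator_gens.
by apply: eq_bigr => x _; exact: commutator_gens.
Qed.

(** For a quadratic form in the [f_i] the commutator with [f_j] is linear; its
    coefficients compare the neighbours of [j] with each other. *)
Lemma commutator_pairs (P : rel 'I_l.+1) j :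
  commutator (\sum_x \sum_(y | P x y) f x * f y) (f j) =
  h * \sum_x ((P x (ord_pred j) + P (ord_pred j) x)%:R
              - (P x (ordS j) + P (ordS j) x)%:R) * f x.
Proof.
have leib x y : commutator (f x * f y) (f j) =
    f x * - (h *~ orient j y) + - (h *~ orient j x) * f y.
  rewrite -!commutator_gens /commutator; move: (f x) (f y) (f j) => X Y Z.
  by rewrite mulrBr mulrBl !mulrA addrA subrK.
have -> : commutator (\sum_x \sum_(y | P x y) f x * f y) (f j) =
    \sum_x \sum_(y | P x y) commutator (f x * f y) (f j).
  rewrite /commutator mulr_suml mulr_sumr -sumrB; apply: eq_bigr => x _.
  by rewrite mulr_suml mulr_sumr -sumrB.
transitivity (\sum_x (\sum_(y | P x y) f x * - (h *~ orient j y) +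
    \sum_(y | P x y) - (h *~ orient j x) * f y)).
  by apply: eq_bigr => x _; rewrite -big_split; apply: eq_bigr => y _; exact: leib.
rewrite big_split /=.
rewrite [X in _ + X](exchange_big_dep xpredT) //= -big_split mulr_sumr.
apply: eq_bigr => x _ /=; rewrite -mulr_suml -mulr_sumr.
rewrite (sum_commutator_gens (P x)) (sum_commutator_gens (fun y => P y x)).
rewrite mulrA -(hC (f x)) -!mulrA -mulrDr; congr (_ * _).
have nC n : f x * n%:R = n%:R * f x by exact: commr_nat.
rewrite mulrBr !nC -mulrBl -mulrDl; congr (_ * _).
by rewrite !natrD opprD addrACA.
Qed.

Let sumF_central : forall x, GRing.comm (\sum_(0 <= m < l.+1) F m) x.
Proof.
apply: f_central => j; rewrite big_mkord.
under eq_bigr => m _ do rewrite /F cyc_val.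
have := commutator_sum xpredT j; rewrite subrr mulr0.
by move/eqP; rewrite subr_eq0 => /eqP.
Qed.

Lemma word_sum2_pairs p s n : (s + n = l.+1)%N -> word_sum F 2 p s n =
  \sum_(x < l.+1)
    \sum_(y < l.+1 | [&& (s <= x)%N, odd x == p, (x < y)%N & odd y != odd x]) f x * f y.
Proof.
move=> sn; rewrite word_sum2 sn big_geq_mkord big_mkcond; apply: eq_bigr => x _.
case: (boolP (_ && _)) => [/andP[-> ->]|sx].
  rewrite big_geq_mkord; apply: eq_big => [y|y _]; first by rewrite andbC.
  by rewrite /F !cyc_val.
by rewrite big1 // => y /and3P[sx' px]; case/negP: sx; rewrite sx' px.
Qed.

Lemma odd_ordS (j : 'I_l.+1) : odd l -> odd (ordS j) = ~~ odd j.
Proof.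
move=> ol; have := ltn_ord j; rewrite ltnS leq_eqVlt => /orP[/eqP jl|jl].
  by rewrite /= jl modnn ol.
by rewrite /= modn_small.
Qed.

Lemma odd_ord_pred (j : 'I_l.+1) : odd l -> odd (ord_pred j) = ~~ odd j.
Proof. by move=> ol; rewrite -{2}(ord_predK j) odd_ordS // negbK. Qed.

Let word_sums2_central : odd l ->
  forall x, GRing.comm (word_sum F 2 false 0 l.+1 + word_sum F 2 true 0 l.+1) x.
Proof.
move=> ol; apply: f_central => j.
pose P (x y : 'I_l.+1) := (x < y)%N && (odd y != odd x).
have -> : word_sum F 2 false 0 l.+1 + word_sum F 2 true 0 l.+1 =
    \sum_x \sum_(y | P x y) f x * f y.
  rewrite !word_sum2_pairs // -big_split; apply: eq_bigr => x _ /=.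
  case: (boolP (odd x)) => ox.
    by rewrite [X in X + _]big_pred0 ?add0r //; apply: eq_bigl => y; rewrite /P ox.
  rewrite [X in _ + X]big_pred0 ?addr0 //.
  by apply: eq_bigl => y; rewrite /P (negbTE ox).
apply/eqP; rewrite -subr_eq0 -/(commutator _ _) commutator_pairs big1 ?mulr0 // => x _.
have e y : (P x y + P y x)%N = (odd y != odd x) :> nat.
  rewrite /P [odd x == _]eq_sym; case: (ltngtP x y) => [||xy]; rewrite ?addn0 //.
  by rewrite xy eqxx.
by rewrite !e odd_ordS // odd_ord_pred // subrr mul0r.
Qed.

Section Rotation.
Variable p : {lrmorphism K -> K}.
Hypothesis p_bij : bijective p.
Hypothesis pf : forall j, p (f j) = f (ordS j).
Hypothesis pa : forall j, p (a j) = a (ordS j).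
Hypothesis ph : p h = h.

Let pF : p \o F =1 (fun m => F m.+1).
Proof. by move=> m; rewrite /= pf ordS_cyc. Qed.

Let delta m := p (v m.-1) - v m.
Let t : K := l.+1%:R^-1 *: k.

Let tC : central t.
Proof. exact: centralZ. Qed.

Let pv m : (p \o v) m = v m.+1 + delta m.+1.
Proof. by rewrite /delta /= addrC subrK. Qed.

Let delta_step m : (0 < m)%N -> delta m - delta m.+1 = (l.+1 %| m)%:R * k - t.
Proof. by case: m => // m _; apply: rotation_varpi. Qed.

Let F_cycle : F l.+1 = F 0. Proof. by rewrite /F -(cycDn l 0). Qed.

Let F_next m : F m * F m.+1 = F m.+1 * F m + h.
Proof. by rewrite /F -ordS_cyc. Qed.

Let F1F0 : F 1 * F 0 = F 0 * F 1 - h.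
Proof. by rewrite F_next addrK. Qed.

Let FlF0 : F l * F 0 = F 0 * F l + h.
Proof. by rewrite -F_cycle F_next. Qed.

Let F0C i : (1 < i < l)%N -> GRing.comm (F 0) (F i).
Proof.
move=> il; apply: f_far; first by rewrite ordS_cyc; apply/eqP => /cyc_inj; lia.
by rewrite -(cycDn l 0) add0n ord_pred_cyc; apply/eqP => /cyc_inj; lia.
Qed.

Let sub_eq_add (x y u w : K) : x - y = u - w -> x = y + u + - w.
Proof. by move=> e; rewrite -addrA -e addrC subrK. Qed.

(** The defect of invariance under the rotation is linear in the [f_i].  Of the
    two parts found in [cubic_ham_rotation], the second is a multiple of the sum
    of all [f_i], which is central because the two neighbours of a letter have
    opposite commutators with it. *)
Lemma rotation_H0_even : ~~ odd l -> exists2 z, forall x, GRing.comm z x &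
  p H = H + k * \sum_(0 <= x < l.+1 | (0 < x)%N && ~~ odd x) F x + z.
Proof.
move=> el; have [m em] : exists m, l = m.+2 by exists l.-2; lia.
have [w1 w2] := weight1_rotation v_cycle pv delta_step el.
pose c x := chi a (~: [set cyc l x]).
have pH : p (cubic_ham F h c l.+1) = cubic_ham (p \o F) h (p \o c) l.+1.
  by rewrite -{2}ph; exact: rmorph_cubic_ham.
have c' x : (x <= l)%N -> p (c x) = weight1 l (p \o v) x.
  by move=> xl; rewrite /c chi1 //; exact: rmorph_weight1.
exists (- (t *+ l./2 * \sum_(0 <= x < l.+1) F x)).
  apply/centralN/centralM => //; rewrite -mulr_natr.
  by apply: centralM => // x; apply/commr_sym/commr_nat.
rewrite /H (H0_even _ l1 hC f_next f_far el) pH (eq_cubic_ham _ _ _ pF).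
rewrite -[X in _ = X + _ + _]/(cubic_ham F h c l.+1).
apply: sub_eq_add.
have em' : ~~ odd m by move: el; rewrite em /= negbK.
have F0C' i : (1 < i < m.+2)%N -> GRing.comm (F 0) (F i) by rewrite -em; apply: F0C.
have F_cycle' : F m.+3 = F 0 by rewrite -em.
have F1m : F m.+2 * F 0 = F 0 * F m.+2 + h by rewrite -em.
have := cubic_ham_rotation (t := t *+ l./2) (k := k) (c := c) (c' := p \o c)
  hC F_cycle' F1F0 F1m F0C' em'.
rewrite -em; apply.
- by move=> x xl; rewrite (c' x (ltnW xl) : (p \o c) x = _) (w1 x xl) /c (chi1 xl).
by rewrite (c' l (leqnn l) : (p \o c) l = _) w2 /c (chi1 (leq0n l)).
Qed.

(** In degree two the sum of all products of letters of opposite parity replaces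
    the sum of all letters as the central element. *)
Lemma rotation_H0_odd : odd l -> exists2 z, forall x, GRing.comm z x &
  p H = H + k * word_sum F 2 false 2 l.-1 + z.
Proof.
move=> ol; have [m em] : exists m, l = m.+2 by exists l.-2; lia.
have [w1 w2] := weight2_rotation v_cycle pv delta_step ol.
have [z0 z0C eH] := H0_odd l1 hC aC f_next f_far ol.
pose c x y := chi a (~: [set cyc l x; cyc l y]).
have pH : p (quartic_ham F h c l.+1) =
    quartic_ham (p \o F) h (fun x y => p (c x y)) l.+1.
  by rewrite -{2}ph; exact: rmorph_quartic_ham.
have pHz : p (quartic_ham F h c l.+1 + z0) =
    quartic_ham (fun m => F m.+1) h (fun x y => p (c x y)) l.+1 + p z0.
  by rewrite -(eq_quartic_ham _ _ _ pF) -pH; exact: rmorphD.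
have c' x y : (x < y <= l)%N -> p (c x y) = weight2 l (p \o v) x y.
  by move=> xy; rewrite /c chi2 //; exact: rmorph_weight2.
have z0C' : central z0 by move=> x; apply/commr_sym/z0C.
pose T := t *+ l.-1./2 * (word_sum F 2 false 0 l.+1 + word_sum F 2 true 0 l.+1).
pose S := \sum_(0 <= x < l | ~~ odd x) p (c x l) * (F x.+1 * F 0 - F 0 * F x.+1).
exists (- T + S + (p z0 - z0)).
  apply: centralD; last by apply: centralD; [exact: central_morph | exact: centralN].
  apply: centralD.
    apply/centralN/centralM.
      by rewrite -mulr_natr; apply: centralM => // x; apply/commr_sym/commr_nat.
    exact: word_sums2_central.
  apply: central_sum => x _; apply: centralM; first exact: (central_morph p_bij (chi_central _)).
  rewrite -/(commutator _ _) commutator_gens; apply: centralN.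
  by move=> y; rewrite /GRing.comm mulrzAl mulrzAr hC.
rewrite /H eH [LHS]pHz.
have om : odd m by move: ol; rewrite em /= negbK.
have F0C' i : (1 < i < m.+2)%N -> GRing.comm (F 0) (F i) by rewrite -em; apply: F0C.
have F_cycle' : F m.+3 = F 0 by rewrite -em.
have F1m : F m.+2 * F 0 = F 0 * F m.+2 + h by rewrite -em.
have em1 : l.-1 = m.+1 by rewrite em.
have := quartic_ham_rotation (t := t *+ l.-1./2) (k := k) (c := c)
  (c' := fun x y => p (c x y)) hC F_cycle' F1F0 F1m F0C' om.
rewrite -em -em1 -/S -/T => e.
have {}e : quartic_ham (fun m => F m.+1) h (fun x y => p (c x y)) l.+1 -
    quartic_ham F h c l.+1 = k * word_sum F 2 false 2 l.-1 - T + S.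
  apply: e => [x y xy oxy | x xl ox].
    have xyl : (x < y <= l)%N by case/andP: xy => -> /ltnW.
    by rewrite (c' _ _ xyl) (w1 _ _ xy oxy) /c (@chi2 x.+1 y.+1).
  have xll : (x < l <= l)%N by rewrite xl leqnn.
  have x0 : (0 < x.+1 <= l)%N by [].
  by rewrite (c' _ _ xll) (w2 _ xl ox) /c (chi2 x0).
rewrite -[X in X + p z0](subrK (quartic_ham F h c l.+1)) e.
have regroup (A : pzRingType) (w c1 c2 q c3 c4 : A) :
    w - c1 + c2 + q + c3 = q + c4 + w + (- c1 + c2 + (c3 - c4)) by ncring.
exact: regroup.
Qed.

End Rotation.
End HigherRank.

(** * The theorem for higher rank *)

Section CommutationThroughBracket.
Variables (R : realType) (K : unitAlgType R[i]) (h H : K) (D : K -> K).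
Hypothesis hC : forall x : K, GRing.comm h x.
Hypothesis h_unit : h \is a GRing.unit.
Hypothesis D_lin : linear D.
Hypothesis D_leib : forall x y, D (x * y) = D x * y + x * D y.

(** The part of [D] that is not the bracket with the Hamiltonian; on generators it
    is elementary. *)
Definition outer x := D x - bracket h H x.

Lemma outer_linear : linear outer.
Proof.
move=> c x y; rewrite /outer D_lin (bracket_linear h H) opprD addrACA.
by rewrite -scalerBr.
Qed.

Lemma outer_leibniz x y : outer (x * y) = outer x * y + x * outer y.
Proof.
by rewrite /outer D_leib (bracket_leibniz _ hC) opprD addrACA mulrBl mulrBr.
Qed.

(** An automorphism carries the bracket with [H] to the bracket with [w H], so the
    defect of [w H = H] must match the defect of commutation with the outer
    part. *)
Lemma commutes_through_bracket (w : {lrmorphism K -> K}) x : w h = h ->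
  h^-1 * commutator (w H - H) (w x) = outer (w x) - w (outer x) ->
  D (w x) = w (D x).
Proof.
move=> wh; have wB : w (bracket h H x) = h^-1 * commutator (w H) (w x).
  by rewrite /bracket rmorphM rmorphV //= wh; congr (_ * _); exact: rmorph_commutator.
have cB (A : pzRingType) (u u' y : A) :
    commutator (u - u') y = commutator u y - commutator u' y.
  by rewrite /commutator; ncring.
have cancel_diff (A : pzRingType) (b b' d d' : A) :
    b - b' = (d - b') - (d' - b) -> d = d'.
  move=> e; apply: subr0_eq; transitivity ((d - b') - (d' - b) - (b - b')).
    by ncring.
  by rewrite e subrr.
rewrite cB mulrBr -wB -/(bracket h H (w x)) /outer.
have -> : w (D x - bracket h H x) = w (D x) - w (bracket h H x) by exact: rmorphB.
exact: cancel_diff.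
Qed.

End CommutationThroughBracket.

Section CyclicSymmetry.
Variable l : nat.
Implicit Types (i j : 'I_l.+1).

Lemma ordS_eq i j : (ordS i == ordS j) = (i == j).
Proof. exact/inj_eq/can_inj/ordSK. Qed.

Lemma orient_ordS i j : orient (ordS i) (ordS j) = orient i j.
Proof. by rewrite /orient ordSK ordS_eq (can2_eq (@ordSK _) (@ord_predK _)). Qed.

Lemma cartan_ordS i j : cartan (ordS i) (ordS j) = cartan i j.
Proof. by rewrite /cartan ordSK !ordS_eq (can2_eq (@ordSK _) (@ord_predK _)). Qed.

Lemma val_ordS i : ordS i = (if i == l :> nat then 0 else i.+1)%N :> nat.
Proof.
rewrite /=; case: eqP => [->|il]; first by rewrite modnn.
by rewrite modn_small // ltnS ltn_neqAle -ltnS ltn_ord andbT; apply/eqP.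
Qed.

Lemma val_ord_pred i : ord_pred i = (if i == 0%N :> nat then l else i.-1)%N :> nat.
Proof.
rewrite /=; case: (i : nat) (ltn_ord i) => [|m] ml; first by rewrite add0n modn_small.
by rewrite addSn /= modnDr modn_small // ltnW.
Qed.

Lemma ord0_eq i : (i == ord0) = (i == 0%N :> nat).
Proof. by rewrite -val_eqE. Qed.

(** Taking the commutator of [f_(i+1)] with the sum of the [f_x], [x > 0] even,
    compares the neighbours [i] and [i + 2]; the result is nonzero only next to the
    cut, where it is the difference of [delta_(i+1,0)] and [delta_(i,0)]. *)
Lemma even_boundary i : (1 < l)%N -> ~~ odd l ->
  (((0 < i) && ~~ odd i) + (i == ord0) =
   (ordS i == ord0) + ((0 < ordS (ordS i)) && ~~ odd (ordS (ordS i))))%N.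
Proof.
move=> l1 el; have il := ltn_ord i; rewrite !ord0_eq !val_ordS.
move: (i : nat) il => m ml; case: (m =P l) => [->|ne].
  have -> : (0%N == l) = false by apply/eqP; lia.
  lia.
by case: (m.+1 =P l) => [e|ne']; lia.
Qed.

(** The support of the quadratic form that appears in [rotation_H0_odd]. *)
Definition even_odd_pair i j : bool :=
  [&& (2 <= i)%N, odd i == false, (i < j)%N & odd j != odd i].

(** The coefficients in [commutator_pairs] for this form.  Both neighbours of [i]
    have the same parity; they pair with the same [x], except that [x] may lie
    between them, that is [x = i], and except next to the cut. *)
Lemma even_odd_pair_boundary i x : (1 < l)%N -> odd l ->
  (even_odd_pair x (ord_pred i) + even_odd_pair (ord_pred i) x
     + (~~ odd i && (x == i)) + ((i == ordS ord0) && odd x) =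
   even_odd_pair x (ordS i) + even_odd_pair (ordS i) x
     + (odd i && (x == i)) + ((i == ord0) && ~~ odd x))%N.
Proof.
move=> l1 ol; have il := ltn_ord i; have xl := ltn_ord x.
rewrite /even_odd_pair ord0_eq -[x == i]val_eqE -[i == ordS _]val_eqE.
rewrite -[val i]/(i : nat) -[val (ordS ord0)]/(ordS ord0 : nat) !val_ordS val_ord_pred /=.
have -> : (0%N == l) = false by apply/eqP => l0; rewrite -l0 in ol.
move: (i : nat) (x : nat) il xl => m y ml yl.
case: (m =P 0%N) => [->|m0].
  have -> : (0%N == l) = false by apply/eqP; lia.
  rewrite ol /= !andbF; case: (boolP (odd y)) => oy /=; first by case: (y) oy => [|[]].
  have ly : y != l by apply: contraNneq oy => ->.
  by case: y oy ly yl => [|[|y']] //; lia.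
have [m' em] : exists m', m = m'.+1 by exists m.-1; lia.
subst m; rewrite eqSS [m'.+1.-1]/=.
case: (m'.+1 =P l) => [e|ml'].
  have om : odd m' = false by lia.
  rewrite /= om /=.
  case: (boolP (odd y)) => oy /=; rewrite ?andbF ?andbT /=; lia.
rewrite /= negbK; case: (boolP (odd m')) => om; case: (boolP (odd y)) => oy;
  rewrite /= ?andbF ?andbT /=; lia.
Qed.

End CyclicSymmetry.

Section HigherRankTheorem.
Variables (R : realType) (n : nat).
Let l := n.+2.
Variables (K : unitAlgType R[i]) (ev : {lrmorphism free_alg R[i] l -> K}).
Hypothesis hK : is_quotient_skew_field ev.
Let f (i : 'I_l.+1) : K := ev (free_gen R[i] (@genf l i)).
Let a (i : 'I_l.+1) : K := ev (free_gen R[i] (gena i)).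
Let h : K := ev (free_gen R[i] (genh l)).

Let gens_ind (P : K -> Prop) : (forall i, P (f i)) -> (forall i, P (a i)) -> P h ->
  forall g, P (ev (free_gen R[i] g)).
Proof. by move=> Pf Pa Ph [[i|i]|[]]; [exact: Pf | exact: Pa | exact: Ph]. Qed.

Let comm_of_relator x y :
  relator (fun i => free_gen R[i] (genf i)) (fun i => free_gen R[i] (gena i))
    (free_gen R[i] (genh l)) (commutator x y) -> GRing.comm (ev x) (ev y).
Proof.
move=> /(gen_relation hK); rewrite rmorph_commutator => /eqP.
by rewrite subr_eq0 => /eqP.
Qed.

Let hC : forall x, GRing.comm h x.
Proof.
apply: (central_of_gens hK); apply: gens_ind => [i|i|]; last exact: erefl.
  by apply: comm_of_relator; exact: (relator_ge2_hf (fun i => free_gen R[i] (@genf l i))).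
apply/commr_sym/comm_of_relator.
exact: (relator_ge2_ah (fun i => free_gen R[i] (@genf l i)) (fun i => free_gen R[i] (gena i))).
Qed.

Let aC : forall i x, GRing.comm (a i) x.
Proof.
move=> i; apply: (central_of_gens hK); apply: gens_ind => [j|j|].
- apply: comm_of_relator.
  exact: (relator_ge2_af (fun i => free_gen R[i] (@genf l i)) (fun i => free_gen R[i] (gena i))).
- apply: comm_of_relator.
  exact: (relator_ge2_aa (fun i => free_gen R[i] (@genf l i)) (fun i => free_gen R[i] (gena i))).
exact/commr_sym/hC.
Qed.

Let f_next i : f i * f (ordS i) = f (ordS i) * f i + h.
Proof.
have /(gen_relation hK) := relator_ge2_next (fun i => free_gen R[i] (@genf l i))
  (fun i => free_gen R[i] (gena i)) (free_gen R[i] (genh l)) i.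
rewrite rmorph_commutatorB => /eqP.
by rewrite subr_eq0 subr_eq addrC => /eqP.
Qed.

Let f_far i j : j != ordS i -> j != ord_pred i -> GRing.comm (f i) (f j).
Proof.
move=> ij ji; apply: comm_of_relator.
exact: (relator_ge2_far (fun i => free_gen R[i] (@genf l i)) (fun i => free_gen R[i] (gena i))
  _ ij ji).
Qed.

Let h_unit : h \is a GRing.unit.
Proof. exact: (ev_genh_unit hK). Qed.

Let f_unit i : f i \is a GRing.unit.
Proof.
apply: (qsf_unit hK); apply/eqP => fi0; have := f_next i.
rewrite fi0 mul0r mulr0 add0r => h0.
by move: h_unit; rewrite -h0 unitr0.
Qed.

Let f_central z : (forall i, GRing.comm z (f i)) -> forall x : K, GRing.comm z x.
Proof.
move=> zf; apply: (central_of_gens hK); apply: gens_ind => [//|i|].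
  exact/commr_sym/aC.
exact/commr_sym/hC.
Qed.

Variable D : K -> K.
Hypothesis D_lin : linear D.
Hypothesis D_leib : forall x y, D (x * y) = D x * y + x * D y.
Let H := H0_ge2 f a h.
Hypothesis Da : forall i, D (a i) = bracket h H (a i).
Hypothesis Dh : D h = bracket h H h.
Hypothesis Df : deriv_f_ge2 f a h D.

Let k := \sum_j a j.
Let x0 := \sum_(j < l.+1 | ~~ odd j) f j.
Let D' := outer h H D.
Let kappa := Defs.half R *: k.

Let D'_lin : linear D' := outer_linear h H D_lin.
Let D'_leib x y : D' (x * y) = D' x * y + x * D' y := outer_leibniz H hC D_leib x y.

Let D'a i : D' (a i) = 0.
Proof. by rewrite /D' /outer Da subrr. Qed.

Let D'h : D' h = 0.
Proof. by rewrite /D' /outer Dh subrr. Qed.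

Let D'f i : D' (f i) = if ~~ odd l then (i == ord0)%:R * k
  else - (-1) ^+ i * kappa * f i + (i == ord0)%:R * (k * x0).
Proof.
rewrite /D' /outer Df -/H -/k -/x0 -/kappa; case: (odd l); rewrite addrC.
  by rewrite -[_ - _ + _]addrA addKr !mulNr.
by rewrite addKr.
Qed.

Let kC x : GRing.comm k x.
Proof. by rewrite /GRing.comm mulr_suml mulr_sumr; apply: eq_bigr => j _; apply: aC. Qed.

Let kappaC x : GRing.comm kappa x.
Proof. by rewrite /GRing.comm -scalerAr -scalerAl kC. Qed.

Let kappa2 : kappa + kappa = k.
Proof.
rewrite -scalerDl (_ : Defs.half R + Defs.half R = 1) ?scale1r //.
by rewrite -mulr2n -mulr_natl divff // pnatr_eq0.
Qed.

Let D'Mz x (m : int) : D' (x *~ m) = D' x *~ m.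
Proof. by rewrite -[x *~ m]scaler_int -[RHS]scaler_int (derivZ D'_lin). Qed.

Section SimpleReflectionCommutes.
Variable s : {lrmorphism K -> K}.
Hypothesis s_bij : bijective s.
Let i1 := cyc l 1.
Hypothesis sf : forall j, s (f j) = f j + a i1 / f i1 *~ orient i1 j.
Hypothesis sa : forall j, s (a j) = a j - a i1 *~ cartan i1 j.
Hypothesis sh : s h = h.
Let b := a i1 / f i1.

Let s_k : s k = k.
Proof.
rewrite rmorph_sum /=; under eq_bigr => j _ do rewrite sa.
rewrite sumrB (sum_cartan (isT : (1 < l)%N) (fun=> a i1)) mulr2n -addrA -opprD subrr.
by rewrite subr0.
Qed.

Let s_kappa : s kappa = kappa.
Proof. by transitivity (Defs.half R *: s k); [exact: linearZ | rewrite s_k]. Qed.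

Let i1_neq0 : (i1 == ord0) = false.
Proof. by rewrite -val_eqE /= val_cyc. Qed.

Let D'b : D' b = if ~~ odd l then 0 else - (kappa * b).
Proof.
rewrite /b D'_leib D'a mul0r add0r (derivV D'_leib) // D'f i1_neq0 mul0r.
case: (odd l) => /=; last by rewrite mulr0 mul0r oppr0 mulr0.
rewrite mul0r addr0 val_cyc /= expr1 opprK mul1r mulrN; congr (- _).
rewrite [(f i1)^-1 * _]mulrA mulrK // -(kappaC (f i1)^-1).
by rewrite mulrA -(kappaC (a i1)) mulrA.
Qed.

Let orient_even j : odd l -> orient i1 j != 0 -> ~~ odd j.
Proof.
move=> ol; rewrite /orient; case: (j =P ordS i1) => [-> _|_].
  by rewrite odd_ordS // val_cyc.
by case: (j =P ord_pred i1) => [-> _|_]; rewrite ?eqxx // odd_ord_pred // val_cyc.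
Qed.

Let s_x0 : odd l -> s x0 = x0.
Proof.
move=> ol; rewrite rmorph_sum /=; under eq_bigr => j _ do rewrite sf.
rewrite big_split /= (sum_orient (isT : (1 < l)%N) (fun=> b) i1 (fun j => ~~ odd j)).
have e1 : odd (ordS i1) = false by rewrite odd_ordS // val_cyc.
have e2 : odd (ord_pred i1) = false by rewrite odd_ord_pred // val_cyc.
by rewrite e1 e2 subrr addr0.
Qed.

(** The Hamiltonian is invariant up to a central element, and the outer part
    commutes with [s_1]: among the [f_j] only [f_0] and [f_2] move, both of even
    index and in such a way that [x_0] is fixed, and for odd [l] the outer part
    multiplies [a_1 / f_1] by the central element opposite to the one of [f_1],
    which is the one of the even [f_j]. *)
Lemma reflection_commutes x : D (s x) = s (D x).
Proof.
have [z zC eH] := reflection_H0 (isT : (1 < l)%N) hC aC f_next f_far f_unit s_bij sf sa sh.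
have wH g : D' (s (ev (free_gen R[i] g))) = s (D' (ev (free_gen R[i] g))) ->
    D (s (ev (free_gen R[i] g))) = s (D (ev (free_gen R[i] g))).
  move=> e; apply: (commutes_through_bracket (H := H) h_unit sh).
  have -> : s H - H = z by rewrite [s H]eH addrC addKr.
  by rewrite /commutator zC subrr mulr0 -/D' e subrr.
apply: (commutes_of_gens hK D_lin D_leib) => g; apply: wH; move: g.
apply: (gens_ind (P := fun y => D' (s y) = s (D' y))) => [j|j|].
- rewrite sf (derivD D'_lin) D'Mz D'b !D'f.
  have sD y y' : s (y + y') = s y + s y' by exact: rmorphD.
  have sM y y' : s (y * y') = s y * s y' by exact: rmorphM.
  have sn (m : nat) : s m%:R = m%:R by exact: rmorph_nat.
  case: (boolP (odd l)) => ol; rewrite [~~ _]/=; last first.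
    by rewrite mul0rz addr0 sM s_k sn.
  have ssign : s (- (-1) ^+ j) = - (-1) ^+ j by rewrite rmorphN rmorph_sign.
  rewrite sD !sM ssign s_kappa s_k (s_x0 ol) sf sn addrAC; congr (_ + _).
  rewrite mulrDr; congr (_ + _).
  have [->|o0] := eqVneq (orient i1 j) 0; first by rewrite !mulr0z mulr0.
  by rewrite -signr_odd (negbTE (orient_even ol o0)) expr0 mulN1r mulNr mulrzAr mulNrz.
- rewrite sa (derivB D'_lin) D'Mz !D'a mul0rz subrr.
  by rewrite rmorph0.
by rewrite sh !D'h rmorph0.
Qed.

End SimpleReflectionCommutes.

Section RotationCommutes.
Variable p : {lrmorphism K -> K}.
Hypothesis p_bij : bijective p.
Hypothesis pf : forall j, p (f j) = f (ordS j).
Hypothesis pa : forall j, p (a j) = a (ordS j).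
Hypothesis ph : p h = h.

Let p_k : p k = k.
Proof.
rewrite rmorph_sum /=; under eq_bigr => j _ do rewrite pa.
by rewrite [RHS](reindex_inj (can_inj (@ordSK l.+1))).
Qed.

Let p_kappa : p kappa = kappa.
Proof. by transitivity (Defs.half R *: p k); [exact: linearZ | rewrite p_k]. Qed.

Let p_x0 : odd l -> p x0 = \sum_(j < l.+1 | odd j) f j.
Proof.
move=> ol; rewrite rmorph_sum /=; under eq_bigr => j _ do rewrite pf.
rewrite [RHS](reindex_inj (can_inj (@ordSK l.+1))) /=.
by apply: eq_bigl => j; rewrite odd_ordS.
Qed.

Let bracket_of_shift S z j (S' : K) : (forall x, GRing.comm z x) ->
  commutator S (f j) = h * S' ->
  h^-1 * commutator (k * S + z) (f j) = k * S'.
Proof.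
move=> zC eS; have -> : commutator (k * S + z) (f j) = k * commutator S (f j).
  rewrite /commutator mulrDl mulrDr zC opprD addrACA subrr addr0 mulrBr.
  by rewrite !mulrA (kC (f j)).
by rewrite eS [k * _]mulrA -(hC k) -mulrA mulKr.
Qed.

Lemma rotation_commutes_of_f :
  (forall j, h^-1 * commutator (p H - H) (f (ordS j)) = D' (f (ordS j)) - p (D' (f j))) ->
  forall x, D (p x) = p (D x).
Proof.
move=> ef; apply: (commutes_of_gens hK D_lin D_leib).
apply: (gens_ind (P := fun y => D (p y) = p (D y))) => [j|j|];
  apply: (commutes_through_bracket (H := H) h_unit ph); rewrite -/D'.
- by rewrite pf ef.
- by rewrite pa !D'a rmorph0 subrr /commutator -(aC (ordS j)) subrr mulr0.
by rewrite ph D'h rmorph0 subrr /commutator -hC subrr mulr0.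
Qed.

(** The form in [rotation_H0_even] is linear, so its brackets with the [f_j] are
    constants; [even_boundary] matches them with the change of the term
    [delta_(i,0) k] of the outer part under the rotation. *)
Lemma rotation_commutes_even : ~~ odd l -> forall x, D (p x) = p (D x).
Proof.
move=> el; apply: rotation_commutes_of_f => j.
have [z zC eH] := rotation_H0_even (isT : (1 < l)%N) hC aC f_next f_far f_central pf pa ph el.
have -> : p H - H =
    k * \sum_(0 <= x < l.+1 | (0 < x)%N && ~~ odd x) f (cyc l x) + z.
  by apply/eqP; rewrite [p H]eH subr_eq [eqbRHS]addrC addrA.
pose P (x : 'I_l.+1) := (0 < x)%N && ~~ odd x.
rewrite big_mkord (eq_bigr f) => [|x _]; last by rewrite cyc_val.
have := commutator_sum (isT : (1 < l)%N) f_next f_far P (ordS j).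
move/(bracket_of_shift zC) => ->; rewrite !D'f el.
have pM y y' : p (y * y') = p y * p y' by exact: rmorphM.
have pn (m : nat) : p m%:R = m%:R by exact: rmorph_nat.
rewrite pM p_k pn -mulrBl kC ordSK; congr (_ * _).
apply/eqP; rewrite subr_eq addrAC eq_sym subr_eq -!natrD; apply/eqP; congr _%:R.
exact: esym (even_boundary j isT el).
Qed.

(** The outer part multiplies [f_i] by a central element whose sign depends on
    the parity of [i], and the rotation reverses this sign; moreover it turns
    [x_0], the sum of the [f_j] of even index, into the sum of the others.  The
    commutator with the quadratic form of [rotation_H0_odd] accounts for both. *)
Lemma rotation_commutes_odd : odd l -> forall x, D (p x) = p (D x).
Proof.
move=> ol; apply: rotation_commutes_of_f => j.
have [z zC eH] := rotation_H0_odd (isT : (1 < l)%N) hC aC f_next f_far f_central p_bij pf pa ph ol.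
have -> : p H - H = k * word_sum (fun m => f (cyc l m)) 2 false 2 l.-1 + z.
  by apply/eqP; rewrite [p H]eH subr_eq [eqbRHS]addrC addrA.
have -> : word_sum (fun m => f (cyc l m)) 2 false 2 l.-1 =
    \sum_x \sum_(y | even_odd_pair x y) f x * f y.
  exact: word_sum2_pairs.
have := commutator_pairs (isT : (1 < l)%N) hC f_next f_far (@even_odd_pair l) (ordS j).
move/(bracket_of_shift zC) => ->; rewrite !D'f ol [~~ _]/=.
have pD y y' : p (y + y') = p y + p y' by exact: rmorphD.
have pM y y' : p (y * y') = p y * p y' by exact: rmorphM.
have pn (m : nat) : p m%:R = m%:R by exact: rmorph_nat.
have psign : p (- (-1) ^+ j) = - (-1) ^+ j by rewrite rmorphN rmorph_sign.
rewrite pD !pM psign pn p_kappa p_k (p_x0 ol) pf.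
have -> : (-1) ^+ ordS j = - (-1) ^+ j :> K.
  by rewrite -signr_odd odd_ordS // signrN signr_odd.
set i := ordS j; set sg : K := (-1) ^+ j; set x1 := \sum_(_ < _ | _) f _.
have coefE x : (even_odd_pair x (ord_pred i) + even_odd_pair (ord_pred i) x)%:R
    - (even_odd_pair x (ordS i) + even_odd_pair (ordS i) x)%:R =
    sg * (x == i)%:R + (i == ord0)%:R * (~~ odd x)%:R - (j == ord0)%:R * (odd x)%:R :> K.
  have /(congr1 (fun m => m%:R : K)) := even_odd_pair_boundary i x isT ol.
  rewrite !natrD => e; have [ei sgE] : (i == ordS ord0) = (j == ord0) /\
      (odd i && (x == i))%:R - (~~ odd i && (x == i))%:R = sg * (x == i)%:R :> K.
    rewrite /i ordS_eq odd_ordS // negbK /sg -signr_odd; split=> //.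
    by case: (odd j); rewrite ?expr1 ?expr0 ?sub0r ?subr0 ?mulN1r ?mul1r.
  have exchange (A : pzRingType) (a1 a2 b1 b2 u u' c c' : A) :
      a1 + a2 + u + c = b1 + b2 + u' + c' -> a1 + a2 - (b1 + b2) = u' - u + c' - c.
    move=> e12; apply: subr0_eq.
    transitivity (a1 + a2 + u + c - (b1 + b2 + u' + c')); first by ncring.
    by rewrite e12 subrr.
  by rewrite (exchange _ _ _ _ _ _ _ _ _ e) sgE ei -!mulnb !natrM.
rewrite (eq_bigr (fun x => sg * ((x == i)%:R * f x) +
    (i == ord0)%:R * ((~~ odd x)%:R * f x) - (j == ord0)%:R * ((odd x)%:R * f x))).
  have sum_bool (Q : pred 'I_l.+1) : \sum_(x < l.+1) (Q x)%:R * f x = \sum_(x | Q x) f x.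
    by rewrite [RHS]big_mkcond; apply: eq_bigr => x _; case: (Q x); rewrite ?mul1r ?mul0r.
  rewrite sumrB big_split /= -!mulr_sumr (sum_bool (pred1 i)) big_pred1_eq.
  rewrite (sum_bool (fun x : 'I_l.+1 => ~~ odd x)) (sum_bool (fun x : 'I_l.+1 => odd x)).
  have regroup (A : pzRingType) (q c1 c2 c3 y y0 y1 : A) :
      (q + q) * c1 = c1 * (q + q) -> (q + q) * c2 = c2 * (q + q) ->
      (q + q) * c3 = c3 * (q + q) -> (q + q) * (c1 * y + c2 * y0 - c3 * y1) =
      - - c1 * q * y + c2 * ((q + q) * y0) - (- c1 * q * y + c3 * ((q + q) * y1)).
    move=> e1 e2 e3; transitivity ((q + q) * c1 * y + (q + q) * c2 * y0 - (q + q) * c3 * y1).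
      by ncring.
    by rewrite e1 e2 e3; ncring.
  by rewrite -kappa2; apply: regroup; rewrite kappa2 kC.
by move=> x _; rewrite coefE mulrBl mulrDl !mulrA.
Qed.

End RotationCommutes.

(** Since [s_(i+1) pi = pi s_i], the reflection [s_1] and the rotation suffice. *)
Lemma higher_rank_commutes (s : 'I_l.+1 -> {lrmorphism K -> K}) (p : {lrmorphism K -> K})
    (w : K -> K) :
  (forall i, bijective (s i)) -> bijective p ->
  weyl_action_ge2 f a h (fun i => s i) p ->
  extended_affine_weyl_group (fun i => s i) p w -> forall x, D (w x) = w (D x).
Proof.
move=> s_bij p_bij [sf sa pf pa sh ph].
have Dp x : D (p x) = p (D x).
  case: (boolP (odd l)) => [ol | el].
    exact: (rotation_commutes_odd p_bij pf pa ph ol).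
  exact: (rotation_commutes_even pf pa ph el).
have sp i x : s (ordS i) (p x) = p (s i x).
  apply: (intertwine_of_gens hK); apply: (gens_ind
    (P := fun y => s (ordS i) (p y) = p (s i y))) => [j|j|].
  - rewrite pf !sf orient_ordS rmorphD rmorphMz rmorphM rmorphV ?f_unit //=.
    by rewrite pf pa pf.
  - by rewrite pa !sa cartan_ordS rmorphB rmorphMz /= !pa.
  by rewrite ph !sh ph.
have Ds1 x : D (s (cyc l 1) x) = s (cyc l 1) (D x).
  exact: (reflection_commutes (s_bij _) (sf _) (sa _) (sh _)).
have Ds := @commutes_reflections K l D (fun i => s i) p p_bij sp Dp (cyc l 1) Ds1.
exact: (@commutes_weyl_group K l D (fun i => s i) p Dp w Ds).
Qed.

End HigherRankTheorem.

(** * The theorem in rank one *)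

Lemma ord2_ind (P : 'I_2 -> Prop) : P 0 -> P 1 -> forall i, P i.
Proof.
move=> P0 P1 [[|[|m]] im] //.
  by have -> : Ordinal im = 0 by apply: val_inj.
by have -> : Ordinal im = 1 by apply: val_inj.
Qed.

Lemma ord3_ind (P : 'I_3 -> Prop) : P 0 -> P 1 -> P 2 -> forall i, P i.
Proof.
move=> P0 P1 P2 [[|[|[|m]]] im] //.
- by have -> : Ordinal im = 0 by apply: val_inj.
- by have -> : Ordinal im = 1 by apply: val_inj.
by have -> : Ordinal im = 2 by apply: val_inj.
Qed.

(** The effect of [s_1] on [f_0 f_1 + f_1 f_0], with [b = a / f_1] and
    [c = b ^ 2].  The commutator of [f_2] with [f_1] is central, so its
    contributions on the two sides of [b] cancel. *)
Lemma rank_one_reflection_identity (A : pzRingType) (f0 f1 f2 a b c h : A) :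
  (forall x, GRing.comm a x) -> (forall x, GRing.comm h x) ->
  b * f1 = a -> f1 * b = a -> c * f1 = a * b -> f1 * c = a * b ->
  f2 * f1 = f1 * f2 + h ->
  (f0 + f2 * b + b * f2 - c) * f1 + f1 * (f0 + f2 * b + b * f2 - c) =
  f0 * f1 + f1 * f0 + (a * f2 - a * b + (a * f2 - a * b)) + (a * f2 + a * f2).
Proof.
move=> aC hC bf fb cf fc e.
apply: subr0_eq; transitivity (f2 * (b * f1 - a) + (f2 * a - a * f2)
  + b * (f2 * f1 - (f1 * f2 + h)) + (b * f1 - a) * f2
  - (c * f1 - a * b) - (f1 * c - a * b)
  - (f2 * f1 - (f1 * f2 + h)) * b + f2 * (f1 * b - a) + (f2 * a - a * f2)
  + (f1 * b - a) * f2 - (h * b - b * h)); first by ncring.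
by rewrite bf fb cf fc e (aC f2) (hC b) !subrr !(mulr0, mul0r, addr0, subr0).
Qed.

Section RankOneHamiltonian.
Variables (R : realType) (K : unitAlgType R[i]).
Implicit Types (f : 'I_3 -> K) (a : 'I_2 -> K) (w : {lrmorphism K -> K}).

Lemma rmorph_H0_one w f a : w (H0_one f a) = H0_one (w \o f) (w \o a).
Proof.
have wZ c y : w (c *: y) = c *: w y by exact: linearZ.
have wD x y : w (x + y) = w x + w y by exact: rmorphD.
have wM x y : w (x * y) = w x * w y by exact: rmorphM.
by rewrite /H0_one wD wZ wD !wM.
Qed.

Lemma half_double (x : K) : Defs.half R *: (x + x) = x.
Proof.
rewrite scalerDr -scalerDl (_ : Defs.half R + Defs.half R = 1) ?scale1r //.
by rewrite -mulr2n -mulr_natl divff // pnatr_eq0.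
Qed.

Lemma reflection_H0_one f a h b w : (forall x : K, GRing.comm (a 1) x) ->
  (forall x : K, GRing.comm h x) -> commutator (f 2) (f 1) = h ->
  b * f 1 = a 1 -> f 1 * b = a 1 ->
  w (f 0) = f 0 + f 2 * b + b * f 2 - b * b -> w (f 1) = f 1 ->
  w (f 2) = f 2 - b -> w (a 1) = - a 1 -> w (H0_one f a) = H0_one f a.
Proof.
move=> aC hC com21 bf fb wf0 wf1 wf2 wa1.
have e : f 2 * f 1 = f 1 * f 2 + h by rewrite -com21 addrC subrK.
have cf : b * b * f 1 = a 1 * b by rewrite -mulrA bf aC.
have fc : f 1 * (b * b) = a 1 * b by rewrite mulrA fb.
rewrite rmorph_H0_one /H0_one /= wf0 wf1 wf2 wa1.
rewrite (rank_one_reflection_identity (f 0) aC hC bf fb cf fc e) 2!scalerDr !half_double.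
have fin (A : pzRingType) (x u v t : A) :
    x + (t * u - t * v) + t * u + - t * (u - v) = x + t * u by ncring.
exact: fin.
Qed.

(** With [k = a_0 + a_1], the rotation changes the Hamiltonian by [- k f_2], whose
    brackets with [f_0] and [f_1] are [k] and [- k]. *)
Lemma rotation_H0_one f a w : w (f 0) = f 1 -> w (f 1) = f 0 -> w (f 2) = - f 2 ->
  w (a 1) = a 0 -> w (H0_one f a) - H0_one f a = - ((a 0 + a 1) * f 2).
Proof.
move=> wf0 wf1 wf2 wa1; rewrite rmorph_H0_one /H0_one /= wf0 wf1 wf2 wa1 [f 1 * f 0 + _]addrC.
have fin (A : pzRingType) (x t0 t1 u : A) :
    x + t0 * - u - (x + t1 * u) = - ((t0 + t1) * u) by ncring.
exact: fin.
Qed.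

Lemma rotation_reflection_one f a h (s : 'I_2 -> {lrmorphism K -> K}) (p : {lrmorphism K -> K}) :
  weyl_action_one f a h (fun i => s i) p ->
  f 0 \is a GRing.unit -> f 1 \is a GRing.unit ->
  (forall i j, s (ordS i) (p (f j)) = p (s i (f j))) /\
  (forall i j, s (ordS i) (p (a j)) = p (s i (a j))).
Proof.
move=> [s0f0 s0f1 s0f2 s1f0 s1f1 s1f2 s0a0 s0a1 s1a0 s1a1 pf0 pf1 pf2 pa0 pa1 _ _] u0 u1.
have [S0 S1] : ordS (0 : 'I_2) = 1 /\ ordS (1 : 'I_2) = 0 by split; apply: val_inj.
have pD y y' : p (y + y') = p y + p y' by exact: rmorphD.
have pN y : p (- y) = - p y by exact: rmorphN.
have pM y y' : p (y * y') = p y * p y' by exact: rmorphM.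
have pn : p 2 = 2 by exact: rmorph_nat.
have sN t y : s t (- y) = - s t y by exact: rmorphN.
have pX y : p (y ^+ 2) = p y ^+ 2 by exact: rmorphXn.
have pV y : y \is a GRing.unit -> p y^-1 = (p y)^-1 by exact: rmorphV.
have pb0 : p (a 0 / f 0) = a 1 / f 1 by rewrite pM pV // pa0 pf0.
have pb1 : p (a 1 / f 1) = a 0 / f 0 by rewrite pM pV // pa1 pf1.
have pc0 : p (a 0 ^+ 2 / f 0 ^+ 2) = a 1 ^+ 2 / f 1 ^+ 2.
  by rewrite pM pV ?unitrX // !pX pa0 pf0.
have pc1 : p (a 1 ^+ 2 / f 1 ^+ 2) = a 0 ^+ 2 / f 0 ^+ 2.
  by rewrite pM pV ?unitrX // !pX pa1 pf1.
split; apply: ord2_ind; rewrite ?S0 ?S1.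
- apply: ord3_ind.
  + by rewrite pf0 s1f1 s0f0 pf0.
  + rewrite pf1 s1f0 s0f1 !(pD, pN) pc0 (pM (f 2)) (pM _ (f 2)) pb0 pf1 pf2.
    by rewrite mulNr mulrN !opprK.
  by rewrite pf2 sN s1f2 s0f2 pD pf2 pb0 opprB addrC.
- apply: ord3_ind.
  + rewrite pf0 s0f1 s1f0 !(pD, pN) pc1 (pM (f 2)) (pM _ (f 2)) pb1 pf0 pf2.
    by rewrite mulNr mulrN.
  + by rewrite pf1 s0f0 s1f1 pf1.
  by rewrite pf2 sN s0f2 s1f2 pD pN pf2 pb1 opprD.
- apply: ord2_ind; first by rewrite pa0 s1a1 s0a0 pN pa0.
  by rewrite pa1 s1a0 s0a1 pD pM pn pa1 pa0.
apply: ord2_ind; first by rewrite pa0 s0a1 s1a0 pD pM pn pa0 pa1.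
by rewrite pa1 s0a0 s1a1 pN pa1.
Qed.

End RankOneHamiltonian.

Section RankOneTheorem.
Variable R : realType.
Variables (K : unitAlgType R[i]) (ev : {lrmorphism free_alg R[i] 1 -> K}).
Hypothesis hK : is_quotient_skew_field ev.
Let f (i : 'I_3) : K := ev (free_gen R[i] (@genf 1 i)).
Let a (i : 'I_2) : K := ev (free_gen R[i] (@gena 1 i)).
Let h : K := ev (free_gen R[i] (genh 1)).

Let gens_ind (P : K -> Prop) : (forall i, P (f i)) -> (forall i, P (a i)) -> P h ->
  forall g, P (ev (free_gen R[i] g)).
Proof. by move=> Pf Pa Ph [[i|i]|[]]; [exact: Pf | exact: Pa | exact: Ph]. Qed.

Let ff := fun i : 'I_3 => free_gen R[i] (@genf 1 i).
Let fa := fun i : 'I_2 => free_gen R[i] (@gena 1 i).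

Let comm_of_relator x y :
  relator_one ff fa (free_gen R[i] (genh 1)) (commutator x y) -> GRing.comm (ev x) (ev y).
Proof.
move=> rxy; have /eqP := gen_relation hK (l := 1) rxy.
by rewrite rmorph_commutator subr_eq0 => /eqP.
Qed.

Let hC : forall x, GRing.comm h x.
Proof.
apply: (central_of_gens hK); apply: gens_ind => [i|i|]; last exact: erefl.
  by apply: comm_of_relator; exact: (relator_one_hf ff).
by apply/commr_sym/comm_of_relator; exact: (relator_one_ah ff fa).
Qed.

Let aC : forall i x, GRing.comm (a i) x.
Proof.
move=> i; apply: (central_of_gens hK); apply: gens_ind => [j|j|].
- by apply: comm_of_relator; exact: (relator_one_af ff fa).
- by apply: comm_of_relator; exact: (relator_one_aa ff fa).
exact/commr_sym/hC.
Qed.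

Let com02 : commutator (f 0) (f 2) = h.
Proof.
have := gen_relation hK (l := 1) (relator_one02 ff fa (free_gen R[i] (genh 1))).
by rewrite rmorph_commutatorB => /eqP; rewrite subr_eq0 => /eqP.
Qed.

Let com21 : commutator (f 2) (f 1) = h.
Proof.
have := gen_relation hK (l := 1) (relator_one21 ff fa (free_gen R[i] (genh 1))).
by rewrite rmorph_commutatorB => /eqP; rewrite subr_eq0 => /eqP.
Qed.

Let h_unit : h \is a GRing.unit.
Proof. exact: (ev_genh_unit hK). Qed.

Let f0_unit : f 0 \is a GRing.unit.
Proof.
apply: (qsf_unit hK); apply/eqP => f0; have := com02.
rewrite f0 /commutator mul0r mulr0 subrr => h0.
by move: h_unit; rewrite -h0 unitr0.
Qed.

Let f1_unit : f 1 \is a GRing.unit.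
Proof.
apply: (qsf_unit hK); apply/eqP => f1; have := com21.
rewrite f1 /commutator mul0r mulr0 subrr => h0.
by move: h_unit; rewrite -h0 unitr0.
Qed.

Variable D : K -> K.
Hypothesis D_lin : linear D.
Hypothesis D_leib : forall x y, D (x * y) = D x * y + x * D y.
Let H := H0_one f a.
Hypothesis Da : forall i, D (a i) = bracket h H (a i).
Hypothesis Dh : D h = bracket h H h.
Hypothesis Df : deriv_f_one f a h D.

Let k := \sum_j a j.
Let D' := outer h H D.

Let D'_lin : linear D' := outer_linear h H D_lin.
Let D'_leib x y : D' (x * y) = D' x * y + x * D' y := outer_leibniz H hC D_leib x y.

Let D'a i : D' (a i) = 0.
Proof. by rewrite /D' /outer Da subrr. Qed.

Let D'h : D' h = 0.
Proof. by rewrite /D' /outer Dh subrr. Qed.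

Let D'f i : D' (f i) = (i == 0)%:R * k.
Proof. by rewrite /D' /outer Df -/H -/k addrC addKr. Qed.

Let kE : k = a 0 + a 1.
Proof. by rewrite /k !big_ord_recl big_ord0 addr0; congr (_ + a _); apply: val_inj. Qed.

Let kC x : GRing.comm k x.
Proof. by rewrite kE /GRing.comm mulrDl mulrDr !aC. Qed.

Section RankOneAction.
Variables (s : 'I_2 -> {lrmorphism K -> K}) (p : {lrmorphism K -> K}).
Hypothesis hW : weyl_action_one f a h (fun i => s i) p.

Let b := a 1 / f 1.

Let D'b : D' b = 0.
Proof.
by rewrite /b D'_leib D'a mul0r add0r (derivV D'_leib) // D'f mul0r mulr0 mul0r oppr0 mulr0.
Qed.

Let sqE : a 1 ^+ 2 / f 1 ^+ 2 = b * b.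
Proof. by rewrite /b !expr2 invrM // !mulrA -[a 1 / f 1 * a 1]mulrA -(aC 1 (f 1)^-1) !mulrA. Qed.

Let s_k : s 1 k = k.
Proof.
case: hW => _ _ _ _ _ _ _ _ sa0 sa1 _ _ _ _ _ _ _.
have sD y y' : s 1 (y + y') = s 1 y + s 1 y' by exact: rmorphD.
rewrite kE sD sa0 sa1 mulr_natl mulr2n addrA; exact: addrK.
Qed.

Let reflection_H : s 1 H = H.
Proof.
case: hW => _ _ _ sf0 sf1 sf2 _ _ _ sa1 _ _ _ _ _ _ _.
apply: (reflection_H0_one (aC 1) hC com21 _ _ _ sf1 sf2 sa1).
- exact: divrK.
- by rewrite mulrA -aC mulrK.
by rewrite sf0 sqE.
Qed.

Let rank_one_reflection_commutes x : D (s 1 x) = s 1 (D x).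
Proof.
case: (hW) => _ _ _ sf0 sf1 sf2 _ _ sa0 sa1 _ _ _ _ _ sh _.
have wH y : D' (s 1 y) = s 1 (D' y) -> D (s 1 y) = s 1 (D y).
  move=> e; apply: (commutes_through_bracket (H := H) h_unit (sh 1)).
  by rewrite reflection_H -/D' e !subrr /commutator mul0r mulr0 subrr mulr0.
apply: (commutes_of_gens hK D_lin D_leib) => g; apply: wH; move: g.
have sM y y' : s 1 (y * y') = s 1 y * s 1 y' by exact: rmorphM.
have sn (m : nat) : s 1 m%:R = m%:R by exact: rmorph_nat.
have dD := derivD D'_lin; have dB := derivB D'_lin.
apply: (gens_ind (P := fun y => D' (s 1 y) = s 1 (D' y))) => [|j|].
- apply: ord3_ind.
  + have D'f2 : D' (f 2) = 0 by rewrite D'f mul0r.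
    have D'M0 x' y : D' x' = 0 -> D' y = 0 -> D' (x' * y) = 0.
      by move=> x0 y0; rewrite D'_leib x0 y0 mul0r mulr0 addr0.
    rewrite sf0 sqE -/b dB 2!dD (D'M0 _ _ D'f2 D'b) (D'M0 _ _ D'b D'f2) (D'M0 _ _ D'b D'b).
    by rewrite !addr0 subr0 D'f sM sn s_k.
  + by rewrite sf1 D'f sM sn s_k.
  by rewrite sf2 dB -/b D'b subr0 D'f sM sn s_k.
- rewrite D'a rmorph0; move: j; apply: ord2_ind.
    by rewrite sa0 mulr_natl mulr2n !dD !D'a !addr0.
  by rewrite sa1 (derivN D'_lin) D'a oppr0.
by rewrite sh !D'h rmorph0.
Qed.

Let p_k : p k = k.
Proof.
case: hW => _ _ _ _ _ _ _ _ _ _ _ _ _ pa0 pa1 _ _.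
have pD y y' : p (y + y') = p y + p y' by exact: rmorphD.
by rewrite kE pD pa0 pa1 addrC.
Qed.

Let rotation_H : p H - H = - (k * f 2).
Proof.
case: hW => _ _ _ _ _ _ _ _ _ _ pf0 pf1 pf2 _ pa1 _ _.
by rewrite kE; exact: rotation_H0_one.
Qed.

Let rank_one_rotation_commutes x : D (p x) = p (D x).
Proof.
case: (hW) => _ _ _ _ _ _ _ _ _ _ pf0 pf1 pf2 pa0 pa1 _ ph.
have pM y y' : p (y * y') = p y * p y' by exact: rmorphM.
have pn (m : nat) : p m%:R = m%:R by exact: rmorph_nat.
have brE y : h^-1 * commutator (p H - H) y = h^-1 * (k * commutator y (f 2)).
  rewrite rotation_H; congr (_ * _).
  have fin (A : pzRingType) (t u v : A) : t * v = v * t ->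
      commutator (- (t * u)) v = t * commutator v u.
    by move=> tv; rewrite /commutator mulrBr (mulrA t v) tv; ncring.
  by apply: fin; exact: kC.
have kh : h^-1 * (k * h) = k by rewrite kC mulKr.
apply: (commutes_of_gens hK D_lin D_leib).
apply: (gens_ind (P := fun y => D (p y) = p (D y))) => [|j|].
- apply: ord3_ind; apply: (commutes_through_bracket (H := H) h_unit ph); rewrite -/D' brE.
  + rewrite pf0 !D'f pM pn p_k /= mul0r mul1r sub0r.
    have -> : commutator (f 1) (f 2) = - h by rewrite -com21 /commutator opprB.
    by rewrite !mulrN kh.
  + by rewrite pf1 !D'f pM pn p_k /= mul0r mul1r subr0 com02 kh.
  rewrite pf2 (derivN D'_lin) !D'f pM pn p_k /= mul0r oppr0 addr0.
  by rewrite /commutator mulNr mulrN subrr !mulr0.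
- apply: (commutes_through_bracket (H := H) h_unit ph); rewrite -/D' brE D'a rmorph0 subr0.
  have [i ->] : exists i, p (a j) = a i.
    by move: j; apply: ord2_ind; [exists 1 | exists 0].
  by rewrite D'a /commutator (aC i) subrr !mulr0.
apply: (commutes_through_bracket (H := H) h_unit ph); rewrite -/D' brE ph.
by rewrite D'h rmorph0 /commutator (hC (f 2)) !subrr !mulr0.
Qed.

Let intertwine i x : s (ordS i) (p x) = p (s i x).
Proof.
have [pf pa] := rotation_reflection_one hW f0_unit f1_unit.
apply: (intertwine_of_gens hK); apply: (gens_ind
  (P := fun y => s (ordS i) (p y) = p (s i y))) => [j|j|] //.
by case: hW => _ _ _ _ _ _ _ _ _ _ _ _ _ _ _ sh ph; rewrite ph !sh ph.
Qed.

Lemma rank_one_commutes w : bijective p ->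
  extended_affine_weyl_group (fun i => s i) p w -> forall x, D (w x) = w (D x).
Proof.
move=> p_bij.
have Ds := @commutes_reflections K 1 D (fun i => s i) p p_bij intertwine
  rank_one_rotation_commutes 1 rank_one_reflection_commutes.
exact: (@commutes_weyl_group K 1 D (fun i => s i) p rank_one_rotation_commutes w Ds).
Qed.

End RankOneAction.
End RankOneTheorem.

Theorem theorem1p2 (R : realType) (l : nat) (hl : (1 <= l)%N)
    (K : unitAlgType R[i]) (ev : {lrmorphism free_alg R[i] l -> K})
    (hK : is_quotient_skew_field ev) :
  let f := fun i : 'I_(nf l) => ev (free_gen R[i] (genf i)) in
  let a := fun i : 'I_l.+1 => ev (free_gen R[i] (gena i)) in
  let h := ev (free_gen R[i] (genh l)) in
  forall (D : K -> K) (hD : is_hamiltonian_derivation f a h D)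
    (s : 'I_l.+1 -> {lrmorphism K -> K}) (pi : {lrmorphism K -> K})
    (hs : forall i, bijective (s i)) (hpi : bijective pi)
    (hW : weyl_action f a h (fun i => s i) pi)
    (w : K -> K) (hw : extended_affine_weyl_group (fun i => s i) pi w) (phi : K),
  D (w phi) = w (D phi).
Proof.
move=> f a h D [D_lin D_leib Da Dh Df] s pi s_bij pi_bij hW w hw.
case: l hl ev hK @f @a @h D_lin D_leib Da Dh Df s s_bij hW hw => [//|[|n]] _ ev hK.
  move=> f a h D_lin D_leib Da Dh Df s _ hW hw.
  exact: (rank_one_commutes hK D_lin D_leib Da Dh Df hW pi_bij hw).
move=> f a h D_lin D_leib Da Dh Df s s_bij hW hw.
exact: (higher_rank_commutes hK D_lin D_leib Da Dh Df s_bij pi_bij hW hw).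
Qed.
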